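(* Let $k\ge1$ be an integer and $r>0$. Consider the model $dy_t=S(t)dt+d\xi_t$, $0\le t\le n$, where for each $n\ge1$ the distribution of $(\xi_t)_{0\le t\le n}$ belongs to a family $\mathcal{Q}_n$ such that $\mathcal{Q}_n\subseteq\{Q:\ \mathbf{L}_{1,n}(Q)+\mathbf{L}_{2,n}(Q)\le l_n\}$, $$0<\varsigma_*:=\inf_{Q\in\mathcal{Q}_n}\varsigma_Q\le\sup_{Q\in\mathcal{Q}_n}\varsigma_Q=:\varsigma^*<\infty,\qquad \sigma^*:=\sup_{Q\in\mathcal{Q}_n}\sigma_Q<\infty ,$$ and such that $\mathcal{Q}_n$ contains the distribution $Q_0$ of the Wiener process with scale parameter $\varsigma^*$ (i.e. of $\sqrt{\varsigma^*}\,w_t$, $w$ a standard Brownian motion). Let $\Pi_n$ be the set of all estimators $\widehat S_n$ measurable with respect to $\sigma\{y_t,\ 0\le t\le n\}$. Then $$\lim_{n\to\infty}\,n^{2k/(2k+1)}\inf_{\widehat S_n\in\Pi_n}\ \sup_{S\in W^k_r}\mathcal{R}^*_n(\widehat S_n,S)=R^*_k,\qquad R^*_k=\bigl((2k+1)r\bigr)^{1/(2k+1)}\left(\frac{\varsigma^*k}{(k+1)\pi}\right)^{2k/(2k+1)},$$ where $W^k_r$ is the Sobolev ball defined in the context.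
   Context: Sobolev ball: $W^k_r=\{f\in\mathcal{C}^k_{per}[0,1]:\ \sum_{j=0}^k\|f^{(j)}\|^2\le r\}$, where $\mathcal{C}^k_{per}[0,1]$ is the set of $k$ times continuously differentiable $f:[0,1]\to\mathbb{R}$ with $f^{(i)}(0)=f^{(i)}(1)$ for $0\le i\le k$ (extended 1-periodically), and $\|f\|^2=\int_0^1f^2(t)dt$. Model: $n$ is a positive integer, $S$ is an unknown 1-periodic function in $L_2[0,1]$, and $(\xi_t)_{0\le t\le n}$ is an unobservable semimartingale with values in the Skorokhod space $\mathcal{D}[0,n]$ whose distribution $Q$ belongs to a family $\mathcal{Q}_n$ of probability measures on $\mathcal{D}[0,n]$. For every $Q\in\mathcal{Q}_n$ and $f\in L_2[0,n]$ the integral $I_n(f)=\int_0^nf_s\,d\xi_s$ is well defined with $\mathbf{E}_QI_n(f)=0$ and $\mathbf{E}_QI_n^2(f)\le\sigma_Q\int_0^nf_s^2ds$, for a constant $\sigma_Q>0$ attached to $Q$. $\mathbf{E}_{Q,S}$ is expectation under the law of $(y_t)_{0\le t\le n}$. Risks: $\mathcal{R}_Q(\widehat S,S)=\mathbf{E}_{Q,S}\|\widehat S-S\|^2$, and robust risk $\mathcal{R}^*_n(\widehat S,S)=\sup_{Q\in\mathcal{Q}_n}\mathcal{R}_Q(\widehat S,S)$. Basis: $\phi_1=1$ and, for $j\ge2$, $\phi_j(x)=\sqrt2\cos(2\pi[j/2]x)$ for even $j$, $\sqrt2\sin(2\pi[j/2]x)$ for odd $j$ ($[\cdot]$ integer part).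 $\xi_{j,n}=n^{-1/2}I_n(\phi_j)$. For a sequence $x=(x_j)$, $|x|^2=\sum_jx_j^2$, $\#(x)=\sum_j\mathbf{1}_{\{|x_j|>0\}}$. To each $Q$ is attached a constant $\varsigma_Q>0$ with $$\mathbf{L}_{1,n}(Q)=\sup_{x\in[-1,1]^\infty,\ \#(x)\le n}\Bigl|\sum_{j\ge1}x_j(\mathbf{E}_Q\xi_{j,n}^2-\varsigma_Q)\Bigr|<\infty,\qquad \mathbf{L}_{2,n}(Q)=\sup_{|x|\le1,\ \#(x)\le n}\mathbf{E}_Q\Bigl(\sum_{j\ge1}x_j(\xi_{j,n}^2-\mathbf{E}_Q\xi_{j,n}^2)\Bigr)^2<\infty .$$ $(l_n)$ is a fixed positive increasing sequence with $l_n\to\infty$ and $l_n/n^\delta\to0$ for every $\delta>0$. The constants $\varsigma_*,\varsigma^*,\sigma^*$ do not depend on $n$. *)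

(* Defs.v *)
From HB Require Import structures.
From mathcomp Require Import all_boot all_order all_algebra.
From mathcomp Require Import all_classical all_reals all_analysis.
Set Implicit Arguments.
Unset Strict Implicit.
Unset Printing Implicit Defensive.
Import Order.TTheory GRing.Theory Num.Theory.
Import numFieldNormedType.Exports.
Local Open Scope classical_set_scope.
Local Open Scope ring_scope.

Section cadlag_functions.
Context {R : realType}.
Implicit Types (T t s : R) (f : R -> R).

Definition cadlag T f : Prop :=
  (forall t, 0 <= t < T -> f s @[s --> t^'+] --> f t) /\
  (forall t, 0 < t <= T -> cvg (f s @[s --> t^'-])).

Definition clamp T t : R := Num.max 0 (Num.min t T).

Lemma clampE T t : 0 <= t <= T -> clamp T t = t.
Proof. by move=> /andP[t0 tn]; rewrite /clamp (min_idPl tn) (max_idPr t0). Qed.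

Lemma clamp_itv T t : 0 <= T -> 0 <= clamp T t <= T.
Proof. by move=> T0; rewrite /clamp le_max lexx/= ge_max T0 ge_min lexx orbT. Qed.

Lemma cadlag_cst T c : cadlag T (cst c).
Proof. by split=> t _; [exact: cvg_cst | exact: is_cvg_cst]. Qed.

Lemma cadlag_clamp T f : cadlag T f -> cadlag T (f \o clamp T).
Proof.
move=> [fr fl]; split=> t /andP[t0 tT].
- rewrite /= clampE ?t0 ?ltW//.
  apply: cvg_trans (fr t _); last by rewrite t0 tT.
  apply: near_eq_cvg; near=> s; rewrite /= clampE//; apply/andP; split.
    by apply: (le_trans t0); near: s; exact: nbhs_right_ge.
  by near: s; exact: nbhs_right_le.
- apply: (@cvgP _ _ (lim (f s @[s --> t^'-]))).
  apply: cvg_trans (fl t _); last by rewrite t0 tT.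
  apply: near_eq_cvg; near=> s; rewrite /= clampE//; apply/andP; split.
    by near: s; exact: nbhs_left_ge.
  by apply: le_trans tT; near: s; exact: nbhs_left_le.
Unshelve. all: by end_near. Qed.

Lemma cadlagD T f g : cadlag T f -> cadlag T g -> cadlag T (f \+ g).
Proof.
move=> [fr fl] [gr gl]; split=> t tT.
- by apply: cvgD; [exact: fr | exact: gr].
- by apply: is_cvgD; [exact: fl | exact: gl].
Qed.

Lemma cadlag_within_continuous T f :
  {within `[0, T], continuous f} -> cadlag T f.
Proof.
have [T0 cf|T0 _] := ltP 0 T; last first.
  by split=> t /andP[t0 tT]; [have := le_lt_trans t0 tT|have := lt_le_trans t0 tT];
    rewrite ltNge T0.
have [ci c0 cT] := (continuous_within_itvP f T0).1 cf.
split=> t /andP[].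
- rewrite le_eqVlt => /predU1P[<- _//|t0 tT].
  by apply: cvg_at_right_filter; apply: ci; rewrite in_itv/= t0.
- move=> t0; rewrite le_eqVlt => /predU1P[->|tT]; first exact: cvgP cT.
  apply: (@cvgP _ _ (f t)).
  by apply: cvg_at_left_filter; apply: ci; rewrite in_itv/= t0.
Qed.

End cadlag_functions.

(* The path space D[0,n]. A path is stored as a function on the whole line,
   constant on ]-oo, 0] and on [n, +oo[, so that equality of elements is
   equality of the paths on [0,n]. *)
Record skorokhod (R : realType) (n : nat) := Skorokhod {
  traj :> R -> R ;
  traj_cadlag : cadlag n%:R traj ;
  traj_clamp : forall t, traj t = traj (clamp n%:R t) }.

Section skorokhod_structure.
Context {R : realType} {n : nat}.
Local Notation D := (skorokhod R n).

HB.instance Definition _ := gen_eqMixin D.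
HB.instance Definition _ := gen_choiceMixin D.

Lemma skorokhod_eq (x y : D) :
  (forall t, 0 <= t <= n%:R -> x t = y t) -> x = y.
Proof.
move=> xy; have {}xy : traj x = traj y.
  by apply/funext => t; rewrite traj_clamp xy ?clamp_itv// -traj_clamp.
case: x y xy => [f cf ef] [g cg eg] /= fg; case: _ / fg cg eg => cg eg.
by rewrite (Prop_irrelevance cf cg) (Prop_irrelevance ef eg).
Qed.

Definition zero_traj : D :=
  Skorokhod (@cadlag_cst R n%:R 0) (fun=> erefl).

HB.instance Definition _ := isPointed.Build D zero_traj.

(* The Borel sigma-algebra of the Skorokhod topology is the one generated by
   the coordinate maps. *)
Definition cylinders : set (set D) :=
  [set [set x : D | B (x t)] | t in `[0, n%:R]%classic & B in measurable].

HB.instance Definition _ := @isMeasurable.Build (sigma_display cylinders)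
  D <<s cylinders >> (@sigma_algebra0 _ setT cylinders)
  (@sigma_algebraC D cylinders) (@sigma_algebra_bigcup _ setT cylinders).

Lemma traj_of_clamp (f : R -> R) t :
  (f \o clamp n%:R) t = (f \o clamp n%:R) (clamp n%:R t).
Proof. by rewrite /= [in RHS]clampE// clamp_itv. Qed.

(* The restriction of f to [0,n] as a path; junk if f is not cadlag. *)
Definition traj_of (f : R -> R) : D :=
  match pselect (cadlag n%:R f) with
  | left cf => Skorokhod (cadlag_clamp cf) (traj_of_clamp f)
  | right _ => zero_traj
  end.

Lemma traj_ofE (f : R -> R) t :
  cadlag n%:R f -> 0 <= t <= n%:R -> traj_of f t = f t.
Proof. by move=> cf tn; rewrite /traj_of; case: pselect => //= _; rewrite clampE. Qed.

End skorokhod_structure.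

Section function_spaces.
Context {R : realType}.
Local Notation mu := (@lebesgue_measure R).

Definition L2fun (T : R) (f : R -> R) : Prop :=
  measurable_fun `[0, T] f /\
  (\int[mu]_(s in `[0%R, T]) ((f s) ^+ 2)%:E < +oo)%E.

Definition norm2 (f : R -> R) : \bar R :=
  (\int[mu]_(t in `[0%R, 1%R]) ((f t) ^+ 2)%:E)%E.

(* A function on [0,1] is represented by its 1-periodic extension; the
   conditions f^(i)(0) = f^(i)(1) say that this extension is C^k on the line. *)
Definition Cper (k : nat) (f : R -> R) : Prop :=
  [/\ forall t, f (t + 1) = f t,
      forall i t, (i < k)%N -> derivable (derive1n i f) t 1 &
      continuous (derive1n k f)].

Definition sobolev (k : nat) (r : R) : set (R -> R) :=
  [set f | Cper k f /\ (\sum_(j < k.+1) norm2 (derive1n j f) <= r%:E)%E].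

Definition trig_basis (j : nat) (x : R) : R :=
  if (j <= 1)%N then 1
  else if odd j then Num.sqrt 2 * sin (2 * pi * (j./2)%:R * x)
  else Num.sqrt 2 * cos (2 * pi * (j./2)%:R * x).

End function_spaces.

Section semimartingale.
Context {R : realType} {n : nat}.
Local Notation D := (skorokhod R n).
Implicit Types (Q : probability D R) (F : R -> set (set D)) (X : R -> D -> R).

Definition filtration F : Prop :=
  [/\ forall t, 0 <= t <= n%:R ->
        sigma_algebra [set: D] (F t) /\ F t `<=` measurable,
      forall s t, 0 <= s -> s <= t -> t <= n%:R -> F s `<=` F t &
      forall t A, 0 <= t < n%:R ->
        (forall s, t < s <= n%:R -> F s A) -> F t A].

Definition adapted F X : Prop :=
  forall t, 0 <= t <= n%:R -> forall B, measurable B -> F t (X t @^-1` B).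

Definition martingale Q F X : Prop :=
  [/\ adapted F X,
      forall t, 0 <= t <= n%:R -> Q.-integrable setT (EFin \o X t) &
      forall s t A, 0 <= s -> s <= t -> t <= n%:R -> F s A ->
        (\int[Q]_(x in A) (X t x)%:E = \int[Q]_(x in A) (X s x)%:E)%E].

Definition stopping_time F (tau : D -> R) : Prop :=
  (forall x, 0 <= tau x) /\
  (forall t, 0 <= t <= n%:R -> F t [set x | tau x <= t]).

Definition local_martingale Q F X : Prop :=
  [/\ adapted F X,
      {ae Q, forall x, cadlag n%:R (X^~ x)} &
      exists tau : nat -> D -> R,
        [/\ forall m, stopping_time F (tau m),
            {ae Q, forall x, forall m, tau m x <= tau m.+1 x},
            {ae Q, forall x, exists m, n%:R <= tau m x} &
            forall m, martingale Q F
              (fun t x => X (Num.min t (tau m x)) x - X 0 x)]].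

Definition finite_variation Q F X : Prop :=
  [/\ adapted F X,
      {ae Q, forall x, cadlag n%:R (X^~ x)} &
      {ae Q, forall x, bounded_variation 0 n%:R (X^~ x)}].

(* The coordinate process of D[0,n] is a semimartingale under Q. As the
   sigma-algebras are not completed, path properties hold almost surely. *)
Definition semimartingale Q : Prop :=
  exists F M A,
    [/\ filtration F, adapted F (fun t x => x t),
        local_martingale Q F M, finite_variation Q F A &
        {ae Q, forall x, M 0 x = 0 /\ A 0 x = 0 /\
           forall t, 0 <= t <= n%:R -> x t = x 0 + M t x + A t x}].

(* I f is the stochastic integral over ]0,n] of the deterministic integrand f
   against the coordinate process, for every f in L_2[0,n]: the extension of
   the elementary integral that is linear and satisfies the dominated
   convergence theorem in probability, which determines I f almost surely. *)
Definition stochastic_integral Q (I : (R -> R) -> D -> R) : Prop :=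
  [/\ forall f, L2fun n%:R f -> measurable_fun setT (I f),
      forall a b, 0 <= a -> a <= b -> b <= n%:R ->
        {ae Q, forall x : D, I (\1_(`]a, b]%classic)) x = x b - x a},
      forall c f g, L2fun n%:R f -> L2fun n%:R g ->
        {ae Q, forall x, I (fun s => c * f s + g s) x = c * I f x + I g x} &
      forall (f : nat -> R -> R) g h,
        (forall m, L2fun n%:R (f m)) -> L2fun n%:R g -> L2fun n%:R h ->
        (forall s, 0 < s <= n%:R -> f m s @[m --> \oo] --> g s) ->
        (forall m s, 0 < s <= n%:R -> `|f m s| <= h s) ->
        forall e, 0 < e ->
          Q [set x | e <= `|I (f m) x - I g x|] @[m --> \oo] --> 0%E].

(* The law of sqrt c * w on [0,n], w being a standard Brownian motion. *)
Definition wiener (c : R) Q : Prop :=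
  [/\ {ae Q, forall x : D, x 0 = 0},
      {ae Q, forall x : D, {within `[0, n%:R], continuous x}},
      forall s t, 0 <= s -> s < t -> t <= n%:R -> forall B, measurable B ->
        Q [set x : D | B (x t - x s)] =
          normal_prob 0 (Num.sqrt (c * (t - s))) B &
      forall (m : nat) (t : nat -> R) (B : nat -> set R),
        0 <= t 0%N -> (forall i, (i < m)%N -> t i <= t i.+1) -> t m <= n%:R ->
        (forall i, measurable (B i)) ->
        fine (Q [set x : D |
                 forall i, (i < m)%N -> B i (x (t i.+1) - x (t i))]) =
          \prod_(i < m) fine (Q [set x : D | B i (x (t i.+1) - x (t i))])].

End semimartingale.

Section noise_functionals.
Context {R : realType} {n : nat}.
Local Notation D := (skorokhod R n).
Variables (Q : probability D R) (I : (R -> R) -> D -> R).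

(* Sequences (x_j), j >= 1, are functions on nat whose value at 0 is ignored. *)
Definition seq_norm2 (x : nat -> R) : \bar R :=
  (\sum_(1 <= j <oo) ((x j) ^+ 2)%:E)%E.

Definition seq_card (x : nat -> R) : \bar R :=
  (\sum_(1 <= j <oo) ((0 < `|x j|)%R%:R)%:E)%E.

Definition noise_coef (j : nat) (w : D) : R :=
  (Num.sqrt n%:R)^-1 * I (trig_basis j) w.

Definition noise_coef_var (j : nat) : R :=
  fine 'E_Q[fun w => ((noise_coef j w) ^+ 2)%R]%E.

(* The sums over j >= 1 below have at most n nonzero terms. *)
Definition L1n (varsigma : R) : \bar R :=
  ereal_sup [set (`| \sum_(j \in [set j | (1 <= j)%N])
                       x j * (noise_coef_var j - varsigma) |)%:E
            | x in [set x : nat -> R | (forall j, (1 <= j)%N -> -1 <= x j <= 1)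
                                       /\ (seq_card x <= n%:R%:E)%E]].

Definition L2n : \bar R :=
  ereal_sup [set 'E_Q[fun w => ((\sum_(j \in [set j | (1 <= j)%N])
                       x j * ((noise_coef j w) ^+ 2 - noise_coef_var j)) ^+ 2)%R]%E
            | x in [set x : nat -> R | (seq_norm2 x <= 1)%E
                                       /\ (seq_card x <= n%:R%:E)%E]].

End noise_functionals.

Section estimation.
Context {R : realType} {n : nat}.
Local Notation D := (skorokhod R n).
Local Notation mu := (@lebesgue_measure R).

(* y_t = int_0^t S(s) ds + xi_t, as an element of D[0,n] *)
Definition observation (S : R -> R) (xi : D) : D :=
  traj_of (fun t => (\int[mu]_(s in `[0, t]) S s) + xi t).

Lemma observationE (S : R -> R) (xi : D) t :
  mu.-integrable `[0, n%:R] (EFin \o S) -> 0 <= t <= n%:R ->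
  observation S xi t = (\int[mu]_(s in `[0, t]) S s) + xi t.
Proof.
move=> iS tn; rewrite /observation traj_ofE//.
apply: (@cadlagD _ _ (fun t => \int[mu]_(s in `[0, t]) S s)).
  by apply: cadlag_within_continuous; exact: parameterized_integral_continuous.
exact: traj_cadlag.
Qed.

Lemma observation_sobolevE k r S (xi : D) t :
  sobolev k r S -> 0 <= t <= n%:R ->
  observation S xi t = (\int[mu]_(s in `[0, t]) S s) + xi t.
Proof.
move=> [[_ dS cS] _]; apply: observationE.
have cS0 : continuous S.
  case: k dS cS => [//|k] dS _ x.
  by apply: differentiable_continuous; apply/derivable1_diffP; exact: (dS 0%N).
apply: continuous_compact_integrable; first exact: segment_compact.
by apply: continuous_subspaceT.
Qed.

(* The data being an element of D[0,n], whose sigma-algebra is generated by the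
   coordinates, an estimator is a measurable function of the observed path. *)
Definition estimators : set (D -> R -> R) :=
  [set Sh | measurable_fun ([set: D] `*` [set t : R | 0 <= t <= 1])
                           (fun p : D * R => Sh p.1 p.2)].

(* The law of the observation y under (Q, S) is the image of Q by
   [observation S]. *)
Definition risk (Q : probability D R) (Sh : D -> R -> R) (S : R -> R) : \bar R :=
  (\int[Q]_xi norm2 (fun t => Sh (observation S xi) t - S t)%R)%E.

Definition robust_risk (QQ : set (probability D R)) Sh S : \bar R :=
  ereal_sup [set risk Q Sh S | Q in QQ].

Definition minimax_risk (QQ : set (probability D R)) (W : set (R -> R)) :
    \bar R :=
  ereal_inf [set ereal_sup [set robust_risk QQ Sh S | S in W]
            | Sh in estimators].

End estimation.

Definition pinsker_constant {R : realType} (k : nat) (r varsigma : R) : R :=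
  ((2 * k + 1)%:R * r) `^ ((2 * k + 1)%:R^-1) *
  (varsigma * k%:R / ((k + 1)%:R * pi)) `^ ((2 * k)%:R / (2 * k + 1)%:R).

(* Main.v *)
Require Import Defs.
From HB Require Import structures.
From mathcomp Require Import all_boot all_order all_algebra.
From mathcomp Require Import all_classical all_reals all_analysis measurable_realfun.
From mathcomp Require Import ring lra zify.

(** Pinsker's theorem. In the trigonometric basis the loss is the squared l^2
    distance between coefficient sequences, the sup over the Sobolev ball is a
    sup over (essentially) an ellipsoid whose weight at the frequency m is
    (2 pi m)^(2k), and the observation amounts to the coefficients of S plus
    noises of variance about varsigma / n. For such ellipsoids a linear filter
    and a Gaussian prior with matching shapes have asymptotically equal risks.

    Upper bound ([pinsker_estimator_risk], [minimax_upper_bound]). The j-th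
    empirical coefficient, of frequency m = [j/2], is multiplied by
    1 - (m/M)^k if m < M and discarded otherwise. Its squared bias is
    (m/M)^(2k) times the squared coefficient of S below the cutoff M, and at
    most that above it, so that the total is at most r / (2 pi M)^(2k) because
    the k-th derivative of S has energy at most r. This uses Parseval's
    identity, obtained from an approximation of S by trigonometric polynomials
    ([parseval_tail]). The variance is at most varsigma^* times the sum of the
    squares of the filter, plus l_n, all divided by n: this is the definition
    of L_(1,n). An estimator has to be a function of the path that is the same
    for all Q, whereas I_n(phi_j) is only determined almost surely under each
    Q. The integrals against dy are therefore replaced by sums over a regular
    mesh, which are finite combinations of coordinates of the path; for n
    fixed, the effect of the mesh on the risk vanishes with its size.

    Lower bound ([minimax_lower_bound]). The sup over the noises is at least
    the risk under the Wiener noise, and the sup over the ball is compared to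
    the mean risk under a prior: independent centred Gaussian coefficients of
    variance (1 - eta) (varsigma^* / n) ((M/m)^k - 1) at the frequencies m with
    a <= m < M. Given the other coefficients, the estimation of the j-th one
    is a one-parameter problem, whose Bayes risk s^2 / (1 + n s^2 / varsigma^* )
    ([one_dimensional_bayes]) follows from the Cameron-Martin density. That
    density is only needed for functionals of finitely many times, where it is
    a product of ratios of Gaussian densities; a bounded functional of the path
    is an L^1 limit of such functionals ([bounded_approximable]). The prior
    charges the complement of the ball, but its Sobolev energy has mean at most
    (1 - eta/2) r and a variance of smaller order, so that, once the estimated
    coefficients are truncated, the functions outside the ball contribute
    O(M^(2k+1) / n^2) to the Bayes risk ([ball_lower_bound]).

    With M equivalent to kappa n^(1/(2k+1)) and kappa such that the prior has
    energy r in the limit eta = 0 ([cutoff_ratioX]), both bounds, multiplied by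
    n^(2k/(2k+1)), tend to R^*_k ([upper_rate0], [pinsker_constant_cutoff]). *)

Set Implicit Arguments.
Unset Strict Implicit.
Unset Printing Implicit Defensive.
Import Order.TTheory GRing.Theory Num.Theory.
Import numFieldNormedType.Exports.
Local Open Scope classical_set_scope.
Local Open Scope ring_scope.

(** * Gaussian integrals *)

Section monotone_class.
Context {R : realType} d d' (T : measurableType d) (U : measurableType d').
Variables (mu : {measure set T -> \bar R}) (nu : {measure set U -> \bar R}).
Import HBNNSimple.
Variables (X : T -> U) (h : T -> R) (K : R).
Hypothesis mX : measurable_fun setT X.
Hypothesis mh : measurable_fun setT h.
Hypothesis h0 : forall x, 0 <= h x.
Hypothesis indicH : forall B, measurable B ->
  (\int[mu]_x ((\1_B (X x))%:E * (h x)%:E) = K%:E * nu B)%E.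

(** The change of variables formula for a density: if the image of h mu by X
    is K nu on sets, the same holds for integrals of nonnegative functions.
    It serves for normal densities, for the increments of the Wiener process
    and for its translates. *)
Lemma integral_from_indic (f : U -> \bar R) : measurable_fun setT f ->
  (forall u, (0 <= f u)%E) ->
  (\int[mu]_x (f (X x) * (h x)%:E) = K%:E * \int[nu]_u f u)%E.
Proof.
move=> mf f0.
pose g := nnsfun_approx measurableT mf.
have sfunH (s : {nnsfun U >-> R}) :
  (\int[mu]_x ((s (X x))%:E * (h x)%:E) = K%:E * \int[nu]_u (s u)%:E)%E.
  transitivity (\int[mu]_x \sum_(r \in range s)
      (r%:E * ((\1_(s @^-1` [set r]) (X x))%:E * (h x)%:E)))%E.
    apply: eq_integral => x _.
    rewrite (fimfunE s) -fsumEFin// ge0_mule_fsuml; last first.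
      move=> r; rewrite lee_fin; have [rs|rs] := leP 0 r; first by rewrite mulr_ge0.
      by rewrite preimage_nnfun0// indicE in_set0 mulr0.
    by apply: eq_fsbigr => r _; rewrite muleA.
  rewrite ge0_integral_fsum//; last 2 first.
    move=> r; apply: emeasurable_funM => //.
    apply: emeasurable_funM; apply/measurable_EFinP => //.
    by apply: measurableT_comp.
    move=> r x _; have [rs|rs] := leP 0 r.
      by rewrite -!EFinM lee_fin !mulr_ge0.
    by rewrite preimage_nnfun0// indicE in_set0 mul0e mule0.
  rewrite integralT_nnsfun sintegralE ge0_mule_fsumr; last first.
    move=> r; have [rs|rs] := leP 0 r; first by rewrite mule_ge0.
    by rewrite preimage_nnfun0// measure0 mule0.
  apply: eq_fsbigr => r rs.
  have [r0|r0] := leP 0 r; last first.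
    rewrite preimage_nnfun0// measure0 !mule0.
    by under eq_integral do rewrite indicE in_set0 mul0e mule0; rewrite integral0.
  rewrite ge0_integralZl//; last 2 first.
    apply: emeasurable_funM; apply/measurable_EFinP => //.
    by apply: measurableT_comp.
    by move=> x _; rewrite -EFinM lee_fin mulr_ge0.
  by rewrite indicH// muleCA.
have -> : (\int[nu]_u f u = limn (fun n => \int[nu]_u (g n u)%:E))%E.
  rewrite -monotone_convergence//.
  - apply: eq_integral => u _; apply/esym/cvg_lim => //.
    exact: cvg_nnsfun_approx.
  - by move=> n; apply/measurable_EFinP; exact: measurable_funTS.
  - by move=> n u _; rewrite lee_fin.
  - by move=> u _ m n mn; rewrite lee_fin; apply/lefP/nd_nnsfun_approx.
rewrite -limeMl//; last first.
  apply: ereal_nondecreasing_is_cvgn => m n mn.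
  apply: ge0_le_integral => //.
  - by move=> u _; rewrite lee_fin.
  - by apply/measurable_EFinP; exact: measurable_funTS.
  - by apply/measurable_EFinP; exact: measurable_funTS.
  - by move=> u _; rewrite lee_fin; apply/lefP/nd_nnsfun_approx.
transitivity (limn (fun n => \int[mu]_x ((g n (X x))%:E * (h x)%:E)))%E; last first.
  by congr (limn _); apply/funext => n; rewrite sfunH.
rewrite -monotone_convergence//.
- apply: eq_integral => x _; apply/esym/cvg_lim => //.
  by apply: cvgeZr => //; exact: cvg_nnsfun_approx.
- move=> n; apply: emeasurable_funM; apply/measurable_EFinP => //.
  by apply: measurableT_comp.
- by move=> n x _; rewrite mule_ge0// lee_fin.
- move=> x _ m n mn; rewrite lee_wpmul2r ?lee_fin//.
  by apply/lefP/nd_nnsfun_approx.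
Qed.
End monotone_class.

Section tonelli.
Context {R : realType} d1 d2 (T1 : measurableType d1) (T2 : measurableType d2).
Variables (m1 : {sigma_finite_measure set T1 -> \bar R}).
Variables (m2 : {sigma_finite_measure set T2 -> \bar R}).
Variables (f : T1 -> T2 -> \bar R).
Hypothesis mf : measurable_fun setT (fun p : T1 * T2 => f p.1 p.2).
Hypothesis f0 : forall x y, (0 <= f x y)%E.

Lemma measurable_integral_snd :
  measurable_fun setT (fun x => \int[m2]_y f x y)%E.
Proof.
apply: (@measurable_fun_fubini_tonelli_F _ _ _ _ _ m2 (fun p => f p.1 p.2)) => //.
Qed.

Lemma tonelli_swap :
  (\int[m1]_x \int[m2]_y f x y = \int[m2]_y \int[m1]_x f x y)%E.
Proof.
apply: (@fubini_tonelli _ _ _ _ _ m1 m2 (fun p => f p.1 p.2)) => //.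
Qed.
End tonelli.

Lemma cvge_exists_gt {R : realType} (u : (\bar R)^nat) (l m : \bar R) :
  u @ \oo --> l -> (m < l)%E -> exists N, (m < u N)%E.
Proof.
move=> ul ml; apply: contrapT => h.
suff : (l <= m)%E by rewrite leNgt ml.
rewrite -(cvg_lim _ ul)//; apply: lime_le; first by apply/cvg_ex; exists l.
by apply: nearW => N; rewrite leNgt; apply/negP => uN; apply: h; exists N.
Qed.

Lemma prob_integral_cst {R : realType} d (T : measurableType d)
  (P : probability T R) (c : \bar R) : (\int[P]_x c = c)%E.
Proof.
rewrite (_ : (fun=> c) = cst c)// integral_cst//.
by rewrite [X in (_ * X)%E](@probability_setT _ _ _ P) mule1.
Qed.

Ltac mfun1 :=
  lazymatch goal with
  | |- measurable_fun _ (fun x => @EFin _ _) => apply/measurable_EFinP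
  | |- measurable_fun _ (EFin \o _) => apply/measurable_EFinP
  | |- measurable_fun _ (fun x => @GRing.add _ _ (@GRing.opp _ _)) =>
      first [apply: measurable_funB | apply: emeasurable_funB]
  | |- measurable_fun _ (fun x => @GRing.add _ _ _) =>
      first [apply: measurable_funD | apply: emeasurable_funD]
  | |- measurable_fun _ (fun x => @GRing.mul _ _ _) => apply: measurable_funM
  | |- measurable_fun _ (fun x => @mule _ _ _) => apply: emeasurable_funM
  | |- measurable_fun _ (fun x => @GRing.opp _ _) =>
      first [apply: measurable_funN | apply: measurableT_comp]
  | |- measurable_fun _ (fun x => @GRing.exp _ _ _) => apply: measurable_funX
  | |- measurable_fun _ (fun x => @expR _ _) =>
      apply: measurableT_comp; first exact: measurable_expR
  end.
Ltac mfun := repeat (first [done | mfun1]).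
Ltac pos1 :=
  first [ done | (apply: ltW; done) | exact: sqr_ge0 | exact: exprn_even_ge0 | exact: expR_ge0 | exact: normal_pdf_ge0
  | apply: mulr_ge0 | apply: mule_ge0 | apply: addr_ge0 | apply: adde_ge0
  | rewrite lee_fin ].
Ltac pos := repeat pos1.
Ltac side := try (solve [done | mfun | by move=> *; pos | by pos]).

Section gaussian_integrals.
Context {R : realType}.
Local Notation mu := (@lebesgue_measure R).

Lemma integral_normal (m s : R) (f : R -> \bar R) : measurable_fun setT f ->
  (forall u, (0 <= f u)%E) ->
  (\int[normal_prob m s]_u f u = \int[mu]_u (f u * (normal_pdf m s u)%:E))%E.
Proof.
move=> mf f0; rewrite -[LHS]mul1e -(@integral_from_indic R _ _ _ _ mu (normal_prob m s) idfun
  (normal_pdf m s) 1 (@measurable_id _ _ setT) (measurable_normal_pdf m s)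
  (normal_pdf_ge0 m s))// => B mB. rewrite mul1e /normal_prob [RHS]integral_mkcond.
apply: eq_integral => u _; rewrite patchE indicE.
by case: (u \in B); rewrite ?mul1e ?mul0e.
Qed.

Lemma integral_lebesgue_translate (a : R) (f : R -> \bar R) :
  measurable_fun setT f -> (forall u, (0 <= f u)%E) ->
  (\int[mu]_u f (u + a)%R = \int[mu]_u f u)%E.
Proof.
move=> mf f0.
have ma : measurable_fun [set: measurableTypeR R]
    ((fun u => u + a) : R -> measurableTypeR R).
  by apply: measurable_funD => //; exact: measurable_cst.
have := @ge0_integral_pushforward _ _ (measurableTypeR R) (measurableTypeR R) R
  _ ma mu setT f measurableT mf (fun u _ => f0 u).
rewrite preimage_setT => <-.
apply: eq_measure_integral => A mA _ /=.
apply/esym; apply: lebesgue_measure_unique => //= X [[x y] _ <-].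
rewrite /pushforward /=.
have -> : (fun u => u + a) @^-1` `]x, y] = `]x - a, y - a]%classic.
  by apply/seteqP; split => u /=; rewrite !in_itv/= ltrBlDr lerBrDr.
rewrite !lebesgue_measure_itv/= !lte_fin ltrD2r.
by case: ifP => // _; rewrite -!EFinB; congr EFin; ring.
Qed.

Lemma normal_pdf0E (s u : R) : 0 < s -> normal_pdf 0 s u =
  (s * Num.sqrt (pi *+ 2))^-1 * expR (- u ^+ 2 / (2 * s ^+ 2)).
Proof.
move=> s0; rewrite normal_pdfE ?gt_eqF// /normal_peak /normal_fun subr0.
rewrite -mulrnAr sqrtrM ?sqr_ge0// sqrtr_sqr gtr0_norm//.
by rewrite mulr_natl.
Qed.

(** The one-dimensional Cameron-Martin formula: completing the square in the
    normal density. *)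
Lemma normal_shift (s a : R) (f : R -> \bar R) : 0 < s ->
  measurable_fun setT f -> (forall u, (0 <= f u)%E) ->
  (\int[normal_prob 0 s]_u f (u + a)%R =
   \int[normal_prob 0 s]_u
      (f u * (expR (a * u / s ^+ 2 - a ^+ 2 / (2 * s ^+ 2)))%:E))%E.
Proof.
move=> s0 mf f0.
have mfa : measurable_fun setT (fun u : R => f (u + a)).
  by apply: measurableT_comp => //; apply: measurable_funD.
have me : measurable_fun [set: R]
    (fun u => expR (a * u / s ^+ 2 - a ^+ 2 / (2 * s ^+ 2))).
  apply: measurableT_comp => //; apply: measurable_funB => //.
  by apply: measurable_funM => //; apply: measurable_funM.
rewrite integral_normal// integral_normal; last 2 first.
  by apply: emeasurable_funM => //; exact/measurable_EFinP.
  by move=> u; rewrite mule_ge0// lee_fin expR_ge0.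
rewrite -(@integral_lebesgue_translate a (fun u => f u *
   (expR (a * u / s ^+ 2 - a ^+ 2 / (2 * s ^+ 2)))%:E * (normal_pdf 0 s u)%:E)%E).
- apply: eq_integral => u _; rewrite -muleA -EFinM; congr (_ * _%:E)%E.
  rewrite !(normal_pdf0E _ s0) [RHS]mulrCA -expRD; congr (_ * expR _).
  by field; rewrite gt_eqF.
- apply: emeasurable_funM => //.
    by apply: emeasurable_funM => //; exact/measurable_EFinP.
  by apply/measurable_EFinP; exact: measurable_normal_pdf.
- move=> u; rewrite !mule_ge0// lee_fin ?expR_ge0//.
  exact: normal_pdf_ge0.
Qed.

(** Completing the square turns the integrand into a multiple of another
    normal density, of variance s^2. All Gaussian moments and posterior
    quantities below are read off this single integral. *)
Lemma normal_exp_quadratic (s z : R) : 0 < s ->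
  (\int[normal_prob 0 1]_u (expR (u * z - u ^+ 2 * (s ^- 2 - 1) / 2))%:E =
   (s * expR (z ^+ 2 * s ^+ 2 / 2))%:E)%E.
Proof.
move=> s0.
have me : measurable_fun [set: R]
    (fun u => expR (u * z - u ^+ 2 * (s ^- 2 - 1) / 2)).
  by mfun.
rewrite integral_normal; last 2 first.
  exact/measurable_EFinP.
  by move=> u; rewrite lee_fin expR_ge0.
transitivity (\int[mu]_u ((s * expR (z ^+ 2 * s ^+ 2 / 2))%:E *
    (normal_pdf (z * s ^+ 2) s u)%:E))%E.
  apply: eq_integral => u _; rewrite -!EFinM; congr EFin.
  rewrite normal_pdf0E// normal_pdfE ?gt_eqF// /normal_peak /normal_fun.
  rewrite -mulrnAr sqrtrM ?sqr_ge0// sqrtr_sqr gtr0_norm// mul1r.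
  rewrite mulrCA -expRD [in RHS]invfM !mulrA -[s * _ / s]mulrAC divff ?gt_eqF// mul1r.
  rewrite mulrAC -[RHS]mulrAC -expRD mulrC; congr (expR _ * _).
  by rewrite -mulr_natl; field; rewrite gt_eqF.
rewrite ge0_integralZl//; last 3 first.
  by apply/measurable_EFinP; exact: measurable_normal_pdf.
  by move=> u _; rewrite lee_fin normal_pdf_ge0.
  by rewrite lee_fin mulr_ge0 ?expR_ge0// ltW.
by rewrite integral_normal_pdf mule1.
Qed.

(** The moment is the derivative at 0 of the exponential moments of u^2. The
    inequality 1 + x <= exp x replaces the differentiation: for every s > 1 it
    bounds the moment by 2 s^2 / (s + 1), and s tends to 1. *)
Lemma normal_second_moment : (\int[normal_prob 0 1]_u (u ^+ 2)%:E <= (1 : R)%:E)%E.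
Proof.
set m2 := (\int[_]_u _)%E.
have m20 : (0 <= m2)%E by apply: integral_ge0 => u _; rewrite lee_fin sqr_ge0.
have key (s : R) : 1 < s -> (m2 <= (2 * s ^+ 2 / (s + 1))%:E)%E.
  move=> s1; have s0 : 0 < s by apply: lt_trans s1.
  pose c := (1 - s ^- 2) / 2.
  have c0 : 0 < c by rewrite divr_gt0// subr_gt0 invf_lt1 ?exprn_gt0// exprn_egt1.
  have : (c%:E * m2 + 1 <= s%:E)%E.
    have := normal_exp_quadratic 0 s0.
    rewrite expr0n /= !mul0r expR0 mulr1 => <-.
    rewrite -ge0_integralZl//; last 3 first.
      by apply/measurable_EFinP.
      by move=> u _; rewrite lee_fin sqr_ge0.
      by rewrite lee_fin ltW.
    have <- : (\int[normal_prob 0 1]_(u in [set: R]) (cst 1 u) = 1)%E.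
      by rewrite integral_cst// mul1e; exact: probability_setT.
    rewrite -ge0_integralD//; last 2 first.
      by move=> u _; rewrite mule_ge0// lee_fin ?sqr_ge0// ltW.
      by apply/measurable_EFinP; apply: measurable_funM.
    apply: ge0_le_integral => //.
    - by move=> u _; rewrite /= adde_ge0// mule_ge0// lee_fin ?sqr_ge0// ltW.
    - by apply/measurable_EFinP; apply: measurable_funD => //; apply: measurable_funM.
    - apply/measurable_EFinP/measurableT_comp => //; apply: measurable_funB => //.
        exact: measurable_funM.
      by do 2 apply: measurable_funM => //.
    - move=> u _; rewrite /= -EFinM -EFinD lee_fin.
      apply: le_trans (expR_ge1Dx _); rewrite addrC lerD2l mulr0 sub0r /c.
      by rewrite le_eqVlt; apply/orP; left; apply/eqP; field; rewrite gt_eqF.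
  case: m2 m20 => [x|_|//]; last by rewrite gt0_muley ?lte_fin.
  rewrite lee_fin => x0; rewrite -EFinM -EFinD !lee_fin => h.
  rewrite -(ler_pM2l c0).
  have -> : c * (2 * s ^+ 2 / (s + 1)) = s - 1.
    by rewrite /c; field; rewrite !gt_eqF//= ?addr_gt0.
  by lra.
case: m2 m20 key => [x|_ /(_ 2 (ltr1n _ 2))|//]; last by rewrite leye_eq.
rewrite lee_fin => x0 key; rewrite lee_fin; apply/ler_addgt0Pr => e e0.
have := key (1 + e / (e + 2)); rewrite lee_fin => /(_ _)/le_trans; apply.
  by rewrite ltrDl divr_gt0// addr_gt0.
rewrite ler_pdivrMr; last by rewrite !addr_gt0// divr_gt0// addr_gt0.
set t := e / _.
have t0 : 0 < t by rewrite divr_gt0// addr_gt0.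
have et : e = t * (e + 2) by rewrite /t; field; rewrite gt_eqF// addr_gt0.
nra.
Qed.

(** u^4 is dominated by a multiple of exp (u^2 / 4), of explicit mean. The value 64, far from the
    optimal 3, only enters terms that vanish in the limit. *)
Lemma normal_fourth_moment : (\int[normal_prob 0 1]_u (u ^+ 4)%:E <= (64 : R)%:E)%E.
Proof.
have s0 : 0 < Num.sqrt (2 : R) by rewrite sqrtr_gt0.
apply: (@le_trans _ _ (\int[normal_prob 0 1]_u ((32 : R)%:E *
    (expR (u * 0 - u ^+ 2 * (Num.sqrt 2 ^- 2 - 1) / 2))%:E))%E).
  apply: ge0_le_integral => //.
  - by move=> u _; rewrite lee_fin exprn_even_ge0.
  - exact/measurable_EFinP.
  - apply/measurable_EFinP; apply: measurable_funM => //.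
    by mfun.
  - move=> u _; rewrite -EFinM lee_fin sqr_sqrtr// mulr0 sub0r.
    have -> : - (u ^+ 2 * (2^-1 - 1) / 2) = u ^+ 2 / 4 :> R by field.
    have t0 : 0 <= u ^+ 2 / 4 by rewrite mulr_ge0// sqr_ge0.
    have -> : u ^+ 4 = 16 * (u ^+ 2 / 4) ^+ 2 by field.
    have := expR_ge1Dxn 1 t0; set t := u ^+ 2 / 4 in t0 *.
    rewrite (_ : 2`!%:R = 2 :> R)//; lra.
rewrite ge0_integralZl; side.
rewrite normal_exp_quadratic// expr0n /= !mul0r expR0 mulr1 -EFinM lee_fin.
have : Num.sqrt 2 <= (2 : R).
  rewrite -[leRHS]ger0_norm// -sqrtr_sqr ler_sqrt; lra.
lra.
Qed.

(** With z the statistic and q the information, the weight is the likelihood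
    of u, and the posterior law of u is normal of variance (1 + q)^-1: no
    guess a has a smaller posterior squared error. As for the second moment,
    the derivative of the Gaussian integral with respect to the exponent is
    replaced by 1 + x <= exp x applied to x = - c (a - u)^2, with c tending
    to 0. *)
Lemma normal_posterior_variance (q z a : R) : 0 <= q ->
  ((1 + q)^-1%:E * \int[normal_prob 0 1]_u (expR (u * z - u ^+ 2 * q / 2))%:E <=
   \int[normal_prob 0 1]_u
     ((a - u) ^+ 2 * expR (u * z - u ^+ 2 * q / 2))%:E)%E.
Proof.
move=> q0; set Q := 1 + q; have Q0 : 0 < Q by rewrite /Q; lra.
pose I (z q : R) := (\int[normal_prob 0 1]_u (expR (u * z - u ^+ 2 * q / 2))%:E)%E.
have IE (z' q' : R) : 0 < 1 + q' -> I z' q' =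
    ((Num.sqrt (1 + q'))^-1 * expR (z' ^+ 2 / (2 * (1 + q'))))%:E.
  move=> h; have s0 : 0 < (Num.sqrt (1 + q'))^-1 by rewrite invr_gt0 sqrtr_gt0.
  have := normal_exp_quadratic z' s0.
  rewrite !exprVn invrK sqr_sqrtr ?ltW// (_ : 1 + q' - 1 = q'); last by ring.
  rewrite /I => ->; congr (_ * expR _)%:E.
  by field; rewrite gt_eqF.
set V := (leRHS); rewrite -/(I z q).
have mE (z' q' : R) : measurable_fun [set: R]
    (fun u => expR (u * z' - u ^+ 2 * q' / 2)).
  apply: measurableT_comp => //; apply: measurable_funB => //.
    exact: measurable_funM.
  by do 2 apply: measurable_funM => //.
have mV : measurable_fun [set: R]
    (fun u => (a - u) ^+ 2 * expR (u * z - u ^+ 2 * q / 2)).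
  by apply: measurable_funM => //; apply: measurable_funX; apply: measurable_funB.
have V0 : (0 <= V)%E.
  by apply: integral_ge0 => u _; rewrite lee_fin mulr_ge0 ?sqr_ge0 ?expR_ge0.
have key (t : R) : 1 < t -> ((2 / (Q * t * (t + 1)))%:E * I z q <= V)%E.
  move=> t1; have t0 : 0 < t by apply: lt_trans t1.
  pose c := Q * (t ^+ 2 - 1) / 2.
  have c0 : 0 < c by rewrite !mulr_gt0// subr_gt0 exprn_egt1.
  have h : (I z q <= c%:E * V + t^-1%:E * I z q)%E.
    apply: (@le_trans _ _ (c%:E * V +
        (expR (- c * a ^+ 2))%:E * I (z + 2 * c * a)%R (q + 2 * c)%R)%E).
      rewrite /I /V -ge0_integralZl; side.
      rewrite -ge0_integralZl; side.
      rewrite -ge0_integralD; side.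
      apply: ge0_le_integral; side.
      - move=> u _; rewrite /= -!EFinM -EFinD lee_fin -expRD.
        have -> : - c * a ^+ 2 + (u * (z + 2 * c * a) - u ^+ 2 * (q + 2 * c) / 2)
          = - (c * (a - u) ^+ 2) + (u * z - u ^+ 2 * q / 2) by field.
        rewrite [X in _ <= _ + X]expRD -subr_ge0.
        have := expR_ge1Dx (- (c * (a - u) ^+ 2)).
        have := expR_ge0 (u * z - u ^+ 2 * q / 2).
        set E := expR (u * z - _); set e := expR _; set A := (a - u) ^+ 2.
        move=> E0 eA; rewrite (_ : _ - _ = (e - (1 - c * A)) * E); last by ring.
        by rewrite mulr_ge0// subr_ge0; lra.
    apply: leeD2l.
    have Qc : 1 + (q + 2 * c) = Q * t ^+ 2 by rewrite /c /Q; field.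
    have Qt0 : 0 < Q * t ^+ 2 by rewrite mulr_gt0// exprn_gt0.
    rewrite !IE ?Qc// -!EFinM lee_fin mulrCA -expRD.
    rewrite (sqrtrM _ (ltW Q0)) sqrtr_sqr gtr0_norm// invfM -/Q.
    rewrite [(Num.sqrt Q)^-1 / t]mulrC -[leLHS]mulrA ler_pM2l ?invr_gt0// ler_pM2l ?invr_gt0 ?sqrtr_gt0// ler_expR.
    rewrite -subr_ge0.
    have -> : z ^+ 2 / (2 * Q) - (- c * a ^+ 2 +
        (z + 2 * c * a) ^+ 2 / (2 * (Q * t ^+ 2))) =
        c * (z - Q * a) ^+ 2 / (Q * (Q * t ^+ 2)).
      by rewrite /c; field; rewrite !gt_eqF.
    apply: divr_ge0; first by rewrite mulr_ge0 ?sqr_ge0// ltW.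
    by apply: ltW; rewrite mulr_gt0.
  move: h; rewrite IE//; set i := (_ * _) ; have i0 : 0 < i.
    by rewrite mulr_gt0 ?expR_gt0// invr_gt0 sqrtr_gt0.
  case: V V0 => [v|_ _|//]; last by rewrite leey.
  rewrite lee_fin => v0; rewrite -!EFinM -EFinD !lee_fin => h.
  rewrite -(ler_pM2l c0) mulrA.
  have -> : c * (2 / (Q * t * (t + 1))) = 1 - t^-1.
    by rewrite /c; field; rewrite !gt_eqF//= ?addr_gt0.
  by lra.
move: key; rewrite IE//; set i := (_ * _) ; have i0 : 0 < i.
  by rewrite mulr_gt0 ?expR_gt0// invr_gt0 sqrtr_gt0.
case: V V0 => [v|_ _|//]; last by rewrite leey.
rewrite lee_fin => v0 key; rewrite -EFinM lee_fin mulrC ler_pdivrMr//.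
apply/ler_addgt0Pr => e e0.
pose t := 1 + Num.min 1 (e / (3 * (v * Q + 1))).
have vQ : 0 < 3 * (v * Q + 1).
  by rewrite mulr_gt0// ltr_wpDl// mulr_ge0// ltW.
have t1 : 1 < t by rewrite ltrDl lt_min ltr01 divr_gt0.
have := key _ t1; rewrite -EFinM lee_fin mulrAC ler_pdivrMr; last first.
  by rewrite !mulr_gt0//; lra.
have : t <= 2 by rewrite /t (_ : 2 = 1 + 1)// lerD2l ge_min lexx.
have : (t - 1) * (3 * (v * Q + 1)) <= e.
  by rewrite -ler_pdivlMr// /t addrAC subrr add0r ge_min lexx orbT.
have : 0 <= v * Q by rewrite mulr_ge0// ltW.
rewrite (_ : v * (Q * t * (t + 1)) = (v * Q) * (t * (t + 1))); last by ring.
set x := v * Q; nra.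
Qed.

End gaussian_integrals.

(** * The Gaussian product prior *)

Section product_prior.
Context {R : realType}.
Local Notation mR := (measurableTypeR R).
Local Notation N01 := (@normal_prob R 0 1).

Lemma tuple_prior_step d (P : probability (d.-tuple mR) R) :
  exists P' : probability (d.+1.-tuple mR) R,
    forall f : d.+1.-tuple mR -> \bar R, measurable_fun setT f ->
      (forall t, (0 <= f t)%E) ->
      (\int[P']_t f t = \int[N01]_a \int[P]_t f [the d.+1.-tuple _ of a :: t])%E.
Proof.
pose F (p : mR * d.-tuple mR) : d.+1.-tuple mR := [the d.+1.-tuple _ of p.1 :: p.2].
have mF : measurable_fun setT F by apply: measurable_cons.
pose m := measure_function_pushforward__canonical__measure_function_Measure
   (product_measure1 N01 P) mF.
have m1 : m setT = 1%E.
  rewrite /m /= /pushforward preimage_setT.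
  exact: (@probability_setT _ _ _ (N01 \x P)%E).
pose P' : probability _ _ := HB.pack (Measure.sort m) (Measure_isProbability.Build _ _ _ m m1).
exists P' => f mf f0.
transitivity (\int[m]_t f t)%E; first by [].
rewrite ge0_integral_pushforward//= preimage_setT.
rewrite (@fubini_tonelli1 _ _ _ _ _ N01 P (f \o F))//.
  exact: measurableT_comp.
by move=> x; rewrite /=.
Qed.

Fixpoint tuple_prior d : probability (d.-tuple mR) R :=
  match d with
  | 0 => [the probability _ _ of \d_([tuple] : 0.-tuple mR)]
  | d'.+1 => projT1 (cid (tuple_prior_step (tuple_prior d')))
  end.

Lemma integral_tuple_priorS d (f : d.+1.-tuple mR -> \bar R) :
  measurable_fun setT f -> (forall t, (0 <= f t)%E) ->
  (\int[tuple_prior d.+1]_t f t =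
   \int[N01]_a \int[tuple_prior d]_t f [the d.+1.-tuple _ of a :: t])%E.
Proof. by rewrite /=; case: cid => P' /= h mf f0; exact: h. Qed.

Definition tuple_set d (t : d.-tuple mR) (j : 'I_d) (u : mR) : d.-tuple mR :=
  [tuple if i == j then u else tnth t i | i < d].

Lemma measurable_tuple_set d e (T : measurableType e) (t : T -> d.-tuple mR)
    (j : 'I_d) (u : T -> mR) :
  measurable_fun setT t -> measurable_fun setT u ->
  measurable_fun setT (fun x => tuple_set (t x) j (u x)).
Proof.
move=> mt mu; apply/measurable_fun_tnthP => i.
rewrite (_ : _ \o _ = if i == j then u else (fun x => tnth (t x) i)).
  case: (i == j) => //.
  exact: (measurableT_comp (@measurable_tnth _ mR d i)).
by apply/funext => x /=; rewrite tnth_mktuple; case: ifP.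
Qed.

(** Independence of the coordinates, in the form used by the coordinatewise
    Bayes argument: the j-th coordinate can be drawn afresh. *)
Lemma tuple_prior_resample d (j : 'I_d) (f : d.-tuple mR -> \bar R) :
  measurable_fun setT f -> (forall t, (0 <= f t)%E) ->
  (\int[tuple_prior d]_t f t =
   \int[tuple_prior d]_t \int[N01]_u f (tuple_set t j u))%E.
Proof.
elim: d j f => [[]//|d IH] j f mf f0.
have mfc a : measurable_fun setT (fun t : d.-tuple mR => f [the d.+1.-tuple _ of a :: t]).
  by apply: measurableT_comp => //; apply: measurable_cons.
have mset : measurable_fun setT
    (fun p : d.+1.-tuple mR * mR => f (tuple_set p.1 j p.2)).
  by apply: measurableT_comp => //; exact: measurable_tuple_set.
rewrite integral_tuple_priorS// integral_tuple_priorS//; last 2 first.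
  by apply: (@measurable_integral_snd _ _ _ _ _ N01 (fun t u => f (tuple_set t j u))).
  by move=> t; apply: integral_ge0.
have set0 (a : mR) (t : d.-tuple mR) (u : mR) : tuple_set [the d.+1.-tuple mR of a :: t] ord0 u
    = [the d.+1.-tuple mR of u :: t].
  apply: eq_from_tnth => i; rewrite tnth_mktuple.
  by case: (unliftP ord0 i) => [i' ->|->] /=; rewrite ?eqxx// tnthS tnthS.
have setS (a : mR) (t : d.-tuple mR) k (u : mR) : tuple_set [the d.+1.-tuple mR of a :: t] (lift ord0 k) u
    = [the d.+1.-tuple mR of a :: tuple_set t k u].
  apply: eq_from_tnth => i; rewrite tnth_mktuple.
  case: (unliftP ord0 i) => [i' ->|->] /=; rewrite ?tnthS ?tnth_mktuple//.
have [k ->|jE] := unliftP ord0 j.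
  apply: eq_integral => a _; rewrite (IH k)//.
  by apply: eq_integral => t _; apply: eq_integral => u _; rewrite setS.
rewrite jE; transitivity (\int[tuple_prior d]_t \int[N01]_u
    f [the d.+1.-tuple mR of u :: t])%E.
  apply: (@tonelli_swap _ _ _ _ _ N01 (tuple_prior d) (fun a (t : d.-tuple mR) => f [the d.+1.-tuple mR of a :: t])) => //.
  by apply: measurableT_comp => //; exact: measurable_cons.
rewrite -[LHS](prob_integral_cst N01).
apply: eq_integral => a _; apply: eq_integral => t _.
by apply: eq_integral => u _; rewrite set0.
Qed.

Definition weighted_squares d (w : nat -> R) (t : d.-tuple mR) : R :=
  \sum_(i < d) w i * (tnth t i) ^+ 2.

Lemma measurable_weighted_squares d w :
  measurable_fun setT (@weighted_squares d w).
Proof.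
apply: measurable_sum => i; apply: measurable_funM => //.
by apply: measurable_funX; exact: measurable_tnth.
Qed.

Lemma weighted_squares_ge0 d w (t : d.-tuple mR) : (forall i, 0 <= w i) ->
  0 <= weighted_squares w t.
Proof. by move=> w0; apply: sumr_ge0 => i _; rewrite mulr_ge0// sqr_ge0. Qed.

Ltac side2 := side; try (by move=> *; pos; exact: weighted_squares_ge0).

Lemma weighted_squares_cons d w a (t : d.-tuple mR) :
  weighted_squares w [the d.+1.-tuple mR of a :: t]
  = w 0%N * a ^+ 2 + weighted_squares (fun i => w i.+1) t.
Proof.
rewrite /weighted_squares big_ord_recl; congr (_ * _ + _).
by apply: eq_bigr => i _; rewrite tnthS.
Qed.

Lemma normal_second_moment_eq : (\int[N01]_u (u ^+ 2)%:E = (1 : R)%:E)%E.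
Proof.
apply/eqP; rewrite eq_le normal_second_moment/=.
have := normal_posterior_variance 0 0 (lexx (0 : R)).
under eq_integral do rewrite mulr0 mulr0 mul0r subrr expR0.
rewrite prob_integral_cst addr0 invr1 mule1 => /le_trans; apply.
rewrite le_eqVlt; apply/orP; left; apply/eqP; apply: eq_integral => u _.
by rewrite mulr0 mulr0 mul0r subrr expR0 mulr1 sub0r sqrrN.
Qed.

Lemma tuple_prior_first_moment d (w : nat -> R) : (forall i, 0 <= w i) ->
  (\int[tuple_prior d]_t (weighted_squares w t)%:E = (\sum_(i < d) w i)%:E)%E.
Proof.
elim: d w => [|d IH] w w0.
  under eq_integral do rewrite /weighted_squares big_ord0.
  by rewrite integral0 big_ord0.
have mw := @measurable_weighted_squares d (fun i => w i.+1).
have w0' i : 0 <= w i.+1 by [].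
rewrite integral_tuple_priorS; last 2 first.
  by apply/measurable_EFinP; exact: measurable_weighted_squares.
  by move=> t; rewrite lee_fin weighted_squares_ge0.
set X := fun t : d.-tuple mR => weighted_squares (fun i => w i.+1) t.
have E a : (\int[tuple_prior d]_t (weighted_squares w [the d.+1.-tuple mR of a :: t])%:E =
    (w 0%N)%:E * (a ^+ 2)%:E + (\sum_(i < d) w i.+1)%:E)%E.
  under eq_integral do rewrite weighted_squares_cons EFinD.
  rewrite ge0_integralD; side2.
  by rewrite prob_integral_cst IH.
under eq_integral do rewrite E.
rewrite ge0_integralD; side2.
  rewrite ge0_integralZl; side2.
  by rewrite prob_integral_cst big_ord_recl EFinD normal_second_moment_eq mule1.
by move=> a _; rewrite lee_fin sumr_ge0.
Qed.

Lemma tuple_prior_second_moment d (w : nat -> R) : (forall i, 0 <= w i) ->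
  (\int[tuple_prior d]_t ((weighted_squares w t) ^+ 2)%:E <=
   ((\sum_(i < d) w i) ^+ 2 + 64 * \sum_(i < d) (w i) ^+ 2)%:E)%E.
Proof.
elim: d w => [|d IH] w w0.
  under eq_integral do rewrite /weighted_squares big_ord0 expr0n.
  by rewrite integral0 !big_ord0 expr0n /= mulr0 addr0.
have mw := @measurable_weighted_squares d (fun i => w i.+1).
have w0' i : 0 <= w i.+1 by [].
rewrite integral_tuple_priorS; last 2 first.
  by apply/measurable_EFinP/measurable_funX; exact: measurable_weighted_squares.
  by move=> t; rewrite lee_fin sqr_ge0.
set X := fun t : d.-tuple mR => weighted_squares (fun i => w i.+1) t.
set s1 := \sum_(i < d) w i.+1; set s2 := \sum_(i < d) w i.+1 ^+ 2.
have s10 : 0 <= s1 by rewrite sumr_ge0.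
apply: (@le_trans _ _ (\int[N01]_a (((w 0%N) ^+ 2)%:E * (a ^+ 4)%:E +
   ((2 * w 0%N * s1)%:E * (a ^+ 2)%:E + (s1 ^+ 2 + 64 * s2)%:E)))%E).
  apply: ge0_le_integral => //.
  - by move=> a _; apply: integral_ge0 => t _; rewrite lee_fin sqr_ge0.
  - apply: measurable_integral_snd.
      by apply/measurable_EFinP; mfun; apply: measurableT_comp;
        [exact: measurable_weighted_squares|exact: measurable_cons].
    by move=> x y; rewrite lee_fin ?sqr_ge0 ?weighted_squares_ge0.
  - by mfun.
  - move=> a _; under eq_integral => t _.
      rewrite weighted_squares_cons (_ : _ ^+ 2 = w 0%N ^+ 2 * a ^+ 4 +
        (2 * w 0%N * a ^+ 2 * X t + (X t) ^+ 2)); last by rewrite /X; ring.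
      rewrite !EFinD (EFinM (2 * w 0%N * a ^+ 2)); over.
    rewrite ge0_integralD; side2.
    rewrite prob_integral_cst -EFinM leeD2l//.
    rewrite ge0_integralD; side2.
    rewrite ge0_integralZl; side2.
    rewrite leeD// ?IH//.
    have -> : ((2 * w 0%N * s1)%:E * (a ^+ 2)%:E = (2 * w 0%N * a ^+ 2)%:E * s1%:E)%E.
      by rewrite -!EFinM; congr EFin; ring.
    apply: lee_wpmul2l; last by rewrite tuple_prior_first_moment.
    by rewrite lee_fin mulr_ge0 ?sqr_ge0 ?mulr_ge0.
rewrite ge0_integralD; side2.
rewrite ge0_integralD; side2.
rewrite ge0_integralZl; side2.
rewrite ge0_integralZl; side2.
rewrite prob_integral_cst.
apply: (@le_trans _ _ (((w 0%N) ^+ 2)%:E * 64%:E +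
   ((2 * w 0%N * s1)%:E * 1%:E + (s1 ^+ 2 + 64 * s2)%:E))%E).
  apply: leeD.
    by rewrite lee_wpmul2l ?lee_fin ?sqr_ge0//; exact: normal_fourth_moment.
  apply: leeD => //.
  by rewrite lee_wpmul2l ?lee_fin ?mulr_ge0//; exact: normal_second_moment.
rewrite -!EFinM -!EFinD lee_fin !big_ord_recl -/s1 -/s2.
have := sqr_ge0 (w 0%N); rewrite mulr1; nra.
all: move=> a _; rewrite -?EFinM lee_fin.
all: have s20 : 0 <= s2 by apply: sumr_ge0 => i _; exact: sqr_ge0.
all: by pos.
Qed.

(** The variance of a sum of independent terms, bounded by second moments:
    the squared mean is cancelled by the expansion of the square. *)
Lemma tuple_prior_variance d (w : nat -> R) : (forall i, 0 <= w i) ->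
  (\int[tuple_prior d]_t ((weighted_squares w t - \sum_(i < d) w i) ^+ 2)%:E <=
   (64 * \sum_(i < d) (w i) ^+ 2)%:E)%E.
Proof.
move=> w0; set W := \sum_(i < d) w i.
have W0 : 0 <= W by exact: sumr_ge0.
have mw := @measurable_weighted_squares d w.
have := tuple_prior_second_moment d w0; rewrite -/W => h2.
have E : (\int[tuple_prior d]_t ((weighted_squares w t - W) ^+ 2)%:E + (2 * W ^+ 2)%:E =
    \int[tuple_prior d]_t ((weighted_squares w t) ^+ 2)%:E + (W ^+ 2)%:E)%E.
  have <- : (\int[tuple_prior d]_t ((2 * W)%:E * (weighted_squares w t)%:E) = (2 * W ^+ 2)%:E)%E.
    rewrite ge0_integralZl; side2.
    by rewrite tuple_prior_first_moment// -EFinM -/W -mulrA -expr2.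
  rewrite -ge0_integralD; side2.
  rewrite -(prob_integral_cst (tuple_prior d) (W ^+ 2)%:E) -ge0_integralD; side2.
    by apply: eq_integral => t _; rewrite -EFinM -!EFinD; congr EFin; ring.
rewrite -(@leeD2rE _ (2 * W ^+ 2)%:E)// E.
apply: le_trans (leeD2r _ h2) _; rewrite -!EFinD lee_fin; lra.
Qed.

End product_prior.

(** * Functionals of finitely many times on the path space *)

Section path_space_measurability.
Context {R : realType} {n : nat}.
Local Notation D := (skorokhod R n).

Lemma clamp_in_itv (t : R) : 0 <= clamp n%:R t <= (n%:R : R).
Proof. exact: clamp_itv. Qed.

Lemma measurable_coordinate (t : R) : measurable_fun [set: D] (fun x : D => x t).
Proof.
rewrite (_ : (fun x => _) = (fun x : D => x (clamp n%:R t))); last first.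
  by apply/funext => x; rewrite traj_clamp.
move=> _ B mB; rewrite setTI; apply: sub_sigma_algebra.
exists (clamp n%:R t); first by rewrite /= in_itv/= clamp_in_itv.
by exists B.
Qed.

Lemma measurable_to_paths d (T : measurableType d) (f : T -> D) :
  (forall t, 0 <= t <= n%:R -> measurable_fun setT (fun z => f z t)) ->
  measurable_fun setT f.
Proof.
move=> mf; apply: (@measurability _ _ T D setT f (@cylinders R n)) => //.
move=> _ [_ [t tn [B mB <-]] <-].
by have := mf t tn measurableT B mB.
Qed.

(** Paths are clamped functions, so the sum of a path and of a function is
    restricted to [0, n] by [traj_of] again. *)
Definition path_add (h : R -> R) (x : D) : D := traj_of (fun t => h t + x t).

Lemma path_addE (h : R -> R) (x : D) t : cadlag n%:R h -> 0 <= t <= n%:R ->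
  path_add h x t = h t + x t.
Proof.
move=> ch tn; rewrite /path_add traj_ofE//.
by apply: (@cadlagD _ _ h) => //; exact: traj_cadlag.
Qed.

Lemma measurable_path_add d (T : measurableType d) (h : T -> R -> R) (x : T -> D) :
  (forall z, cadlag n%:R (h z)) ->
  (forall t, 0 <= t <= n%:R -> measurable_fun setT (h^~ t)) ->
  measurable_fun setT x -> measurable_fun setT (fun z => path_add (h z) (x z)).
Proof.
move=> ch mh mx; apply: measurable_to_paths => t tn.
rewrite (_ : (fun z => _) = (fun z => h z t + x z t)); last first.
  by apply/funext => z; rewrite path_addE.
apply: measurable_funD; first exact: mh.
exact: (measurableT_comp (measurable_coordinate t)).
Qed.

Lemma cadlagZ (u : R) (h : R -> R) : cadlag n%:R h -> cadlag n%:R (fun t => u * h t).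
Proof.
move=> [hr hl]; split=> t tn; first by apply: cvgMr; exact: hr.
by apply: is_cvgMr; exact: hl.
Qed.
End path_space_measurability.

Lemma density_measure_ex {R : realType} d (T : measurableType d)
    (mu : {measure set T -> \bar R}) (g : T -> \bar R) :
  measurable_fun setT g -> (forall x, (0 <= g x)%E) ->
  exists m : {measure set T -> \bar R}, forall A, m A = (\int[mu]_(x in A) g x)%E.
Proof.
move=> mg g0; pose F (A : set T) := (\int[mu]_(x in A) g x)%E.
have F0 : F set0 = 0%E by rewrite /F integral_set0.
have Fge0 A : (0 <= F A)%E by apply: integral_ge0.
have Fadd : semi_sigma_additive F.
  move=> A mA tA mUA; rewrite /F ge0_integral_bigcup//; last exact: measurable_funTS.
  by apply: is_cvg_ereal_nneg_natsum_cond => k _ _; exact: integral_ge0.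
pose m : {measure set T -> \bar R} := HB.pack F (isMeasure.Build _ _ _ F F0 Fge0 Fadd).
by exists m.
Qed.

Section finite_time_measurability.
Context {R : realType} {n : nat}.
Local Notation D := (skorokhod R n).

Definition time_cylinders (T : seq R) : set (set D) :=
  [set [set x : D | B (x t)] | t in [set` T] & B in measurable].

Lemma sub_time_cylinders (T T' : seq R) : {subset T <= T'} ->
  <<s time_cylinders T >> `<=` <<s time_cylinders T' >>.
Proof.
move=> TT'; apply: sub_smallest2r; first exact: smallest_sigma_algebra.
by move=> _ [t tT [B mB <-]]; exists t; [exact: TT'|exists B].
Qed.

Lemma time_cylinders_measurable (T : seq R) : <<s time_cylinders T >> `<=` measurable.
Proof.
apply: smallest_sub; first exact: sigma_algebra_measurable.
move=> _ [t tT [B mB <-]]; have := @measurable_coordinate R n t measurableT B mB.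
by rewrite setTI.
Qed.

Definition time_measurable (T : seq R) (H : D -> R) :=
  measurable_fun (T := g_sigma_algebraType (time_cylinders T)) setT H.

Lemma sub_time_measurable (T T' : seq R) H : {subset T <= T'} ->
  time_measurable T H -> time_measurable T' H.
Proof.
move=> TT' mH _ B mB; apply: (sub_time_cylinders TT').
exact: mH.
Qed.

Lemma time_measurable_measurable T H : time_measurable T H -> measurable_fun setT H.
Proof.
move=> mH _ B mB; apply: (@time_cylinders_measurable T).
exact: mH.
Qed.

Variable mu : probability D R.

Definition approximable (F : D -> R) := forall e : R, 0 < e ->
  exists T H, [/\ time_measurable T H & (\int[mu]_x `|F x - H x|%:E <= e%:E)%E].

Lemma approximableD F G : measurable_fun setT F -> measurable_fun setT G ->
  approximable F -> approximable G -> approximable (F \+ G).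
Proof.
move=> mF mG aF aG e e0; have e2 : 0 < e / 2 by rewrite divr_gt0.
have [T [H [mH FH]]] := aF _ e2; have [T' [H' [mH' GH']]] := aG _ e2.
have mH1 := time_measurable_measurable mH.
have mH1' := time_measurable_measurable mH'.
exists (T ++ T'), (H \+ H'); split.
  apply: measurable_funD; apply: sub_time_measurable; try eassumption;
    by move=> t; rewrite mem_cat => ->; rewrite ?orbT.
apply: (@le_trans _ _ (\int[mu]_x (`|F x - H x|%:E + `|G x - H' x|%:E))%E).
  apply: ge0_le_integral => //.
  - by apply/measurable_EFinP/measurableT_comp => //; apply: measurable_funB; apply: measurable_funD.
  - by apply: emeasurable_funD; apply/measurable_EFinP/measurableT_comp => //; apply: measurable_funB.
  - move=> x _; rewrite -EFinD lee_fin /= opprD addrACA; exact: ler_normD.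
rewrite ge0_integralD//; last 2 first.
  by apply/measurable_EFinP/measurableT_comp => //; apply: measurable_funB.
  by apply/measurable_EFinP/measurableT_comp => //; apply: measurable_funB.
by rewrite [e]splitr EFinD leeD.
Qed.

Lemma approximableZ r F : measurable_fun setT F ->
  approximable F -> approximable (fun x => r * F x).
Proof.
move=> mF aF e e0; have r0 : 0 < `|r| + 1 by rewrite ltr_wpDl.
have [T [H [mH FH]]] := aF (e / (`|r| + 1)) (divr_gt0 e0 r0).
have mH1 := time_measurable_measurable mH.
exists T, (fun x => r * H x); split; first exact: measurable_funM.
under eq_integral do rewrite -mulrBr normrM EFinM.
rewrite ge0_integralZl//; last first.
  by apply/measurable_EFinP/measurableT_comp => //; apply: measurable_funB.
apply: (@le_trans _ _ (`|r|%:E * (e / (`|r| + 1))%:E)%E).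
  by apply: lee_wpmul2l.
rewrite -EFinM lee_fin mulrCA ger_pMr// ler_pdivrMr// mul1r.
by rewrite lerDl.
Qed.

Lemma integral_dist_indic (A B : set D) : measurable A -> measurable B ->
  (\int[mu]_x `|\1_A x - \1_B x|%:E = mu ((A `\` B) `|` (B `\` A)))%E.
Proof.
move=> mA mB; rewrite -[X in _ = mu X]setIT -integral_indic//; last first.
  by apply: measurableU; apply: measurableD.
apply: eq_integral => x _; congr EFin; rewrite !indicE in_setU !in_setD.
by case: (x \in A); case: (x \in B); rewrite /= ?subrr ?subr0 ?sub0r ?normrN ?normr0 ?normr1.
Qed.

(** These sets form a sigma-algebra containing the cylinders, which is why
    every measurable set is one of them. *)
Definition approximable_set (A : set D) := measurable A /\
  forall e : R, 0 < e -> exists T B,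
    <<s time_cylinders T >> B /\ (mu ((A `\` B) `|` (B `\` A)) <= e%:E)%E.

Lemma approximable_setC A : approximable_set A -> approximable_set (~` A).
Proof.
move=> [mA aA]; split; first exact: measurableC.
move=> e e0; have [T [B [GB AB]]] := aA _ e0.
exists T, (~` B); split.
  exact: (@measurableC _ (g_sigma_algebraType (time_cylinders T))).
by rewrite setDE setCK setIC -setDE [X in (_ `|` X)%classic]setDE setCK setIC -setDE setUC.
Qed.

Lemma approximable_setU A A' : approximable_set A -> approximable_set A' ->
  approximable_set (A `|` A').
Proof.
move=> [mA aA] [mA' aA']; split; first exact: measurableU.
move=> e e0; have e2 : 0 < e / 2 by rewrite divr_gt0.
have [T [B [GB AB]]] := aA _ e2; have [T' [B' [GB' AB']]] := aA' _ e2.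
have mB := time_cylinders_measurable GB; have mB' := time_cylinders_measurable GB'.
exists (T ++ T'), (B `|` B'); split.
  apply: (@measurableU _ (g_sigma_algebraType (time_cylinders (T ++ T')))).
    by apply: sub_time_cylinders GB => t; rewrite mem_cat => ->.
  by apply: sub_time_cylinders GB' => t; rewrite mem_cat => ->; rewrite orbT.
rewrite [e]splitr EFinD; apply: le_trans (leeD AB AB').
apply: le_trans (measureU2 _ _ _) => /=.
- apply: le_measure; rewrite ?inE//.
  + by apply: measurableU; apply: measurableD; apply: measurableU.
  + by apply: measurableU; apply: measurableU; apply: measurableD.
  + by move=> x /=; tauto.
- by apply: measurableU; apply: measurableD.
- by apply: measurableU; apply: measurableD.
Qed.

Lemma approximable_set_bigcup (A : (set D)^nat) : (forall k, approximable_set (A k)) ->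
  approximable_set (\bigcup_k A k).
Proof.
move=> aA; have mA k : measurable (A k) by have [] := aA k.
split; first exact: bigcupT_measurable.
pose U N := \big[setU/set0]_(k < N) A k.
have aU N : approximable_set (U N).
  rewrite /U; elim: N => [|N IH]; last by rewrite big_ord_recr; exact: approximable_setU.
  rewrite big_ord0; split => // e e0; exists [::], set0; split.
    exact: (@measurable0 _ (g_sigma_algebraType (time_cylinders [::]))).
  by rewrite set0D setU0 measure0 lee_fin ltW.
have mU N : measurable (U N) by have [] := aU N.
have mUA : measurable (\bigcup_k A k) by exact: bigcupT_measurable.
have UA : \bigcup_N U N = \bigcup_k A k.
  by rewrite /U eqEsubset; split=> x [k _];
    [rewrite -bigcup_mkord => -[j _ Aj]; exists j
    |move=> Ak; exists k.+1 => //; rewrite -bigcup_mkord; exists k => //=].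
have ndU : nondecreasing_seq U.
  by apply/nondecreasing_seqP => N; rewrite /U big_ord_recr /= subsetEset; exact: subsetUl.
have cU : mu (U N) @[N --> \oo] --> mu (\bigcup_k A k).
  by rewrite -UA; apply: nondecreasing_cvg_mu => //; rewrite UA.
move=> e e0; have e2 : 0 < e / 2 by rewrite divr_gt0.
have fmu B : measurable B -> mu B \is a fin_num by exact: fin_num_measure.
have [N UN] : exists N, (mu (\bigcup_k A k `\` U N) <= (e / 2)%:E)%E.
  have [|N h] := @cvge_exists_gt _ _ _ (mu (\bigcup_k A k) - (e / 2)%:E) cU.
    by rewrite lteBlDr// lteDl ?fmu// lte_fin.
  exists N.
  rewrite measureD//; last by rewrite ltey_eq fmu.
  rewrite setIidr; last by rewrite -UA; exact: bigcup_sup.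
  by rewrite leeBlDr ?fmu// addeC -leeBlDr ?fmu// ltW.
have [_ /(_ _ e2)[T [B [GB UB]]]] := aU N.
have mB := time_cylinders_measurable GB.
exists T, B; split => //.
rewrite [e]splitr EFinD; apply: le_trans (leeD UN UB).
apply: le_trans (measureU2 _ _ _) => /=.
- apply: le_measure; rewrite ?inE//.
  + by apply: measurableU; apply: measurableD.
  + apply: measurableU; first exact: measurableD.
    by apply: measurableU; apply: measurableD.
  + move=> x /= [[Ax nBx]|[Bx nAx]].
      by have [Ux|nUx] := pselect (U N x); [right; left|left].
    by right; right; split => // Ux; apply: nAx; rewrite -UA; exists N.
- exact: measurableD.
- by apply: measurableU; apply: measurableD.
Qed.

Lemma measurable_approximable_set A : measurable A -> approximable_set A.
Proof.
apply: smallest_sub => [|_ [t tn [B mB <-]]].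
  split.
  - split => // e e0; exists [::], set0; split.
      exact: (@measurable0 _ (g_sigma_algebraType (time_cylinders [::]))).
    by rewrite set0D setU0 measure0 lee_fin ltW.
  - by move=> A' aA'; rewrite setTD; exact: approximable_setC.
  - exact: approximable_set_bigcup.
split.
  by have := @measurable_coordinate R n t measurableT B mB; rewrite setTI.
move=> e e0; exists [:: t], [set x : D | B (x t)]; split.
  by apply: sub_sigma_algebra; exists t; rewrite /= ?mem_head//; exists B.
by rewrite setDv setU0 measure0 lee_fin ltW.
Qed.

Lemma indic_approximable A : measurable A -> approximable (\1_A).
Proof.
move=> mA e e0; have [_ /(_ _ e0)[T [B [GB AB]]]] := measurable_approximable_set mA.
exists T, (\1_B); split.
  exact: (@measurable_indic _ (g_sigma_algebraType (time_cylinders T))).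
by rewrite integral_dist_indic//; exact: time_cylinders_measurable GB.
Qed.

Import HBNNSimple.

Lemma nnsfun_approximable (f : {nnsfun D >-> R}) : approximable f.
Proof.
rewrite (_ : (f : D -> R) = (fun x => \sum_(r <- finmap.enum_fset (fset_set (range f)))
    r * \1_(f @^-1` [set r]) x)); last first.
  by apply/funext => x; rewrite {1}fimfunE fsbig_finite.
move: (finmap.enum_fset _) => s0; elim: s0 => [|r s IH].
  move=> e e0; exists [::], (cst 0); split; first exact: measurable_cst.
  by under eq_integral do rewrite big_nil subrr normr0; rewrite integral0 lee_fin ltW.
under [X in approximable X]eq_fun do rewrite big_cons.
apply: (@approximableD (fun x => r * \1_(f @^-1` [set r]) x)).
- by apply: measurable_funM => //; exact: measurable_indic.
- by apply: measurable_sum => i; apply: measurable_funM.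
- by apply: approximableZ => //; exact: indic_approximable.
- exact: IH.
Qed.

(** The finite-dimensional sigma-algebras generate that of the path space,
    hence are dense in L^1: for indicators by the closure properties above,
    then for simple functions by linearity, then by monotone convergence after
    a shift by b that makes the functional nonnegative. *)
Lemma bounded_approximable (F : D -> R) (b : R) : measurable_fun setT F ->
  (forall x, `|F x| <= b) -> approximable F.
Proof.
move=> mF Fb.
have b0 : 0 <= b by exact: le_trans (normr_ge0 _) (Fb point).
have mFb : measurable_fun setT (fun x => F x + b) by exact: measurable_funD.
have Fb0 x : 0 <= F x + b by have := Fb x; rewrite ler_norml => /andP[]; lra.
have mE : measurable_fun setT (fun x => (F x + b)%:E) by exact/measurable_EFinP.
pose g := nnsfun_approx measurableT mE.
suff aFb : approximable (fun x => F x + b).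
  rewrite (_ : F = (fun x => F x + b) \+ (fun x => (- b) * \1_setT x)).
    apply: approximableD => //; first exact: measurable_funM.
    by apply: approximableZ => //; exact: indic_approximable.
  by apply/funext => x; rewrite /= indicT mulr1 addrK.
move=> e e0; have e2 : 0 < e / 2 by rewrite divr_gt0.
have cg : (\int[mu]_x (g k x)%:E)%E @[k --> \oo] --> (\int[mu]_x (F x + b)%:E)%E.
  rewrite (_ : (\int[mu]_x (F x + b)%:E)%E = (\int[mu]_x limn (fun k => (g k x)%:E))%E).
    apply: cvg_monotone_convergence => //.
    - by move=> k; apply/measurable_EFinP; exact: measurable_funTS.
    - by move=> k x _; rewrite lee_fin.
    - by move=> x _ i j ij; rewrite lee_fin; apply/lefP/nd_nnsfun_approx.
  apply: eq_integral => x _; apply/esym/cvg_lim => //.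
  by apply: cvg_nnsfun_approx => // ? _; rewrite lee_fin.
have gle k x : g k x <= F x + b.
  rewrite -lee_fin /g nnsfun_approxE; apply: le_approx => // ? _.
  by rewrite lee_fin.
have ib : (\int[mu]_x (F x + b)%:E <= (2 * b)%:E)%E.
  rewrite -(prob_integral_cst mu (2 * b)%:E); apply: ge0_le_integral => //.
    by move=> x _; rewrite lee_fin.
  by move=> x _; rewrite lee_fin; have := Fb x; rewrite ler_norml => /andP[]; lra.
have i0 : (0 <= \int[mu]_x (F x + b)%:E)%E by apply: integral_ge0 => x _; rewrite lee_fin.
have ifin : (\int[mu]_x (F x + b)%:E)%E \is a fin_num.
  by rewrite ge0_fin_numE//; exact: le_lt_trans ib (ltry _).
have [k gk] : exists k, (\int[mu]_x (F x + b - g k x)%:E <= (e / 2)%:E)%E.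
  have [|k h] := @cvge_exists_gt _ _ _ (\int[mu]_x (F x + b)%:E - (e / 2)%:E) cg.
    by rewrite lteBlDr// lteDl// lte_fin.
  exists k.
  have gfin : (\int[mu]_x (g k x)%:E)%E \is a fin_num.
    rewrite ge0_fin_numE; last by apply: integral_ge0 => x _; rewrite lee_fin.
    apply: le_lt_trans (le_lt_trans ib (ltry _)).
    by apply: ge0_le_integral => //; (try exact/measurable_EFinP) => x _; rewrite lee_fin.
  have mgk : measurable_fun setT (g k) by [].
  have : (\int[mu]_x (F x + b)%:E = \int[mu]_x (F x + b - g k x)%:E + \int[mu]_x (g k x)%:E)%E.
    rewrite -ge0_integralD//.
    - by apply: eq_integral => x _; rewrite -EFinD subrK.
    - by move=> x _; rewrite lee_fin subr_ge0.
    - by apply/measurable_EFinP; exact: measurable_funB.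
    - by move=> x _; rewrite lee_fin.
    - exact/measurable_EFinP.
  move=> E; move: h; rewrite E lteBlDr// addeC => h.
  by apply: ltW; rewrite -(@lteD2lE _ (\int[mu]_x (g k x)%:E)%E).
have [T [H [mH gH]]] := nnsfun_approximable (g k) e2.
have mH1 := time_measurable_measurable mH.
exists T, H; split => //.
rewrite [e]splitr EFinD; apply: le_trans (leeD gk gH).
rewrite -ge0_integralD//; last 3 first.
  by move=> x _; rewrite lee_fin subr_ge0.
  by apply/measurable_EFinP; exact: measurable_funB.
  by apply/measurable_EFinP/measurableT_comp => //; exact: measurable_funB.
apply: ge0_le_integral => //.
- by apply/measurable_EFinP/measurableT_comp => //; exact: measurable_funB.
- apply: emeasurable_funD; apply/measurable_EFinP; first exact: measurable_funB.
  by apply: measurableT_comp => //; exact: measurable_funB.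
- move=> x _; rewrite -EFinD lee_fin.
  have -> : F x + b - H x = (F x + b - g k x) + (g k x - H x) by ring.
  by apply: le_trans (ler_normD _ _) _; rewrite ger0_norm ?subr_ge0.
Qed.

End finite_time_measurability.

(** * Translations of the Wiener measure *)

Section wiener_cameron_martin.
Context {R : realType} {n : nat}.
Local Notation D := (skorokhod R n).
Variables (Q : probability D R) (c : R).
Hypotheses (c0 : 0 < c) (wQ : wiener c Q).

Variables (m : nat) (t : nat -> R).
Hypotheses (t00 : t 0%N = 0) (tincr : forall i, (i < m)%N -> t i < t i.+1).
Hypothesis (tmn : t m <= n%:R).

Definition increment (i : nat) (x : D) : R := x (t i.+1) - x (t i).

Let v i := c * (t i.+1 - t i).
Let N i : probability _ R := normal_prob 0 (Num.sqrt (v i)).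

Lemma partition_le i j : (i <= j <= m)%N -> t i <= t j.
Proof.
move=> /andP[ij jm]; elim: j ij jm => [|j IH]; first by rewrite leqn0 => /eqP ->.
rewrite leq_eqVlt => /predU1P[->//|ij jm].
by apply: le_trans (IH ij (ltnW jm)) _; apply: ltW; exact: tincr.
Qed.

Lemma partition_itv i : (i <= m)%N -> 0 <= t i <= n%:R.
Proof.
move=> im; rewrite -t00 partition_le ?leq0n//=.
by apply: le_trans tmn; rewrite partition_le// im leqnn.
Qed.

Lemma measurable_increment i : measurable_fun [set: D] (increment i).
Proof. by apply: measurable_funB; exact: measurable_coordinate. Qed.

Lemma wiener_increment_normal i B : (i < m)%N -> measurable B ->
  Q (increment i @^-1` B) = N i B.
Proof.
move=> im mB; have [_ _ h _] := wQ; apply: h => //.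
- by have /andP[] := partition_itv (ltnW im).
- exact: tincr.
- by have /andP[] := partition_itv im.
Qed.

Lemma all_increments_setE (B : nat -> set R) :
  [set x : D | forall i, (i < m)%N -> B i (increment i x)] =
  \big[setI/setT]_(i < m) (increment i @^-1` (B i)).
Proof.
rewrite -(bigcap_mkord m (fun i => increment i @^-1` (B i))).
by apply/seteqP; split => x /= hx i im; exact: hx.
Qed.

Lemma measurable_all_increments (B : nat -> set R) : (forall i, measurable (B i)) ->
  measurable [set x : D | forall i, (i < m)%N -> B i (increment i x)].
Proof.
move=> mB; rewrite all_increments_setE; apply: bigsetI_measurable => i _.
by have := measurable_increment i measurableT (mB i); rewrite setTI.
Qed.

Lemma wiener_increment_indep (B : nat -> set R) : (forall i, measurable (B i)) ->
  Q [set x : D | forall i, (i < m)%N -> B i (increment i x)] =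
  (\prod_(i < m) fine (N i (B i)))%:E.
Proof.
move=> mB; have [_ _ _ h] := wQ.
rewrite -[LHS]fineK; last first.
  by apply: fin_num_measure; exact: measurable_all_increments.
congr EFin; rewrite h//.
- by apply: eq_bigr => i _; rewrite -wiener_increment_normal.
- by rewrite t00.
- by move=> i im; apply: ltW; exact: tincr.
Qed.

(** Independence is given for events only; the indicators are replaced by
    functions one increment at a time, by induction on the number k of factors
    already replaced. *)
Lemma wiener_prod_increments (f : nat -> R -> R) (p : nat -> R) :
  (forall i, measurable_fun setT (f i)) -> (forall i u, 0 <= f i u) ->
  (forall i, (i < m)%N -> (\int[N i]_u (f i u)%:E = (p i)%:E)%E) ->
  (\int[Q]_x (\prod_(i < m) f i (increment i x))%:E = (\prod_(i < m) p i)%:E)%E.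
Proof.
move=> mf f0 fp.
pose g k (B : nat -> set R) i u := if (i < k)%N then f i u else \1_(B i) u.
pose q k (B : nat -> set R) i := if (i < k)%N then p i else fine (N i (B i)).
have g0 k B i u : 0 <= g k B i u by rewrite /g; case: ifP.
have mg k B i : (forall i, measurable (B i)) -> measurable_fun setT (g k B i).
  move=> mB; rewrite /g; case: (i < k)%N; first exact: mf.
  by apply: measurable_indic; exact: mB.
have mprod k B (P : pred 'I_m) : (forall i, measurable (B i)) -> measurable_fun setT
    (fun x : D => \prod_(i < m | P i) g k B i (increment i x)).
  move=> mB; under eq_fun do rewrite big_mkcond.
  apply: measurable_prod => i _; case: (P i) => //.
  by apply: measurableT_comp; [exact: mg|exact: measurable_increment].
have key k B : (k <= m)%N -> (forall i, measurable (B i)) ->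
  (\int[Q]_x (\prod_(i < m) g k B i (increment i x))%:E =
   (\prod_(i < m) q k B i)%:E)%E.
  elim: k B => [|k IH] B km mB.
    rewrite -wiener_increment_indep// -[in RHS](setIT [set x | _]) -integral_indic//; last first.
      exact: measurable_all_increments.
    apply: eq_integral => x _; congr EFin; rewrite indicE.
    case: (boolP (x \in _)) => [|].
      rewrite inE /= => hx; apply: big1 => i _.
      by rewrite /g ltn0 indicE mem_set//; exact: hx.
    rewrite notin_setE /= => /existsNP[i] /not_implyP[im nB].
    by rewrite (bigD1 (Ordinal im))//= /g ltn0 indicE memNset ?mul0r.
  pose k' := Ordinal km.
  have kk : g k.+1 B k = f k by rewrite /g ltnSn.
  under eq_integral do rewrite (bigD1 k')//= kk EFinM.
  rewrite (@integral_from_indic _ _ _ _ _ Q (N k) (increment k)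
    (fun x => \prod_(i < m | i != k') g k.+1 B i (increment i x))
    (\prod_(i < m | i != k') q k.+1 B i) (measurable_increment k) (mprod _ _ _ mB) _ _
    (EFin \o f k)).
  - rewrite /= fp// -EFinM [in RHS](bigD1 k')//= mulrC; congr (_ * _)%:E.
    by rewrite /q ltnSn.
  - by move=> x; apply: prodr_ge0 => i _.
  - move=> B' mB'.
    pose B2 i := if i == k then B' else B i.
    have mB2 i : measurable (B2 i) by rewrite /B2; case: ifP => _; [exact: mB'|exact: mB].
    have gB2 : g k B2 k = \1_B' by rewrite /g ltnn /B2 eqxx.
    have qB2 : q k B2 k = fine (N k B') by rewrite /q ltnn /B2 eqxx.
    have := IH B2 (ltnW km) mB2.
    rewrite (bigD1 k')//= qB2.
    have E1 (i : 'I_m) : i != k' -> q k.+1 B i = q k B2 i.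
      move=> ik; have {}ik : (i : nat) != k by apply: contraNN ik => /eqP ?; apply/eqP/val_inj.
      by rewrite /q ltnS leq_eqVlt (negbTE ik) /B2 (negbTE ik).
    rewrite -(eq_bigr _ E1) EFinM fineK ?fin_num_measure// muleC => <-.
    apply: eq_integral => x _; rewrite -EFinM; congr EFin.
    rewrite [RHS](bigD1 k')//= gB2; congr (_ * _).
    apply: eq_bigr => i ik; have {}ik : (i : nat) != k by apply: contraNN ik => /eqP ?; apply/eqP/val_inj.
    by rewrite /g ltnS leq_eqVlt (negbTE ik) /B2 (negbTE ik).
  - by apply/measurable_EFinP; exact: mf.
  - by move=> u; rewrite /= lee_fin.
have := key m (fun _ => setT) (leqnn m) (fun _ => measurableT).
under eq_integral do under eq_bigr do rewrite /g ltn_ord.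
by rewrite (eq_bigr (fun i : 'I_m => p i))// => i _; rewrite /q ltn_ord.
Qed.

Variable Phi : R -> R.
Hypotheses (cPhi : cadlag n%:R Phi) (Phi0 : Phi 0 = 0).

(** Under the drift u Phi the increments are normal of means u s_i and
    variances v_i: L u is the likelihood ratio of u against 0, and q the
    information on u. *)
Let s i := Phi (t i.+1) - Phi (t i).
Let q := \sum_(i < m) s i ^+ 2 / v i.
Let Z (x : D) := \sum_(i < m) s i * increment i x / v i.
Let L (u : R) (x : D) := expR (u * Z x - u ^+ 2 * q / 2).
Let y (u : R) (x : D) := path_add (fun t => u * Phi t) x.

Let v_gt0 i : (i < m)%N -> 0 < v i.
Proof. by move=> im; rewrite mulr_gt0// subr_gt0 tincr. Qed.

Lemma measurable_Z : measurable_fun [set: D] Z.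
Proof.
apply: measurable_sum => i; apply: measurable_funM => //.
by apply: measurable_funM => //; exact: measurable_increment.
Qed.

Lemma measurable_likelihood u : measurable_fun [set: D] (L u).
Proof.
apply: measurableT_comp => //; apply: measurable_funB => //.
by apply: measurable_funM => //; exact: measurable_Z.
Qed.

Lemma likelihoodE u x : L u x =
  \prod_(i < m) expR (u * s i * increment i x / v i - (u * s i) ^+ 2 / (2 * v i)).
Proof.
rewrite /L -expR_sum; congr expR; rewrite sumrB /Z /q.
rewrite mulr_sumr [u ^+ 2 * _]mulr_sumr mulr_suml; congr (_ - _).
  by apply: eq_bigr => i _; rewrite !mulrA.
by apply: eq_bigr => i _; field; rewrite gt_eqF ?v_gt0.
Qed.

Lemma cadlag_drift u : cadlag n%:R (fun t => u * Phi t).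
Proof. exact: cadlagZ. Qed.

Lemma increment_path_add u x i : (i < m)%N ->
  increment i (y u x) = increment i x + u * s i.
Proof.
move=> im; rewrite /increment /y !path_addE ?partition_itv ?(ltnW im)//;
  try exact: cadlag_drift.
by rewrite /s; ring.
Qed.

(** A pi-system: the initial value and the increments determine the values at
    the times of the partition. *)
Definition rectangles : set (set D) :=
  [set A | exists B0 (B : nat -> set R), [/\ measurable B0, (forall i, measurable (B i)) &
    A = [set x : D | B0 (x 0) /\ forall i, (i < m)%N -> B i (increment i x)]]].

Lemma measurable_rectangle A : rectangles A -> measurable A.
Proof.
move=> [B0 [B [mB0 mB ->]]].
rewrite (_ : [set x | _] = (fun x : D => x 0) @^-1` B0 `&`
  [set x : D | forall i, (i < m)%N -> B i (increment i x)]); last first.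
  by apply/seteqP; split => x /= [].
apply: measurableI; last exact: measurable_all_increments.
by have := @measurable_coordinate R n 0 measurableT B0 mB0; rewrite setTI.
Qed.

(** The Cameron-Martin formula on rectangles: both sides are products over the
    increments, and the factors agree by translation of a normal law. The
    constraint on the initial value is the same on both sides, since almost
    surely the path starts at 0, and so does the drift. *)
Lemma rectangle_shift u A : rectangles A ->
  Q (y u @^-1` A) = (\int[Q]_(x in A) (L u x)%:E)%E.
Proof.
move=> rA; have mA := measurable_rectangle rA; case: rA => B0 [B [mB0 mB EA]].
have [ae0 _ _ _] := wQ.
pose b := \1_B0 (0 : R) : R.
pose f i w := \1_(B i) (w + u * s i) : R.
pose g i w := \1_(B i) w * expR (u * s i * w / v i - (u * s i) ^+ 2 / (2 * v i)).
pose p i := fine (\int[N i]_w (f i w)%:E)%E.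
have mI i : measurable_fun setT (\1_(B i) : R -> R).
  by apply: measurable_indic; exact: mB.
have mf i : measurable_fun setT (f i).
  apply: (measurableT_comp (mI i)).
  exact: measurable_funD.
have mg i : measurable_fun setT (g i).
  apply: measurable_funM; first exact: mI.
  apply: measurableT_comp => //; apply: measurable_funB => //.
  by apply: measurable_funM => //; apply: measurable_funM.
have f0 i w : 0 <= f i w by [].
have g0 i w : 0 <= g i w by rewrite mulr_ge0 ?expR_ge0.
have fp i : (i < m)%N -> (\int[N i]_w (f i w)%:E = (p i)%:E)%E.
  move=> im; rewrite /p fineK// ge0_fin_numE; last by apply: integral_ge0 => w _; rewrite lee_fin.
  apply: (@le_lt_trans _ _ 1%E); last exact: ltry.
  rewrite -(prob_integral_cst (N i) 1%E); apply: ge0_le_integral => //.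
  - by move=> w _; rewrite lee_fin.
  - by apply/measurable_EFinP; exact: mf.
  - by move=> w _; rewrite lee_fin /f indicE; case: (_ \in _).
have gp i : (i < m)%N -> (\int[N i]_w (g i w)%:E = (p i)%:E)%E.
  move=> im; rewrite -fp//.
  have s0 : 0 < Num.sqrt (v i) by rewrite sqrtr_gt0 v_gt0.
  rewrite (@normal_shift _ _ (u * s i) (EFin \o \1_(B i)) s0); last 2 first.
  - by apply/measurable_EFinP; exact: mI.
  - by move=> w; rewrite /= lee_fin.
  apply: eq_integral => w _; rewrite /= -EFinM; congr (_ * expR _)%:E.
  by rewrite sqr_sqrtr// ltW// v_gt0.
have mP (h : nat -> R -> R) : (forall i, measurable_fun setT (h i)) ->
    measurable_fun setT (fun x : D => \prod_(i < m) h i (increment i x) : R).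
  move=> mh; apply: measurable_prod => i _.
  by apply: measurableT_comp; [exact: mh|exact: measurable_increment].
have mPf := mP _ mf; have mPg := mP _ mg.
have Pf0 x : 0 <= \prod_(i < m) f i (increment i x) by apply: prodr_ge0.
have Pg0 x : 0 <= \prod_(i < m) g i (increment i x) by apply: prodr_ge0.
have b0 : 0 <= b by [].
have lhs : Q (y u @^-1` A) = (b%:E * (\prod_(i < m) p i)%:E)%E.
  rewrite -(wiener_prod_increments mf f0 fp) -ge0_integralZl; side.
  have my : measurable (y u @^-1` A).
    have : measurable_fun setT (y u).
      by apply: measurable_path_add => // z; exact: cadlag_drift.
    by move=> /(_ measurableT A mA); rewrite setTI.
  transitivity (\int[Q]_x (\1_(y u @^-1` A) x)%:E)%E; first by rewrite integral_indic// setIT.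
  apply: ae_eq_integral => //.
  - by apply/measurable_EFinP; exact: measurable_indic.
  - by apply: emeasurable_funM => //; apply/measurable_EFinP.
  - apply: filterS ae0 => x x0 _; rewrite -EFinM; congr EFin.
    have y0 : y u x 0 = 0.
      rewrite /y path_addE; [by rewrite Phi0 mulr0 add0r x0|exact: cadlag_drift|].
      by rewrite lexx ler0n.
    rewrite indicE /b indicE.
    case: (boolP (x \in _)) => [|].
      rewrite inE EA /= y0 => -[hB0 hB]; rewrite mem_set// mul1r big1// => i _.
      by rewrite /f indicE mem_set// -increment_path_add//; exact: hB.
    rewrite notin_setE EA /= y0 => /not_andP[h|].
      by rewrite memNset// mul0r.
    move=> /existsNP[i] /not_implyP[im nB].
    have fi0 : f i (increment i x) = 0.
      by rewrite /f indicE -increment_path_add// memNset.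
    by rewrite (bigD1 (Ordinal im))//= fi0 mul0r mulr0.
rewrite lhs -(wiener_prod_increments mg g0 gp) -ge0_integralZl; side.
rewrite [RHS]integral_mkcond; apply: ae_eq_integral => //.
- by apply: emeasurable_funM => //; apply/measurable_EFinP.
- apply/(measurable_restrictT _ mA); apply: measurable_funTS.
  by apply/measurable_EFinP; exact: measurable_likelihood.
- apply: filterS ae0 => x x0 _; rewrite patchE likelihoodE.
  case: ifPn => [|].
    rewrite inE EA /= x0 => -[hB0 hB]; rewrite -EFinM /b indicE mem_set// mul1r.
    congr EFin; apply: eq_bigr => i _; rewrite /g indicE mem_set ?mul1r//.
    exact: hB.
  rewrite notin_setE EA /= x0 => /not_andP[h|].
    by rewrite /b indicE memNset// mul0e.
  move=> /existsNP[i] /not_implyP[im nB].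
  by rewrite (bigD1 (Ordinal im))//= /g indicE memNset ?mul0r ?mule0.
Qed.

(** Uniqueness of measures that agree on a generating pi-system. *)
Lemma rectangles_shift_sigma u A : <<s rectangles>> A ->
  Q (y u @^-1` A) = (\int[Q]_(x in A) (L u x)%:E)%E.
Proof.
have my : measurable_fun setT (y u).
  by apply: measurable_path_add => // z; exact: cadlag_drift.
have mL := measurable_likelihood u.
have [m2 m2E] := @density_measure_ex _ _ _ Q (EFin \o L u)
  ((measurable_EFinP _ _).2 mL) (fun x => expR_ge0 _).
pose m1 := measure_function_pushforward__canonical__measure_function_Measure Q my.
move=> GA; rewrite -m2E; transitivity (m1 A); first by [].
have rT : rectangles setT.
  exists setT, (fun=> setT); split => //.
  by apply/seteqP; split.
apply: (@g_sigma_algebra_measure_unique _ R D rectangles _ (fun=> setT) _ _ m1 m2) GA => //.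
- by move=> B rB; exact: measurable_rectangle.
- by rewrite -subTset => x _; exists 0%N.
- move=> _ _ [B0 [B [mB0 mB ->]]] [B0' [B' [mB0' mB' ->]]].
  exists (B0 `&` B0'), (fun i => B i `&` B' i); split.
  + exact: measurableI.
  + by move=> i; exact: measurableI.
  + apply/seteqP; split => x /=.
      by move=> [[h0 h] [h0' h']]; split => // i im; split; [exact: h|exact: h'].
    by move=> [[h0 h0'] h]; split; split => // i im; have [] := h _ im.
- by move=> B rB; rewrite m2E; exact: rectangle_shift.
- by move=> _; rewrite /m1 /= /pushforward preimage_setT probability_setT ltry.
Qed.

Lemma time_cylinders_rectangles (T : seq R) :
  (forall tau, tau \in T -> exists2 j, (j <= m)%N & tau = t j) ->
  <<s time_cylinders T >> `<=` <<s rectangles >>.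
Proof.
move=> Tt; apply: smallest_sub; first exact: smallest_sigma_algebra.
move=> _ [tau /Tt[j jm ->] [B mB <-]].
have mi i : (i < m)%N -> measurable_fun (T := g_sigma_algebraType rectangles)
    setT (increment i).
  move=> im _ C mC; rewrite setTI; apply: sub_sigma_algebra.
  exists setT, (fun j => if j == i then C else setT); split => //.
    by move=> k; case: ifP.
  apply/seteqP; split => x /=; last by move=> [_ /(_ _ im)]; rewrite eqxx.
  by move=> Cx; split => // k km; case: eqP => // ->.
suff : measurable_fun (T := g_sigma_algebraType rectangles) setT (fun x : D => x (t j)).
  by move=> /(_ measurableT B mB); rewrite setTI.
elim: j jm => [_|j IH jm].
  rewrite t00 => _ C mC; rewrite setTI; apply: sub_sigma_algebra.
  by exists C, (fun=> setT); split => //; apply/seteqP; split => x /= => [|[]].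
rewrite (_ : (fun x => _) = (fun x : D => x (t j)) \+ increment j).
  by apply: measurable_funD; [apply: IH; exact: ltnW|exact: mi].
by apply/funext => x; rewrite /increment /= addrC subrK.
Qed.

(** The Cameron-Martin formula for functionals of the times of the
    partition. *)
Lemma time_measurable_shift u (T : seq R) (H : D -> R) (phi : R -> \bar R) :
  (forall tau, tau \in T -> exists2 j, (j <= m)%N & tau = t j) ->
  time_measurable T H -> measurable_fun setT phi -> (forall w, (0 <= phi w)%E) ->
  (\int[Q]_x phi (H (y u x)) = \int[Q]_x (phi (H x) * (L u x)%:E))%E.
Proof.
move=> Tt mH mphi phi0.
have my : measurable_fun setT (y u).
  by apply: measurable_path_add => // z; exact: cadlag_drift.
have mHD := time_measurable_measurable mH.
have mHy : measurable_fun setT (H \o y u) by exact: measurableT_comp.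
pose nu := measure_function_pushforward__canonical__measure_function_Measure Q mHy.
rewrite (@integral_from_indic _ _ _ _ _ Q nu H (L u) 1 mHD (measurable_likelihood u))//.
- rewrite mul1e (_ : (\int[nu]_w phi w)%E = (\int[pushforward Q (H \o y u)]_w phi w)%E)//.
  by rewrite ge0_integral_pushforward.
- by move=> x; exact: expR_ge0.
- move=> B mB; rewrite mul1e.
  have mHB : measurable (H @^-1` B) by rewrite -[X in measurable X]setTI; exact: mHD.
  transitivity (Q (y u @^-1` (H @^-1` B))); last by [].
  rewrite rectangles_shift_sigma; last first.
    by apply: (time_cylinders_rectangles Tt); have := mH measurableT B mB; rewrite setTI.
  rewrite [RHS]integral_mkcond; apply: eq_integral => x _.
  rewrite patchE indicE (_ : (H x \in B) = (x \in H @^-1` B)); last first.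
    by apply/idP/idP; rewrite !inE.
  by case: ifP => _; rewrite ?mul1e ?mul0e.
Qed.

Local Notation N01 := (@normal_prob R 0 1).

Lemma information_ge0 : 0 <= q.
Proof.
by apply: sumr_ge0 => i _; rewrite divr_ge0 ?sqr_ge0// ltW// v_gt0.
Qed.

(** For the drift u Phi with a standard normal u: by the Cameron-Martin formula
    the mean risk is an integral over the undrifted path of the posterior
    squared error, whose lower bound has total mass 1 after the factor
    (1 + q)^-1 is taken out, because the likelihood integrates to 1. *)
Lemma bayes_time_measurable (T : seq R) (H : D -> R) :
  (forall tau, tau \in T -> exists2 j, (j <= m)%N & tau = t j) ->
  time_measurable T H ->
  ((1 + q)^-1%:E <= \int[N01]_u \int[Q]_x ((H (y u x) - u) ^+ 2)%:E)%E.
Proof.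
move=> Tt mH; have mHD := time_measurable_measurable mH.
have mZ := measurable_Z.
have mLj : measurable_fun setT (fun p : R * D => L p.1 p.2).
  apply: measurableT_comp => //; apply: measurable_funB.
    by apply: measurable_funM => //; exact: (measurableT_comp mZ).
  by apply: measurable_funM => //; apply: measurable_funM => //; exact: measurable_funX.
have mHu : measurable_fun setT (fun p : R * D => (H p.2 - p.1) ^+ 2 * L p.1 p.2).
  apply: measurable_funM => //; apply: measurable_funX; apply: measurable_funB => //.
  exact: (measurableT_comp mHD).
have mswap : measurable_fun setT (fun p : D * R => (p.2, p.1) : R * D).
  by apply: measurable_fun_pair; [exact: measurable_snd|exact: measurable_fst].
have mLs : measurable_fun setT (fun p : D * R => L p.2 p.1).
  exact: (measurableT_comp mLj mswap).
have mHs : measurable_fun setT (fun p : D * R => (H p.1 - p.2) ^+ 2 * L p.2 p.1).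
  exact: (measurableT_comp mHu mswap).
have E1 u : (\int[Q]_x ((H (y u x) - u) ^+ 2)%:E =
    \int[Q]_x ((H x - u) ^+ 2 * L u x)%:E)%E.
  rewrite (@time_measurable_shift u T H (fun w => ((w - u) ^+ 2)%:E))//.
  - by apply/measurable_EFinP; apply: measurable_funX; exact: measurable_funB.
  - by move=> w; rewrite lee_fin sqr_ge0.
have E2 u : (\int[Q]_x (L u x)%:E = 1)%E.
  have := @time_measurable_shift u T H (cst 1%E) Tt mH (measurable_cst _) (fun=> lee01).
  rewrite /= prob_integral_cst => ->.
  by apply: eq_integral => x _; rewrite mul1e.
under eq_integral do rewrite E1.
rewrite (@tonelli_swap _ _ _ _ _ N01 Q (fun u x => ((H x - u) ^+ 2 * L u x)%:E)); last 2 first.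
- by apply/measurable_EFinP.
- by move=> u x; rewrite lee_fin mulr_ge0 ?sqr_ge0 ?expR_ge0.
have q0 := information_ge0.
apply: (@le_trans _ _ (\int[Q]_x ((1 + q)^-1%:E * \int[N01]_u (L u x)%:E))%E); last first.
  apply: ge0_le_integral => //.
  - move=> x _; apply: mule_ge0; first by rewrite lee_fin invr_ge0 addr_ge0.
    by apply: integral_ge0 => u _; rewrite lee_fin expR_ge0.
  - apply: emeasurable_funM => //.
    apply: (@measurable_integral_snd _ _ _ _ _ N01 (fun x u => (L u x)%:E)).
      by apply/measurable_EFinP; exact: mLs.
    by move=> x u; rewrite lee_fin expR_ge0.
  - apply: (@measurable_integral_snd _ _ _ _ _ N01 (fun x u => ((H x - u) ^+ 2 * L u x)%:E)).
      by apply/measurable_EFinP; exact: mHs.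
    by move=> x u; rewrite lee_fin mulr_ge0 ?sqr_ge0 ?expR_ge0.
  - by move=> x _; exact: normal_posterior_variance.
rewrite ge0_integralZl//; last 3 first.
- apply: (@measurable_integral_snd _ _ _ _ _ N01 (fun x u => (L u x)%:E)).
    by apply/measurable_EFinP; exact: mLs.
  by move=> x u; rewrite lee_fin expR_ge0.
- by move=> x _; apply: integral_ge0 => u _; rewrite lee_fin expR_ge0.
- by rewrite lee_fin invr_ge0 addr_ge0.
rewrite -(@tonelli_swap _ _ _ _ _ N01 Q (fun u x => (L u x)%:E)); last 2 first.
- by apply/measurable_EFinP.
- by move=> u x; rewrite lee_fin expR_ge0.
by under eq_integral do rewrite E2; rewrite prob_integral_cst mule1.
Qed.

End wiener_cameron_martin.

Lemma sorted_times {R : realType} (n : nat) (T : seq R) :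
  (forall tau, tau \in T -> 0 <= tau <= n%:R) ->
  exists m (t : nat -> R), [/\ t 0%N = 0, forall i, (i < m)%N -> t i < t i.+1,
    t m <= n%:R & forall tau, tau \in T -> exists2 j, (j <= m)%N & tau = t j].
Proof.
move=> Tn; pose s := sort <=%R (undup (0 :: T)).
have ss : sorted <%R s.
  by rewrite lt_sorted_uniq_le sort_uniq undup_uniq sort_le_sorted.
have ms tau : (tau \in s) = (tau \in 0 :: T) by rewrite mem_sort mem_undup.
have s0 tau : tau \in s -> 0 <= tau <= n%:R.
  by rewrite ms inE => /predU1P[->|/Tn//]; rewrite lexx ler0n.
have sz : (0 < size s)%N.
  by case: s ms {ss s0} => // /(_ 0); rewrite mem_head in_nil.
exists (size s).-1, (nth 0 s); split.
- have h0 : 0 \in s by rewrite ms mem_head.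
  apply/eqP; rewrite eq_le; apply/andP; split; last first.
    by have /andP[] := s0 _ (mem_nth 0 sz).
  rewrite -[leRHS](nth_index 0 h0).
  by apply: (sorted_leq_nth le_trans le_refl) => //; rewrite ?inE ?index_mem//; exact: sort_le_sorted.
- move=> i im; have i1 : (i.+1 < size s)%N by rewrite -ltn_predRL.
  by apply: (sorted_ltn_nth lt_trans) => //; rewrite inE// ltnW.
- by have /andP[] := s0 _ (mem_nth 0 (n := (size s).-1) (s := s) (ltac:(by rewrite prednK))).
- move=> tau tT; have ts : tau \in s by rewrite ms inE tT orbT.
  exists (index tau s); last by rewrite nth_index.
  by rewrite -ltnS prednK// index_mem.
Qed.

(** * Bayes risk of a one-parameter drift *)

Section continuous_integrals.
Context {R : realType}.
Local Notation mu := (@lebesgue_measure R).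
Implicit Types f g : R -> R.

Lemma continuous_integrable f a b : continuous f -> mu.-integrable `[a, b] (EFin \o f).
Proof.
move=> cf; apply: continuous_compact_integrable; first exact: segment_compact.
exact: continuous_subspaceT.
Qed.

Lemma continuous_measurable f (A : set R) : continuous f -> measurable_fun A f.
Proof. by move=> cf; apply: measurable_funTS; exact: continuous_measurable_fun. Qed.

Lemma continuous_sqr f : continuous f -> continuous (fun x => f x ^+ 2).
Proof.
move=> cf x; rewrite (_ : (fun x => f x ^+ 2) = f \* f).
  by apply: continuousM; exact: cf.
by apply/funext => z; rewrite expr2.
Qed.

Lemma Rintegral_split f a b c : continuous f -> a <= b -> b <= c ->
  \int[mu]_(x in `[a, c]) f x = \int[mu]_(x in `[a, b]) f x + \int[mu]_(x in `[b, c]) f x.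
Proof.
move=> cf ab bc; apply/eqP; rewrite addrC -subr_eq; apply/eqP.
rewrite Rintegral_itvB; last 3 first.
- exact: continuous_integrable.
- by rewrite bnd_simp.
- by rewrite bnd_simp.
rewrite Rintegral_itv_obnd_cbnd//.
apply: integrableS (continuous_integrable b c cf) => //.
by apply: subset_itv; rewrite bnd_simp.
Qed.

Lemma Rintegral_itv_cst a b (r : R) : a <= b -> \int[mu]_(x in `[a, b]) r = r * (b - a).
Proof.
move=> ab; rewrite Rintegral_cst//= lebesgue_measure_itv/= lte_fin.
move: ab; rewrite le_eqVlt => /predU1P[->|->//].
by rewrite ltxx subrr.
Qed.

Lemma Rintegral_itv_ge0 a b f : (forall x, 0 <= f x) -> 0 <= \int[mu]_(x in `[a, b]) f x.
Proof. by move=> f0; apply: Rintegral_ge0 => x _. Qed.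

Lemma Rintegral_cauchy_schwarz f a b : continuous f -> a < b ->
  (\int[mu]_(x in `[a, b]) f x) ^+ 2 <= (b - a) * \int[mu]_(x in `[a, b]) (f x ^+ 2).
Proof.
move=> cf ab; have d0 : 0 < b - a by rewrite subr_gt0.
set I := (\int[mu]_(x in `[a, b]) f x)%R; pose m := I / (b - a).
have ic := continuous_integrable a b.
have cm (r : R) : continuous (fun x => r * f x).
  by move=> x; apply: cvgM; [exact: cvg_cst|exact: cf].
have cf2 := continuous_sqr cf.
have : 0 <= \int[mu]_(x in `[a, b]) (f x - m) ^+ 2.
  by apply: Rintegral_itv_ge0 => x; exact: sqr_ge0.
have -> : \int[mu]_(x in `[a, b]) (f x - m) ^+ 2 =
    \int[mu]_(x in `[a, b]) ((f x ^+ 2 - (2 * m) * f x) + m ^+ 2).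
  by apply: eq_Rintegral => x _; ring.
rewrite RintegralD//; last 2 first.
- apply: (ic (fun x => f x ^+ 2 - (2 * m) * f x)) => x.
  by apply: cvgB; [exact: cf2|exact: cm].
- by apply: (ic (fun x => m ^+ 2)) => x; exact: cvg_cst.
rewrite RintegralB//; [|exact: ic|exact: ic].
rewrite RintegralZl//; last exact: ic.
rewrite -/I (Rintegral_itv_cst _ (ltW ab)).
set J := (\int[mu]_(x in `[a, b]) (f x ^+ 2))%R.
have -> : J - 2 * m * I + m ^+ 2 * (b - a) = J - I ^+ 2 / (b - a).
  by rewrite /m; field; rewrite gt_eqF.
by rewrite subr_ge0 ler_pdivrMr// mulrC.
Qed.

End continuous_integrals.

Section drift.
Context {R : realType} {n : nat}.
Local Notation mu := (@lebesgue_measure R).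
Variable psi : R -> R.
Hypothesis cpsi : continuous psi.

Definition drift (t : R) : R := \int[mu]_(x in `[0, t]) psi x.

Lemma drift0 : drift 0 = 0.
Proof. by rewrite /drift set_itv1 Rintegral_set1. Qed.

Lemma cadlag_drift_path : cadlag n%:R drift.
Proof.
apply: cadlag_within_continuous.
apply: parameterized_integral_continuous; first by rewrite ler0n.
exact: continuous_integrable.
Qed.

Lemma driftB a b : 0 <= a -> a <= b ->
  drift b - drift a = \int[mu]_(x in `[a, b]) psi x.
Proof. by move=> a0 ab; rewrite /drift (Rintegral_split cpsi a0 ab) addrC addKr. Qed.

(** By the Cauchy-Schwarz inequality on each interval, observing finitely many
    times yields at most the information of the whole path. *)
Lemma drift_information (c : R) (m : nat) (t : nat -> R) : 0 < c ->
  t 0%N = 0 -> (forall i, (i < m)%N -> t i < t i.+1) -> t m <= n%:R ->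
  \sum_(i < m) (drift (t i.+1) - drift (t i)) ^+ 2 / (c * (t i.+1 - t i)) <=
  (\int[mu]_(x in `[0%R, n%:R%R]) (psi x ^+ 2)) / c.
Proof.
move=> c0 t0 tincr tm.
have cp2 := continuous_sqr cpsi.
have tge0 i : (i <= m)%N -> 0 <= t i.
  elim: i => [|i IH im]; first by rewrite t0.
  by apply: le_trans (IH (ltnW im)) _; apply: ltW; exact: tincr.
have key i : (i < m)%N -> (drift (t i.+1) - drift (t i)) ^+ 2 / (c * (t i.+1 - t i))
    <= (\int[mu]_(x in `[t i, t i.+1]) (psi x ^+ 2)) / c.
  move=> im; have d0 : 0 < t i.+1 - t i by rewrite subr_gt0 tincr.
  rewrite (driftB (tge0 _ (ltnW im)) (ltW (tincr _ im))).
  rewrite ler_pdivrMr ?mulr_gt0//.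
  have -> : forall J, J / c * (c * (t i.+1 - t i)) = (t i.+1 - t i) * J.
    by move=> J; field; rewrite gt_eqF.
  exact: Rintegral_cauchy_schwarz (tincr _ im).
apply: (@le_trans _ _ (\sum_(i < m) (\int[mu]_(x in `[t i, t i.+1]) (psi x ^+ 2)) / c)).
  by apply: ler_sum => i _; exact: key.
rewrite -mulr_suml ler_pM2r ?invr_gt0//.
have tele k : (k <= m)%N -> \sum_(i < k) (\int[mu]_(x in `[t i, t i.+1]) (psi x ^+ 2))
    = \int[mu]_(x in `[0, t k]) (psi x ^+ 2).
  elim: k => [|k IH km]; first by rewrite big_ord0 t0 set_itv1 Rintegral_set1.
  rewrite big_ord_recr /= IH ?(ltnW km)//.
  by rewrite -Rintegral_split ?tge0 ?(ltnW km)//; apply: ltW; exact: tincr.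
rewrite tele// (@Rintegral_split _ _ 0 (t m) n%:R)// ?tge0//.
by rewrite lerDl Rintegral_itv_ge0// => x; exact: sqr_ge0.
Qed.
End drift.

Section clip.
Context {R : realType}.
Implicit Types b g h : R.

Lemma clip_le b h : 0 <= b -> `|Num.max (- b) (Num.min b h)| <= b.
Proof. by move=> b0; rewrite ler_norml le_max lexx /= ge_max ge_min lexx /= andbT; lra. Qed.

Lemma clip_dist b g h : `|g| <= b ->
  `|g - Num.max (- b) (Num.min b h)| <= `|g - h|.
Proof.
rewrite ler_norml => /andP[g1 g2].
have [bh|hb] := leP b h.
  rewrite (_ : Num.max _ _ = b); last by apply/max_idPr; lra.
  by rewrite ler0_norm ?subr_le0// ler0_norm ?subr_le0//; lra.
have [h'|h'] := leP (- b) h => //.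
by rewrite ger0_norm ?subr_ge0// ger0_norm ?subr_ge0//; lra.
Qed.
End clip.

Section one_dimensional_bayes.
Context {R : realType} {n : nat}.
Local Notation D := (skorokhod R n).
Local Notation mu := (@lebesgue_measure R).
Local Notation N01 := (@normal_prob R 0 1).
Variables (Q : probability D R) (c : R).
Hypotheses (c0 : 0 < c) (wQ : wiener c Q).
Variable psi : R -> R.
Hypothesis cpsi : continuous psi.

Lemma measurable_drift_path :
  measurable_fun setT (fun p : R * D => path_add (fun t => p.1 * drift psi t) p.2).
Proof.
apply: measurable_path_add => //.
- by move=> p; apply: cadlagZ; exact: cadlag_drift_path.
- by move=> t _; exact: measurable_funM.
Qed.

(** Reduction to finitely many times. G is approximated in L^1 under P, the
    law of the observation when u is drawn from the prior; as the approximation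
    can be clipped at the bound b of G, the L^1 distance also controls the
    difference of the risks. The bound does not depend on the times, so the approximation error
    can tend to 0. *)
Lemma one_dimensional_bayes (G : D -> R) (b A : R) :
  measurable_fun setT G -> (forall x, `|G x| <= b) ->
  \int[mu]_(x in `[0%R, n%:R%R]) (psi x ^+ 2) <= A ->
  ((1 + A / c)^-1%:E <= \int[N01]_u \int[Q]_x
     ((G (path_add (fun t => u * drift psi t) x) - u) ^+ 2)%:E)%E.
Proof.
move=> mG Gb psiA.
pose y (u : R) (x : D) := path_add (fun t => u * drift psi t) x.
have my : measurable_fun setT (fun p : R * D => y p.1 p.2) := measurable_drift_path.
have b0 : 0 <= b by exact: le_trans (normr_ge0 _) (Gb point).
pose m := measure_function_pushforward__canonical__measure_function_Measure
   (product_measure1 N01 Q) my.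
have m1 : m setT = 1%E.
  rewrite /m /= /pushforward preimage_setT.
  exact: (@probability_setT _ _ _ (N01 \x Q)%E).
pose P : probability D R :=
  HB.pack (Measure.sort m) (Measure_isProbability.Build _ _ _ m m1).
have PE (F : D -> \bar R) : measurable_fun setT F -> (forall x, (0 <= F x)%E) ->
    (\int[P]_x F x = \int[N01]_u \int[Q]_x F (y u x))%E.
  move=> mF F0; transitivity (\int[m]_x F x)%E; first by [].
  rewrite ge0_integral_pushforward//= preimage_setT.
  rewrite (@fubini_tonelli1 _ _ _ _ _ N01 Q (F \o (fun p => y p.1 p.2)))//.
    exact: measurableT_comp.
  by move=> p /=.
set V := (leRHS).
have mGy : measurable_fun setT (fun p : R * D => G (y p.1 p.2)) by exact: measurableT_comp.
have key (e eta : R) : 0 < e -> 0 < eta ->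
    ((1 + A / c)^-1%:E <= (1 + eta)%:E * V + ((1 + eta^-1) * (2 * b * e))%:E)%E.
  move=> e0 eta0.
  have [T0 [H0 [mH0 GH0]]] := @bounded_approximable _ _ P G b mG Gb e e0.
  pose T := [seq clamp n%:R tau | tau <- T0].
  pose H x := Num.max (- b) (Num.min b (H0 x)).
  have mH : time_measurable T H.
    suff mH0' : time_measurable T H0.
      by apply: measurable_maxr => //; exact: measurable_minr.
    move=> _ B mB; have := mH0 measurableT B mB; rewrite !setTI.
    apply: smallest_sub; first exact: smallest_sigma_algebra.
    move=> _ [tau tT [C mC <-]]; apply: sub_sigma_algebra.
    exists (clamp n%:R tau); first by apply: map_f.
    by exists C => //; apply/seteqP; split => x /=; rewrite -traj_clamp.
  have Tn tau : tau \in T -> 0 <= tau <= n%:R.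
    by move=> /mapP[t _ ->]; exact: clamp_in_itv.
  have [k [t [t0 tincr tm Tt]]] := sorted_times Tn.
  have := @bayes_time_measurable R n Q c c0 wQ k t t0 tincr tm (drift psi)
    (cadlag_drift_path cpsi) (drift0 psi) T H Tt mH.
  have mHD := time_measurable_measurable mH.
  have mHy : measurable_fun setT (fun p : R * D => H (y p.1 p.2)) by exact: measurableT_comp.
  have Hb x : `|H x| <= b := clip_le _ b0.
  have GH x : `|G x - H x| <= `|G x - H0 x| := clip_dist _ (Gb x).
  have qA := drift_information cpsi c0 t0 tincr tm.
  have qA' : \sum_(i < k) (drift psi (t i.+1) - drift psi (t i)) ^+ 2 / (c * (t i.+1 - t i))
     <= A / c by apply: le_trans qA _; rewrite ler_pM2r ?invr_gt0.
  have q0 : 0 <= \sum_(i < k) (drift psi (t i.+1) - drift psi (t i)) ^+ 2 / (c * (t i.+1 - t i)).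
    apply: sumr_ge0 => i _; rewrite divr_ge0 ?sqr_ge0// mulr_ge0 ?ltW//.
    by rewrite subr_gt0 tincr.
  move=> h; apply: le_trans (le_trans h _).
    by rewrite lee_fin lef_pV2 ?posrE ?lerD2l//; apply: ltr_pwDl => //; exact: le_trans qA'.
  have mGs u : measurable_fun setT (fun x => ((G (y u x) - u) ^+ 2)%:E).
    apply/measurable_EFinP/measurable_funX/measurable_funB => //.
    apply: (measurableT_comp mG); apply: measurable_path_add => //.
    by move=> _; apply: cadlagZ; exact: cadlag_drift_path.
  have mDs u : measurable_fun setT (fun x => `|G (y u x) - H (y u x)|%:E).
    apply/measurable_EFinP/measurableT_comp => //; apply: measurable_funB.
      apply: (measurableT_comp mG); apply: measurable_path_add => //.
      by move=> _; apply: cadlagZ; exact: cadlag_drift_path.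
    apply: (measurableT_comp mHD); apply: measurable_path_add => //.
    by move=> _; apply: cadlagZ; exact: cadlag_drift_path.
  have mV : measurable_fun setT (fun u => \int[Q]_x ((G (y u x) - u) ^+ 2)%:E)%E.
    apply: (@measurable_integral_snd _ _ _ _ _ Q (fun u x => ((G (y u x) - u) ^+ 2)%:E)).
      by apply/measurable_EFinP/measurable_funX/measurable_funB.
    by move=> u x; rewrite lee_fin sqr_ge0.
  have mW : measurable_fun setT (fun u => \int[Q]_x `|G (y u x) - H (y u x)|%:E)%E.
    apply: (@measurable_integral_snd _ _ _ _ _ Q (fun u x => `|G (y u x) - H (y u x)|%:E)).
      by apply/measurable_EFinP/measurableT_comp => //; exact: measurable_funB.
    by move=> u x; rewrite lee_fin.
  have k0 : 0 <= (1 + eta^-1) * (2 * b).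
    by rewrite mulr_ge0 ?mulr_ge0// addr_ge0// invr_ge0 ltW.
  have eta1 : 0 <= 1 + eta by rewrite addr_ge0// ltW.
  apply: (@le_trans _ _ (\int[N01]_u ((1 + eta)%:E * (\int[Q]_x ((G (y u x) - u) ^+ 2)%:E)
     + ((1 + eta^-1) * (2 * b))%:E * (\int[Q]_x `|G (y u x) - H (y u x)|%:E)))%E).
    apply: ge0_le_integral => //.
    - by move=> u _; apply: integral_ge0 => x _; rewrite lee_fin sqr_ge0.
    - apply: (@measurable_integral_snd _ _ _ _ _ Q (fun u x => ((H (y u x) - u) ^+ 2)%:E)).
        by apply/measurable_EFinP/measurable_funX/measurable_funB.
      by move=> u x; rewrite lee_fin sqr_ge0.
    - by apply: emeasurable_funD; apply: emeasurable_funM.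
    - move=> u _; rewrite -ge0_integralZl//; last first.
        by move=> x _; rewrite lee_fin sqr_ge0.
      rewrite -ge0_integralZl//.
      rewrite -ge0_integralD//; last 4 first.
      + by move=> x _; rewrite -EFinM lee_fin mulr_ge0// sqr_ge0.
      + by apply: emeasurable_funM.
      + by move=> x _; rewrite -EFinM lee_fin mulr_ge0.
      + by apply: emeasurable_funM.
      apply: ge0_le_integral => //.
      + by move=> x _; rewrite lee_fin sqr_ge0.
      + apply/measurable_EFinP/measurable_funX/measurable_funB => //.
        apply: (measurableT_comp mHD); apply: measurable_path_add => //.
        by move=> _; apply: cadlagZ; exact: cadlag_drift_path.
      + by apply: emeasurable_funD; apply: emeasurable_funM.
      + move=> x _; rewrite -!EFinM -EFinD lee_fin.
        have := GH (y u x); have := Gb (y u x); have := Hb (y u x).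
        set g := G _; set h1 := H _; move=> hb gb _.
        have d2 : (g - h1) ^+ 2 <= 2 * b * `|g - h1|.
          rewrite -real_normK ?num_real// expr2 ler_wpM2r//.
          by apply: le_trans (ler_normB _ _) _; rewrite mulr_natl mulr2n lerD.
        apply: (@le_trans _ _ ((1 + eta) * (g - u) ^+ 2 + (1 + eta^-1) * (g - h1) ^+ 2)).
          rewrite -subr_ge0.
          have -> : (1 + eta) * (g - u) ^+ 2 + (1 + eta^-1) * (g - h1) ^+ 2 - (h1 - u) ^+ 2
            = eta^-1 * (eta * (g - u) + (g - h1)) ^+ 2 by field; rewrite gt_eqF.
          by rewrite mulr_ge0 ?sqr_ge0// invr_ge0 ltW.
        rewrite lerD2l -mulrA ler_wpM2l// addr_ge0// invr_ge0; exact: ltW.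
  rewrite ge0_integralD//; last 4 first.
  - move=> u _; rewrite mule_ge0//.
    by apply: integral_ge0 => x _; rewrite lee_fin sqr_ge0.
  - exact: emeasurable_funM.
  - by move=> u _; rewrite mule_ge0//; apply: integral_ge0.
  - exact: emeasurable_funM.
  rewrite ge0_integralZl//; last first.
    by move=> u _; apply: integral_ge0 => x _; rewrite lee_fin sqr_ge0.
  apply: leeD => //.
  rewrite ge0_integralZl//; last by move=> u _; apply: integral_ge0.
  have mGH : measurable_fun setT (fun x => `|G x - H x|%:E).
    by apply/measurable_EFinP/measurableT_comp => //; exact: measurable_funB.
  rewrite [X in (_ <= X%:E)%E]mulrA [X in (_ <= X)%E]EFinM; apply: lee_wpmul2l => //.
  rewrite -(PE (fun x => `|G x - H x|%:E))//.
  apply: le_trans GH0; apply: ge0_le_integral => //.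
  - apply/measurable_EFinP/measurableT_comp => //; apply: measurable_funB => //.
    exact: time_measurable_measurable mH0.
  - by move=> x _; rewrite lee_fin.
have V0 : (0 <= V)%E.
  by apply: integral_ge0 => u _; apply: integral_ge0 => x _; rewrite lee_fin sqr_ge0.
case: V V0 key => [v|_ _|//]; last by rewrite leey.
rewrite lee_fin => v0 key; rewrite lee_fin; apply/ler_addgt0Pr => e e0.
have e2 : 0 < e / 2 by rewrite divr_gt0.
pose eta := e / 2 / (v + 1).
have v1 : 0 < v + 1 by rewrite ltr_wpDl.
have eta0 : 0 < eta by rewrite divr_gt0.
have k0 : 0 < (1 + eta^-1) * (2 * b) + 1.
  by rewrite ltr_wpDl// mulr_ge0 ?mulr_ge0// addr_ge0// invr_ge0 ltW.
have := key _ _ (divr_gt0 e2 k0) eta0.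
rewrite -EFinM -EFinD lee_fin => /le_trans; apply.
rewrite mulrDl mul1r -addrA lerD2l [leRHS]splitr lerD//.
  by rewrite /eta mulrAC ler_pdivrMr// ler_pM2l// lerDl.
suff -> : (1 + eta^-1) * (2 * b * (e / 2 / ((1 + eta^-1) * (2 * b) + 1))) =
    e / 2 * ((1 + eta^-1) * (2 * b)) / ((1 + eta^-1) * (2 * b) + 1).
  by rewrite ler_pdivrMr// ler_pM2l// lerDl.
by ring.
Qed.

End one_dimensional_bayes.

(** * Calculus and orthonormality of the trigonometric basis *)

Section calculus.
Context {R : realType}.
Local Notation mu := (@lebesgue_measure R).
Implicit Types (F G f g : R -> R) (w x a b : R).

Lemma is_derive_continuous F f : (forall x, is_derive x 1 F (f x)) -> continuous F.
Proof.
move=> dF x; apply/differentiable_continuous/derivable1_diffP.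
by apply: ex_derive; exact: dF.
Qed.

Lemma Rintegral_FTC F f a b : a <= b -> (forall x, is_derive x 1 F (f x)) ->
  continuous f -> \int[mu]_(x in `[a, b]) f x = F b - F a.
Proof.
move=> ab dF cf; have cF := is_derive_continuous dF.
move: ab; rewrite le_eqVlt => /predU1P[->|ab]; first by rewrite set_itv1 Rintegral_set1 subrr.
rewrite /Rintegral (@continuous_FTC2 R f F a b ab)//.
- exact: continuous_subspaceT.
- split; first by move=> x _; apply: ex_derive; exact: dF.
    by apply: cvg_at_right_filter; exact: cF.
  by apply: cvg_at_left_filter; exact: cF.
- by move=> x _; rewrite derive1E; apply: derive_val; exact: dF.
Qed.

Lemma continuousM_fun f g : continuous f -> continuous g -> continuous (fun x => f x * g x).
Proof. by move=> cf cg x; apply: cvgM; [exact: cf|exact: cg]. Qed.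

Lemma continuousD_fun f g : continuous f -> continuous g -> continuous (fun x => f x + g x).
Proof. by move=> cf cg x; apply: cvgD; [exact: cf|exact: cg]. Qed.

Lemma continuousZ_fun (r : R) f : continuous f -> continuous (fun x => r * f x).
Proof. by move=> cf x; apply: cvgM; [exact: cvg_cst|exact: cf]. Qed.

Lemma continuousN_fun f : continuous f -> continuous (fun x => - f x).
Proof. by move=> cf x; apply: (@cvgN _ R); exact: cf. Qed.

Lemma continuous_sum_fun (I : Type) (s : seq I) (f : I -> R -> R) :
  (forall i, continuous (f i)) -> continuous (fun x => \sum_(i <- s) f i x).
Proof.
move=> cf; elim: s => [|i s IH].
  by under eq_fun do rewrite big_nil; move=> x; exact: cvg_cst.
by under eq_fun do rewrite big_cons; exact: continuousD_fun.
Qed.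

Lemma continuous_cst_fun (r : R) : continuous (fun _ : R => r).
Proof. by move=> x; exact: cvg_cst. Qed.

Lemma Rintegral_by_parts F f G g a b : a <= b ->
  (forall x, is_derive x 1 F (f x)) -> (forall x, is_derive x 1 G (g x)) ->
  continuous f -> continuous g ->
  \int[mu]_(x in `[a, b]) (F x * g x) =
  F b * G b - F a * G a - \int[mu]_(x in `[a, b]) (f x * G x).
Proof.
move=> ab dF dG cf cg.
have cF := is_derive_continuous dF; have cG := is_derive_continuous dG.
have dFG x : is_derive x 1 (fun x => F x * G x) (F x * g x + f x * G x).
  by apply: is_derive_eq; rewrite /GRing.scale/= [G x * _]mulrC.
have cFg := continuousM_fun cF cg; have cfG := continuousM_fun cf cG.
have := Rintegral_FTC ab dFG (continuousD_fun cFg cfG).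
rewrite RintegralD//; [|exact: continuous_integrable|exact: continuous_integrable].
by move=> <-; rewrite addrK.
Qed.

Lemma is_derive_linear w x : is_derive x 1 (fun x => w * x) w.
Proof. by apply: is_derive_eq; rewrite /GRing.scale/= ?mulr1 ?mulr0 ?addr0. Qed.

Lemma is_derive_cosw w x : is_derive x 1 (fun x => cos (w * x)) (- w * sin (w * x)).
Proof.
rewrite (_ : - w * sin (w * x) = - sin (w * x) * w); last by ring.
exact: (@is_derive1_comp _ cos (fun x => w * x) x _ _ (is_derive_cos _) (is_derive_linear w x)).
Qed.

Lemma is_derive_sinw w x : is_derive x 1 (fun x => sin (w * x)) (w * cos (w * x)).
Proof.
rewrite mulrC.
exact: (@is_derive1_comp _ sin (fun x => w * x) x _ _ (is_derive_sin _) (is_derive_linear w x)).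
Qed.

Lemma continuous_cosw w : continuous (fun x : R => cos (w * x)).
Proof. exact: is_derive_continuous (is_derive_cosw w). Qed.

Lemma continuous_sinw w : continuous (fun x : R => sin (w * x)).
Proof. exact: is_derive_continuous (is_derive_sinw w). Qed.

Lemma cos_nat_period (k : nat) : cos (2 * pi * k%:R) = 1 :> R.
Proof.
elim: k => [|k IH]; first by rewrite mulr0 cos0.
have -> : 2 * pi * k.+1%:R = 2 * pi * k%:R + pi *+ 2 :> R.
  by rewrite -natr1 -mulr_natl; ring.
by rewrite cosD2pi.
Qed.

Lemma sin_nat_period (k : nat) : sin (2 * pi * k%:R) = 0 :> R.
Proof.
elim: k => [|k IH]; first by rewrite mulr0 sin0.
have -> : 2 * pi * k.+1%:R = 2 * pi * k%:R + pi *+ 2 :> R.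
  by rewrite -natr1 -mulr_natl; ring.
by rewrite sinD2pi.
Qed.

Definition freq (m : nat) : R := 2 * pi * m%:R.

Lemma freq_ge0 m : 0 <= freq m. Proof. by rewrite /freq !mulr_ge0// pi_ge0. Qed.

Lemma freq_gt0 m : (0 < m)%N -> 0 < freq m.
Proof. by move=> m0; rewrite /freq !mulr_gt0 ?pi_gt0// ltr0n. Qed.

Lemma cos_shift_period m x : cos (freq m * (x + 1)) = cos (freq m * x).
Proof. by rewrite mulrDr mulr1 cosD cos_nat_period sin_nat_period mulr1 mulr0 subr0. Qed.

Lemma sin_shift_period m x : sin (freq m * (x + 1)) = sin (freq m * x).
Proof. by rewrite mulrDr mulr1 sinD cos_nat_period sin_nat_period mulr1 mulr0 addr0. Qed.

Lemma integral_cos_freq m y : \int[mu]_(x in `[0, 1]) cos (freq m * x + y) =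
  (m == 0%N)%:R * cos y.
Proof.
case: eqVneq => [->|m0].
  under eq_Rintegral do rewrite /freq mulr0 mul0r add0r.
  by rewrite Rintegral_itv_cst// subr0 mulr1 mul1r.
rewrite mul0r; have w0 : freq m != 0 by rewrite gt_eqF// freq_gt0// lt0n.
have dF x : is_derive x 1 (fun x => (freq m)^-1 * sin (freq m * x + y)) (cos (freq m * x + y)).
  have h : is_derive x 1 (fun x => freq m * x + y) (freq m).
    by apply: is_derive_eq; rewrite /GRing.scale/= ?mulr1 ?mulr0 ?addr0.
  have h2 : is_derive x 1 (fun x => sin (freq m * x + y)) (cos (freq m * x + y) * freq m).
    exact: (@is_derive1_comp _ sin (fun x => freq m * x + y) x _ _ (is_derive_sin _) h).
  by apply: is_derive_eq; rewrite /GRing.scale/= ?mulr0 ?addr0 mulrCA mulVf// mulr1.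
have cc : continuous (fun x => cos (freq m * x + y)).
  move=> x; apply: (@continuous_comp _ _ _ (fun x => freq m * x + y) cos); last exact: continuous_cos.
  by apply: cvgD; [apply: cvgM; [exact: cvg_cst|exact: cvg_id]|exact: cvg_cst].
rewrite (Rintegral_FTC ler01 dF cc) mulr1 mulr0 add0r.
by rewrite sinD sin_nat_period cos_nat_period mul0r add0r mul1r subrr.
Qed.

End calculus.

Section orthonormality.
Context {R : realType}.
Local Notation mu := (@lebesgue_measure R).
Local Notation phi := (@trig_basis R).
Implicit Types (f g : R -> R).

Definition ip f g : R := \int[mu]_(x in `[0, 1]) (f x * g x).

Lemma trig_basis_cos m x : (0 < m)%N -> phi m.*2 x = Num.sqrt 2 * cos (freq m * x).
Proof. by case: m => // m _; rewrite /trig_basis odd_double doubleK. Qed.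

Lemma trig_basis_sin m x : (0 < m)%N -> phi m.*2.+1 x = Num.sqrt 2 * sin (freq m * x).
Proof. by case: m => // m _; rewrite /trig_basis /= odd_double uphalf_double. Qed.

Lemma trig_basisP j : (0 < j)%N -> [\/ j = 1%N,
  exists2 m, (0 < m)%N & j = m.*2 | exists2 m, (0 < m)%N & j = m.*2.+1].
Proof.
move=> j0; case: (leqP j 1) => j1.
  by constructor 1; apply/eqP; rewrite eqn_leq j1 j0.
have h : (0 < j./2)%N by rewrite half_gt0.
by case o: (odd j); [constructor 3|constructor 2]; exists j./2 => //;
  rewrite -[LHS](odd_double_half j) o.
Qed.

Lemma continuous_trig_basis j : continuous (phi j).
Proof.
rewrite (_ : phi j = fun x => if (j <= 1)%N then 1 else if odd j
  then Num.sqrt 2 * sin (freq j./2 * x) else Num.sqrt 2 * cos (freq j./2 * x))//.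
case: (j <= 1)%N; first exact: continuous_cst_fun.
by case: (odd j); apply: continuousZ_fun; [exact: continuous_sinw|exact: continuous_cosw].
Qed.

Lemma trig_basis_periodic j x : phi j (x + 1) = phi j x.
Proof.
rewrite /trig_basis -/(freq j./2).
by case: ifP => // _; case: ifP => _; rewrite ?cos_shift_period ?sin_shift_period.
Qed.

Lemma sqr_sqrt2 : Num.sqrt 2 * Num.sqrt 2 = 2 :> R.
Proof. by rewrite -expr2 sqr_sqrtr. Qed.

Lemma integral_cos_prod m l y z :
  \int[mu]_(x in `[0, 1]) (cos (freq m * x + y) * cos (freq l * x + z)) =
  2^-1 * ((m == l)%:R * cos (y - z) + ((m == 0%N) && (l == 0%N))%:R * cos (y + z)).
Proof.
wlog lm : m l y z / (l <= m)%N => [hw|].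
  case/orP: (leq_total l m) => [/hw//|/hw h].
  under eq_Rintegral do rewrite mulrC.
  by rewrite h eq_sym andbC -cosN opprB [z + y]addrC.
have E x : cos (freq m * x + y) * cos (freq l * x + z) =
   2^-1 * cos (freq (m - l) * x + (y - z)) + 2^-1 * cos (freq (m + l) * x + (y + z)) :> R.
  have -> : freq (m - l) * x + (y - z) = (freq m * x + y) - (freq l * x + z) :> R.
    by rewrite /freq natrB//; ring.
  have -> : freq (m + l) * x + (y + z) = (freq m * x + y) + (freq l * x + z) :> R.
    by rewrite /freq natrD; ring.
  move: (freq m * x + y) (freq l * x + z) => A B.
  by rewrite cosB cosD; field.
under eq_Rintegral do rewrite E.
have cc k w : continuous (fun x : R => 2^-1 * cos (freq k * x + w)).
  apply: continuousZ_fun => x.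
  apply: (@continuous_comp _ _ _ (fun x => freq k * x + w) cos); last exact: continuous_cos.
  by apply: cvgD; [apply: cvgM; [exact: cvg_cst|exact: cvg_id]|exact: cvg_cst].
have c1 k w : continuous (fun x : R => cos (freq k * x + w)).
  move=> x; apply: (@continuous_comp _ _ _ (fun x => freq k * x + w) cos); last exact: continuous_cos.
  by apply: cvgD; [apply: cvgM; [exact: cvg_cst|exact: cvg_id]|exact: cvg_cst].
rewrite RintegralD//; [|exact: continuous_integrable|exact: continuous_integrable].
rewrite RintegralZl//; last exact: continuous_integrable.
rewrite RintegralZl//; last exact: continuous_integrable.
rewrite !integral_cos_freq addn_eq0 subn_eq0 mulrDr.
by rewrite [(m == l)]eqn_leq lm andbT.
Qed.

(** Sines are shifted cosines: with phases, orthonormality is one computation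
    instead of three. *)
Definition phase (j : nat) : R := if odd j then - (pi / 2) else 0.

Lemma trig_basis_phase j x : (1 < j)%N ->
  phi j x = Num.sqrt 2 * cos (freq j./2 * x + phase j).
Proof.
move=> j1; rewrite /trig_basis leqNgt j1 /= /phase -/(freq j./2).
by case: (odd j); rewrite ?cosBpihalf ?addr0.
Qed.

Lemma ipC f g : ip f g = ip g f.
Proof. by apply: eq_Rintegral => x _; rewrite mulrC. Qed.

Lemma trig_basis_orthonormal i j : (0 < i)%N -> (0 < j)%N ->
  ip (phi i) (phi j) = (i == j)%:R.
Proof.
have main k l : (1 < k)%N -> (1 < l)%N -> ip (phi k) (phi l) = (k == l)%:R.
  move=> k1 l1; rewrite /ip.
  have E x : phi k x * phi l x =
      2 * (cos (freq k./2 * x + phase k) * cos (freq l./2 * x + phase l)).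
    by rewrite !trig_basis_phase// mulrACA sqr_sqrt2.
  under eq_Rintegral do rewrite E.
  have c1 m w : continuous (fun x : R => cos (freq m * x + w)).
    move=> x; apply: (@continuous_comp _ _ _ (fun x => freq m * x + w) cos); last exact: continuous_cos.
    by apply: cvgD; [apply: cvgM; [exact: cvg_cst|exact: cvg_id]|exact: cvg_cst].
  rewrite RintegralZl//; last first.
    by apply: continuous_integrable; apply: continuousM_fun; exact: c1.
  rewrite integral_cos_prod mulrA divff// mul1r.
  have k2 : (k./2 == 0)%N = false by apply/negbTE; rewrite -lt0n half_gt0.
  rewrite k2 mul0r addr0.
  have -> : (k == l) = (k./2 == l./2) && (odd k == odd l).
    apply/idP/andP => [/eqP -> //|[/eqP h /eqP o]].
    by rewrite -(odd_double_half k) -(odd_double_half l) h o.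
  case: eqVneq => [_|_]; rewrite ?mul0r//= mul1r /phase.
  case: (odd k); case: (odd l) => /=; rewrite ?subrr ?cos0//.
    by rewrite subr0 cosN cos_pihalf.
  by rewrite sub0r opprK cos_pihalf.
have one l : (1 < l)%N -> ip (phi 1%N) (phi l) = 0.
  move=> l1; rewrite /ip.
  have E x : phi 1%N x * phi l x = Num.sqrt 2 * cos (freq l./2 * x + phase l).
    by rewrite (trig_basis_phase x l1) /trig_basis /= mul1r.
  under eq_Rintegral do rewrite E.
  rewrite RintegralZl//; last first.
    apply: continuous_integrable => x.
    apply: (@continuous_comp _ _ _ (fun x => freq l./2 * x + phase l) cos); last exact: continuous_cos.
    by apply: cvgD; [apply: cvgM; [exact: cvg_cst|exact: cvg_id]|exact: cvg_cst].
  rewrite integral_cos_freq (_ : (l./2 == 0)%N = false) ?mul0r ?mulr0//.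
  by apply/negbTE; rewrite -lt0n half_gt0.
case: i => // -[|i] _; case: j => // -[|j] _.
- rewrite eqxx /ip; under eq_Rintegral do rewrite /trig_basis /= mul1r.
  by rewrite Rintegral_itv_cst// subr0 mulr1.
- by rewrite one.
- by rewrite ipC one.
- exact: main.
Qed.

End orthonormality.

(** * Bessel's inequality and energies of derivatives *)

Section L2_functions.
Context {R : realType}.
Local Notation mu := (@lebesgue_measure R).
Implicit Types (f g : R -> R) (T : R).

Lemma L2_continuous T f : continuous f -> L2fun T f.
Proof.
move=> cf; split; first exact: continuous_measurable.
have /integrableP[_] := continuous_integrable 0 T (continuous_sqr cf).
by under eq_integral do rewrite /= ger0_norm ?sqr_ge0//.
Qed.

Lemma L2_sqr_integrable T f : L2fun T f -> mu.-integrable `[0, T] (fun x => (f x ^+ 2)%:E).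
Proof.
move=> [mf If]; apply/integrableP; split.
  by apply/measurable_EFinP; exact: measurable_funX.
by under eq_integral do rewrite /= ger0_norm ?sqr_ge0//.
Qed.

Lemma L2_mul_integrable T f g : L2fun T f -> L2fun T g ->
  mu.-integrable `[0, T] (fun x => (f x * g x)%:E).
Proof.
move=> Lf Lg; have [mf _] := Lf; have [mg _] := Lg.
apply: (@le_integrable _ _ _ mu _ _ _ (fun x => ((f x ^+ 2)%:E + (g x ^+ 2)%:E)%E)) => //.
- by apply/measurable_EFinP; exact: measurable_funM.
- move=> x _; rewrite /= lee_fin [leRHS]ger0_norm ?addr_ge0 ?sqr_ge0// normrM.
  rewrite -(real_normK (num_real (f x))) -(real_normK (num_real (g x))).
  have := sqr_ge0 (`|f x| - `|g x|); have := normr_ge0 (f x); have := normr_ge0 (g x).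
  by nra.
- by apply: integrableD => //; exact: L2_sqr_integrable.
Qed.

Lemma L2_sub_scale T f g (c : R) : L2fun T f -> L2fun T g ->
  L2fun T (fun x => f x - c * g x).
Proof.
move=> Lf Lg; have [mf _] := Lf; have [mg _] := Lg.
have mh : measurable_fun `[0, T] (fun x => f x - c * g x).
  by apply: measurable_funB => //; exact: measurable_funM.
split; first exact: mh.
apply: (@le_lt_trans _ _ (\int[mu]_(x in `[0%R, T])
   ((2 : R)%:E * (f x ^+ 2)%:E + (2 * c ^+ 2)%R%:E * (g x ^+ 2)%:E))%E).
  apply: ge0_le_integral => //.
  - by move=> x _; rewrite lee_fin sqr_ge0.
  - by apply/measurable_EFinP; exact: measurable_funX.
  - by apply: emeasurable_funD; apply: emeasurable_funM => //; apply/measurable_EFinP; exact: measurable_funX.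
  - move=> x _; rewrite -!EFinM -EFinD lee_fin -subr_ge0.
    rewrite (_ : _ - _ = (f x + c * g x) ^+ 2) ?sqr_ge0//; ring.
have If := L2_sqr_integrable Lf; have Ig := L2_sqr_integrable Lg.
have I12 : mu.-integrable `[0, T]
    (fun x => (2 : R)%:E * (f x ^+ 2)%:E + (2 * c ^+ 2)%R%:E * (g x ^+ 2)%:E)%E.
  by apply: integrableD => //; exact: integrableZl.
have /integrableP[_] := I12.
apply: le_lt_trans; apply: le_integral => //.
- exact: integrable_abse.
- by move=> x _; exact: lee_abs.
Qed.

End L2_functions.

Section fourier.
Context {R : realType}.
Local Notation mu := (@lebesgue_measure R).
Local Notation phi := (@trig_basis R).
Local Notation L2 := (@L2fun R 1).
Implicit Types (f g h : R -> R).

Lemma L2_trig_basis T j : L2fun T (phi j).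
Proof. by apply: L2_continuous; exact: continuous_trig_basis. Qed.

Lemma norm2E f : L2 f -> norm2 f = (ip f f)%:E.
Proof.
move=> Lf; rewrite /norm2 /ip /Rintegral fineK; last first.
  by apply: integrable_fin_num => //; exact: L2_mul_integrable.
by apply: eq_integral => x _; rewrite expr2.
Qed.

Lemma ip_ge0 f : 0 <= ip f f.
Proof. by apply: Rintegral_itv_ge0 => x; rewrite -expr2 sqr_ge0. Qed.

Lemma ip_sub_scalel f g h (c : R) : L2 f -> L2 g -> L2 h ->
  ip (fun x => f x - c * g x) h = ip f h - c * ip g h.
Proof.
move=> Lf Lg Lh; rewrite /ip.
have If := L2_mul_integrable Lf Lh; have Ig := L2_mul_integrable Lg Lh.
rewrite -RintegralZl// -RintegralB//; last exact: (integrableZl _ c Ig).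
by apply: eq_Rintegral => x _; ring.
Qed.

Lemma ip_sub_scale_sqr f g (c : R) : L2 f -> L2 g ->
  ip (fun x => f x - c * g x) (fun x => f x - c * g x) =
  ip f f - 2 * c * ip f g + c ^+ 2 * ip g g.
Proof.
move=> Lf Lg; have Lh := L2_sub_scale c Lf Lg.
rewrite (ip_sub_scalel c Lf Lg Lh) [ip f _]ipC (ip_sub_scalel c Lf Lg Lf).
rewrite [X in _ - c * X]ipC (ip_sub_scalel c Lf Lg Lg) [ip g f]ipC.
ring.
Qed.

Definition tpoly (s : seq nat) (c : nat -> R) (x : R) : R := \sum_(j <- s) c j * phi j x.

Lemma continuous_tpoly s c : continuous (tpoly s c).
Proof.
apply: continuous_sum_fun => j; apply: continuousZ_fun; exact: continuous_trig_basis.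
Qed.

Lemma tpoly_distance g s c : L2 g -> uniq s -> all (fun j => 0 < j)%N s ->
  [/\ L2 (fun x => g x - tpoly s c x),
    ip (fun x => g x - tpoly s c x) (fun x => g x - tpoly s c x) =
     ip g g - 2 * (\sum_(j <- s) c j * ip g (phi j)) + \sum_(j <- s) c j ^+ 2
  & forall i, (0 < i)%N -> i \notin s ->
     ip (fun x => g x - tpoly s c x) (phi i) = ip g (phi i)].
Proof.
elim: s g => [|j s IH] g Lg.
  move=> _ _; rewrite (_ : (fun x => _) = g).
    by rewrite !big_nil; split => //; ring.
  by apply/funext => x; rewrite /tpoly big_nil subr0.
move=> /= /andP[js us] /andP[j0 s0].
pose g' x := g x - c j * phi j x.
have Lp := L2_trig_basis 1.
have Lg' : L2 g' by exact: L2_sub_scale.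
have E : (fun x => g x - tpoly (j :: s) c x) = (fun x => g' x - tpoly s c x).
  by apply/funext => x; rewrite /tpoly big_cons opprD addrA.
have [L1 E1 F1] := IH g' Lg' us s0; rewrite E; split => //.
- rewrite E1 {1}/g' ip_sub_scale_sqr// trig_basis_orthonormal// eqxx mulr1.
  rewrite !big_cons.
  have -> : \sum_(i <- s) c i * ip g' (phi i) = \sum_(i <- s) c i * ip g (phi i).
    apply: eq_big_seq => i si; congr (_ * _).
    rewrite /g' ip_sub_scalel// trig_basis_orthonormal//; last exact: (allP s0).
    rewrite (_ : (j == i) = false) ?mulr0 ?subr0//.
    by apply: contraNF js => /eqP ->.
  ring.
- move=> i i0; rewrite inE negb_or => /andP[ij si].
  rewrite F1// /g' ip_sub_scalel// trig_basis_orthonormal//.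
  by rewrite eq_sym (negbTE ij) mulr0 subr0.
Qed.

(** The part of g orthogonal to the span does not depend on c. With the
    Fourier coefficients for c this gives Bessel's inequality, and with the filtered coefficients
    for c it is the decomposition of the loss of an estimator. *)
Lemma tpoly_pythagoras g s c : L2 g -> uniq s -> all (fun j => 0 < j)%N s ->
  ip (fun x => g x - tpoly s c x) (fun x => g x - tpoly s c x) =
  \sum_(j <- s) (c j - ip g (phi j)) ^+ 2 + (ip g g - \sum_(j <- s) ip g (phi j) ^+ 2).
Proof.
move=> Lg us s0; have [_ -> _] := tpoly_distance c Lg us s0.
have -> : \sum_(j <- s) (c j - ip g (phi j)) ^+ 2 = \sum_(j <- s) c j ^+ 2
    - 2 * (\sum_(j <- s) c j * ip g (phi j)) + \sum_(j <- s) ip g (phi j) ^+ 2.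
  by rewrite mulr_sumr -sumrB -big_split; apply: eq_bigr => j _ /=; ring.
ring.
Qed.

Lemma bessel g s : L2 g -> uniq s -> all (fun j => 0 < j)%N s ->
  \sum_(j <- s) ip g (phi j) ^+ 2 <= ip g g.
Proof.
move=> Lg us s0; have := tpoly_pythagoras (fun j => ip g (phi j)) Lg us s0.
rewrite big1 ?add0r => [E|j _]; last by rewrite subrr expr0n.
by rewrite -subr_ge0 -E; exact: ip_ge0.
Qed.

Lemma derive1n_periodic k f : (forall t, f (t + 1) = f t) ->
  forall t, derive1n k f (t + 1) = derive1n k f t.
Proof.
move=> pf; elim: k => [//|k IH] t; rewrite !derive1nS /derive1.
have E (h : R) : h + (t + 1) = (h + t) + 1 by rewrite addrA.
by under eq_fun do rewrite E !IH.
Qed.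

(** Integration by parts exchanges the cosine and the sine of the frequency m,
    so the energy of the pair is multiplied by the square of the frequency. *)
Lemma ip_derive_energy f f' m : (0 < m)%N -> (forall x : R, is_derive x 1 f (f' x)) ->
  continuous f' -> f 1 = f 0 ->
  ip f' (phi m.*2) ^+ 2 + ip f' (phi m.*2.+1) ^+ 2 =
  freq m ^+ 2 * (ip f (phi m.*2) ^+ 2 + ip f (phi m.*2.+1) ^+ 2).
Proof.
move=> m0 df cf' f10; have cf := is_derive_continuous df.
have Ec g : continuous g -> ip g (phi m.*2) =
    Num.sqrt 2 * \int[mu]_(x in `[0, 1]) (g x * cos (freq m * x)).
  move=> cg; rewrite -RintegralZl//; last first.
    by apply: continuous_integrable; apply: continuousM_fun => //; exact: continuous_cosw.
  by apply: eq_Rintegral => x _; rewrite trig_basis_cos//; ring.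
have Es g : continuous g -> ip g (phi m.*2.+1) =
    Num.sqrt 2 * \int[mu]_(x in `[0, 1]) (g x * sin (freq m * x)).
  move=> cg; rewrite -RintegralZl//; last first.
    by apply: continuous_integrable; apply: continuousM_fun => //; exact: continuous_sinw.
  by apply: eq_Rintegral => x _; rewrite trig_basis_sin//; ring.
have H1 : \int[mu]_(x in `[0, 1]) (f' x * cos (freq m * x)) =
    freq m * \int[mu]_(x in `[0, 1]) (f x * sin (freq m * x)).
  have cc : continuous (fun x : R => - freq m * sin (freq m * x)).
    by apply: continuousZ_fun; exact: continuous_sinw.
  have := Rintegral_by_parts ler01 df (is_derive_cosw (freq m)) cf' cc.
  rewrite mulr1 mulr0 cos_nat_period cos0 f10 subrr sub0r => /eqP.
  rewrite -eqr_oppLR => /eqP <-; rewrite -RintegralZl//; last first.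
    by apply: continuous_integrable; apply: continuousM_fun => //; exact: continuous_sinw.
  rewrite -mulN1r -RintegralZl//; last first.
    by apply: continuous_integrable; exact: continuousM_fun.
  by apply: eq_Rintegral => x _; ring.
have H2 : \int[mu]_(x in `[0, 1]) (f' x * sin (freq m * x)) =
    - (freq m * \int[mu]_(x in `[0, 1]) (f x * cos (freq m * x))).
  have cc : continuous (fun x : R => freq m * cos (freq m * x)).
    by apply: continuousZ_fun; exact: continuous_cosw.
  have := Rintegral_by_parts ler01 df (is_derive_sinw (freq m)) cf' cc.
  rewrite mulr1 mulr0 sin_nat_period sin0 !mulr0 subrr sub0r => /eqP.
  rewrite -eqr_oppLR => /eqP <-; rewrite -RintegralZl//; last first.
    by apply: continuous_integrable; apply: continuousM_fun => //; exact: continuous_cosw.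
  by congr (- _); apply: eq_Rintegral => x _; ring.
by rewrite !Ec// !Es// H1 H2; ring.
Qed.

Lemma Cper_derivn k f i : Cper k f -> (i < k)%N ->
  (forall x : R, is_derive x 1 (derive1n i f) (derive1n i.+1 f x)) /\ continuous (derive1n i.+1 f).
Proof.
move=> [pf df cf] ik; split.
  by move=> x; apply: DeriveDef; [exact: df|rewrite derive1nS derive1E].
move: ik; rewrite leq_eqVlt => /predU1P[->//|ik] x.
by apply/differentiable_continuous/derivable1_diffP; exact: df.
Qed.

Lemma Cper_continuous k f i : Cper k f -> (i <= k)%N -> continuous (derive1n i f).
Proof.
move=> Cf; rewrite leq_eqVlt => /predU1P[->|ik]; first by case: Cf.
exact: is_derive_continuous (Cper_derivn Cf ik).1.
Qed.

Lemma Cper_energy k f i m : Cper k f -> (i <= k)%N -> (0 < m)%N ->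
  ip (derive1n i f) (phi m.*2) ^+ 2 + ip (derive1n i f) (phi m.*2.+1) ^+ 2 =
  freq m ^+ (2 * i) * (ip f (phi m.*2) ^+ 2 + ip f (phi m.*2.+1) ^+ 2).
Proof.
move=> Cf; have pf : forall t, f (t + 1) = f t by case: Cf.
elim: i => [|i IH] ik m0; first by rewrite muln0 expr0 mul1r.
have [df cf] := Cper_derivn Cf ik.
rewrite (ip_derive_energy m0 df cf) ?IH//; last 2 first.
- exact: ltnW.
- by rewrite -[RHS](derive1n_periodic i pf) add0r.
by rewrite mulrA -exprD mulnS.
Qed.

Lemma sum_pairs (F : nat -> R) a b :
  \sum_(a.*2 <= j < b.*2) F j = \sum_(a <= m < b) (F m.*2 + F m.*2.+1).
Proof.
have [ba|/ltnW ab] := leqP b a.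
  by rewrite !big_geq// leq_double.
rewrite -(subnKC ab); elim: (b - a)%N => [|d IH]; first by rewrite addn0 !big_geq.
have h : (a.*2 <= (a + d).*2)%N by rewrite leq_double leq_addr.
rewrite addnS doubleS big_nat_recr/=; last exact: leqW.
by rewrite big_nat_recr//= IH big_nat_recr/= ?leq_addr// addrA.
Qed.

End fourier.

(** * Parseval's identity for periodic functions of class C^1 *)

Section completeness.
Context {R : realType}.
Local Notation mu := (@lebesgue_measure R).
Local Notation phi := (@trig_basis R).
Implicit Types (f g h : R -> R).

Definition int01 f : R := \int[mu]_(t in `[0, 1]) f t.

Lemma int01D f g : continuous f -> continuous g ->
  int01 (fun t => f t + g t) = int01 f + int01 g.
Proof. by move=> cf cg; rewrite /int01 RintegralD//; exact: continuous_integrable. Qed.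

Lemma int01Z (c : R) f : continuous f -> int01 (fun t => c * f t) = c * int01 f.
Proof. by move=> cf; rewrite /int01 RintegralZl//; exact: continuous_integrable. Qed.

Lemma le_int01 f g : continuous f -> continuous g ->
  (forall t, 0 <= t <= 1 -> f t <= g t) -> int01 f <= int01 g.
Proof.
move=> cf cg fg; apply: le_Rintegral; first by [].
- exact: continuous_integrable.
- exact: continuous_integrable.
- by move=> t /=; rewrite in_itv/=; exact: fg.
Qed.

Lemma le_norm_int01 f g : continuous f -> continuous g ->
  (forall t, 0 <= t <= 1 -> `|f t| <= g t) -> `|int01 f| <= int01 g.
Proof.
move=> cf cg fg; rewrite ler_norml; apply/andP; split.
- rewrite -mulN1r -int01Z//; apply: le_int01 => //; first exact: continuousZ_fun.
  by move=> t t01; have := fg t t01; rewrite ler_norml => /andP[]; rewrite mulN1r.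
- by apply: le_int01 => // t t01; have := fg t t01; rewrite ler_norml => /andP[].
Qed.

(** Requiring a representation for all large N, rather than for one N, makes
    the class closed under sums without padding coefficients. *)
Definition trig_span g :=
  exists N0, forall N, (N0 <= N)%N -> exists c, g = tpoly (index_iota 1 N) c.

Lemma trig_spanD f g : trig_span f -> trig_span g -> trig_span (fun x => f x + g x).
Proof.
move=> [N1 h1] [N2 h2]; exists (maxn N1 N2) => N; rewrite geq_max => /andP[/h1[c ->] /h2[d ->]].
exists (fun j => c j + d j); apply/funext => x; rewrite /tpoly -big_split.
by apply: eq_bigr => j _ /=; rewrite mulrDl.
Qed.

Lemma trig_spanZ (a : R) f : trig_span f -> trig_span (fun x => a * f x).
Proof.
move=> [N1 h1]; exists N1 => N /h1[c ->].
exists (fun j => a * c j); apply/funext => x; rewrite /tpoly mulr_sumr.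
by apply: eq_bigr => j _ /=; rewrite mulrA.
Qed.

Lemma trig_span_basis j : (0 < j)%N -> trig_span (phi j).
Proof.
move=> j0; exists j.+1 => N jN; exists (fun i => (i == j)%:R); apply/funext => x.
rewrite /tpoly (bigD1_seq j)/= ?iota_uniq ?mem_index_iota ?j0//.
rewrite eqxx mul1r big1 ?addr0// => i /negbTE ->; exact: mul0r.
Qed.

Lemma trig_span_cos m : trig_span (fun x => cos (freq m * x)).
Proof.
case: m => [|m].
  rewrite (_ : (fun x => _) = phi 1%N); first exact: trig_span_basis.
  by apply/funext => x; rewrite /freq mulr0 mul0r cos0.
rewrite (_ : (fun x => _) = (fun x => (Num.sqrt 2)^-1 * phi m.+1.*2 x)).
  by apply: trig_spanZ; exact: trig_span_basis.
apply/funext => x; rewrite trig_basis_cos// mulKf// gt_eqF//.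
Qed.

Lemma trig_span_sin m : trig_span (fun x => sin (freq m * x)).
Proof.
case: m => [|m].
  rewrite (_ : (fun x => _) = fun x => 0 * phi 1%N x).
    by apply: trig_spanZ; exact: trig_span_basis.
  by apply/funext => x; rewrite /freq mulr0 !mul0r sin0.
rewrite (_ : (fun x => _) = (fun x => (Num.sqrt 2)^-1 * phi m.+1.*2.+1 x)).
  by apply: trig_spanZ; exact: trig_span_basis.
apply/funext => x; rewrite trig_basis_sin// mulKf// gt_eqF//.
Qed.

Lemma trig_span_sum (s : seq nat) (c : nat -> R) (F : nat -> R -> R) :
  (forall j, j \in s -> trig_span (F j)) ->
  trig_span (fun x => \sum_(j <- s) c j * F j x).
Proof.
elim: s => [|j s IH] hF.
  rewrite (_ : (fun x => _) = fun x => 0 * phi 1%N x).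
    by apply: trig_spanZ; exact: trig_span_basis.
  by apply/funext => x; rewrite big_nil mul0r.
under eq_fun do rewrite big_cons.
apply: trig_spanD; first by apply: trig_spanZ; apply: hF; rewrite inE eqxx.
by apply: IH => i si; apply: hF; rewrite inE si orbT.
Qed.

Lemma freqS m x : freq m.+1 * x = freq m * x + freq 1 * x :> R.
Proof. by rewrite /freq -[in LHS]addn1 natrD; ring. Qed.

(** By linearity it is enough to multiply the basis functions. *)
Lemma trig_spanM (g : R -> R) :
  (forall m, trig_span (fun x => cos (freq m * x) * g x)) ->
  (forall m, trig_span (fun x => sin (freq m * x) * g x)) ->
  forall f, trig_span f -> trig_span (fun x => f x * g x).
Proof.
move=> hc hs f [N /(_ _ (leqnn N))[c ->]].
rewrite (_ : (fun x => _) = fun x => \sum_(j <- index_iota 1 N) c j * (phi j x * g x)).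
  apply: trig_span_sum => j; rewrite mem_index_iota => /andP[j0 _].
  have [->|[m m0 ->]|[m m0 ->]] := trig_basisP j0.
  - rewrite (_ : (fun x => _) = fun x => cos (freq 0 * x) * g x); first exact: hc.
    by apply/funext => x; rewrite /freq mulr0 mul0r cos0.
  - rewrite (_ : (fun x => _) = fun x => Num.sqrt 2 * (cos (freq m * x) * g x)).
      exact: trig_spanZ.
    by apply/funext => x; rewrite trig_basis_cos// mulrA.
  - rewrite (_ : (fun x => _) = fun x => Num.sqrt 2 * (sin (freq m * x) * g x)).
      exact: trig_spanZ.
    by apply/funext => x; rewrite trig_basis_sin// mulrA.
apply/funext => x; rewrite /tpoly mulr_suml; apply: eq_bigr => j _; exact: esym (mulrA _ _ _).
Qed.

Lemma trig_spanM_cos f : trig_span f -> trig_span (fun x => f x * cos (freq 1 * x)).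
Proof.
apply: trig_spanM => -[|m].
- rewrite (_ : (fun x => _) = fun x => cos (freq 1 * x)); first exact: trig_span_cos.
  by apply/funext => x; rewrite /freq mulr0 mul0r cos0 mul1r.
- rewrite (_ : (fun x => _) = fun x => 2^-1 * cos (freq m.+2 * x) + 2^-1 * cos (freq m * x)).
    by apply: trig_spanD; apply: trig_spanZ; exact: trig_span_cos.
  apply/funext => x; have -> : freq m * x = freq m.+1 * x - freq 1 * x by rewrite freqS addrK.
  by rewrite (freqS m.+1) cosD cosB; field.
- rewrite (_ : (fun x => _) = fun x => sin (freq 0 * x)); first exact: trig_span_sin.
  by apply/funext => x; rewrite /freq mulr0 mul0r sin0 mul0r.
- rewrite (_ : (fun x => _) = fun x => 2^-1 * sin (freq m.+2 * x) + 2^-1 * sin (freq m * x)).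
    by apply: trig_spanD; apply: trig_spanZ; exact: trig_span_sin.
  apply/funext => x; have -> : freq m * x = freq m.+1 * x - freq 1 * x by rewrite freqS addrK.
  by rewrite (freqS m.+1) sinD sinB; field.
Qed.

Lemma trig_spanM_sin f : trig_span f -> trig_span (fun x => f x * sin (freq 1 * x)).
Proof.
apply: trig_spanM => -[|m].
- rewrite (_ : (fun x => _) = fun x => sin (freq 1 * x)); first exact: trig_span_sin.
  by apply/funext => x; rewrite /freq mulr0 mul0r cos0 mul1r.
- rewrite (_ : (fun x => _) = fun x => 2^-1 * sin (freq m.+2 * x) + (- 2^-1) * sin (freq m * x)).
    by apply: trig_spanD; apply: trig_spanZ; exact: trig_span_sin.
  apply/funext => x; have -> : freq m * x = freq m.+1 * x - freq 1 * x by rewrite freqS addrK.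
  by rewrite (freqS m.+1) sinD sinB; field.
- rewrite (_ : (fun x => _) = fun x => sin (freq 0 * x)); first exact: trig_span_sin.
  by apply/funext => x; rewrite /freq mulr0 mul0r sin0 mul0r.
- rewrite (_ : (fun x => _) = fun x => (- 2^-1) * cos (freq m.+2 * x) + 2^-1 * cos (freq m * x)).
    by apply: trig_spanD; apply: trig_spanZ; exact: trig_span_cos.
  apply/funext => x; have -> : freq m * x = freq m.+1 * x - freq 1 * x by rewrite freqS addrK.
  by rewrite (freqS m.+1) cosD cosB; field.
Qed.

Lemma is_derive_shift (x t : R) : is_derive t 1 (fun t => pi * (x - t)) (- pi).
Proof. by apply: is_derive_eq; rewrite /GRing.scale/=; ring. Qed.

Lemma is_derive_cos_shift (x t : R) :
  is_derive t 1 (fun t => cos (pi * (x - t))) (pi * sin (pi * (x - t))).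
Proof.
rewrite (_ : pi * _ = - sin (pi * (x - t)) * - pi); last by ring.
exact: (@is_derive1_comp _ cos (fun t => pi * (x - t)) t _ _ (is_derive_cos _) (is_derive_shift x t)).
Qed.

Lemma is_derive_sin_shift (x t : R) :
  is_derive t 1 (fun t => sin (pi * (x - t))) (- pi * cos (pi * (x - t))).
Proof.
rewrite mulrC.
exact: (@is_derive1_comp _ sin (fun t => pi * (x - t)) t _ _ (is_derive_sin _) (is_derive_shift x t)).
Qed.

Lemma is_derive_power (f : R -> R) (t df : R) n : is_derive t 1 f df ->
  is_derive t 1 (fun t => f t ^+ n) (n%:R * f t ^+ n.-1 * df).
Proof.
move=> hf; elim: n => [|n IH].
  rewrite !mul0r; under eq_fun do rewrite expr0; exact: is_derive_cst.
under eq_fun do rewrite exprS.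
apply: is_derive_eq; rewrite /GRing.scale/=.
by case: n {IH} => [|n]/=; rewrite ?expr0 ?exprS ?mulrSr; ring.
Qed.

Lemma continuous_power f n : continuous f -> continuous (fun x => f x ^+ n).
Proof.
move=> cf; elim: n => [|n IH].
  by under eq_fun do rewrite expr0; exact: continuous_cst_fun.
by under eq_fun do rewrite exprS; exact: continuousM_fun.
Qed.

Lemma continuous_cos_shift (x : R) : continuous (fun t => cos (pi * (x - t))).
Proof. exact: is_derive_continuous (is_derive_cos_shift x). Qed.

Lemma continuous_sin_shift (x : R) : continuous (fun t => sin (pi * (x - t))).
Proof. exact: is_derive_continuous (is_derive_sin_shift x). Qed.

(** The even powers of cos (pi (x - t)) are nonnegative, trigonometric
    polynomials in x, and concentrate around t = x modulo 1. They serve as an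
    approximate identity whose moments are computable by parts. *)
Definition kernel p (x t : R) := cos (pi * (x - t)) ^+ (2 * p).

Lemma continuous_kernel p (x : R) : continuous (kernel p x).
Proof. by apply: continuous_power; exact: continuous_cos_shift. Qed.

Lemma kernel_ge0 p x t : 0 <= kernel p x t.
Proof. by rewrite /kernel exprM exprn_ge0// sqr_ge0. Qed.

Lemma kernelS p x t : kernel p.+1 x t = cos (pi * (x - t)) ^+ 2 * kernel p x t.
Proof. by rewrite /kernel mulnS exprD. Qed.

(** Each factor cos^2 (pi (x - t)) is (1 + cos (2 pi x) cos (2 pi t) +
    sin (2 pi x) sin (2 pi t)) / 2, whose functions of t are absorbed in f. *)
Lemma kernel_convolution_span p f : continuous f ->
  trig_span (fun x => int01 (fun t => f t * kernel p x t)).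
Proof.
elim: p f => [|p IH] f cf.
  rewrite (_ : (fun x => _) = fun x => int01 f * phi 1%N x).
    by apply: trig_spanZ; exact: trig_span_basis.
  apply/funext => x; rewrite /trig_basis/= mulr1; congr int01; apply/funext => t.
  by rewrite /kernel muln0 expr0 mulr1.
have c1 : continuous (fun t : R => cos (freq 1 * t)) by exact: continuous_cosw.
have s1 : continuous (fun t : R => sin (freq 1 * t)) by exact: continuous_sinw.
have cfc := continuousM_fun cf c1; have cfs := continuousM_fun cf s1.
rewrite (_ : (fun x => _) = fun x => 2^-1 * int01 (fun t => f t * kernel p x t)
  + (2^-1 * int01 (fun t => f t * cos (freq 1 * t) * kernel p x t) * cos (freq 1 * x)
  + 2^-1 * int01 (fun t => f t * sin (freq 1 * t) * kernel p x t) * sin (freq 1 * x))).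
  apply: trig_spanD; first by apply: trig_spanZ; exact: IH.
  by apply: trig_spanD; [apply: trig_spanM_cos|apply: trig_spanM_sin];
    apply: trig_spanZ; exact: IH.
apply/funext => x; have ck : continuous (kernel p x) by exact: continuous_kernel.
rewrite [_ * cos _]mulrAC [_ * sin _]mulrAC -!int01Z; try exact: continuousM_fun.
rewrite -int01D; try (apply: continuousZ_fun; exact: continuousM_fun).
rewrite -int01D; first last.
- by apply: continuousD_fun; apply: continuousZ_fun; exact: continuousM_fun.
- by apply: continuousZ_fun; exact: continuousM_fun.
congr int01; apply/funext => t; rewrite kernelS.
have -> : cos (pi * (x - t)) ^+ 2 =
    2^-1 * (1 + (cos (freq 1 * x) * cos (freq 1 * t) + sin (freq 1 * x) * sin (freq 1 * t))).
  rewrite -cosB (_ : freq 1 * x - freq 1 * t = (pi * (x - t)) *+ 2); last first.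
    by rewrite /freq mulr2n; ring.
  by rewrite cos_mulr2n; field.
ring.
Qed.

(** The Wallis ratios. *)
Fixpoint kernel_mass p : R := if p is q.+1 then kernel_mass q * ((2 * q)%:R + 1) / ((2 * q)%:R + 2) else 1.

Lemma kernel_mass_gt0 p : 0 < kernel_mass p.
Proof.
elim: p => //= p IH; rewrite divr_gt0 ?mulr_gt0//; exact: ltr_wpDl.
Qed.

(** The integral over a period of the derivative of sin cos^(2p+1) is 0. *)
Lemma kernel_moments p x : ((2 * p)%:R + 1) *
  int01 (fun t => sin (pi * (x - t)) ^+ 2 * kernel p x t) = int01 (kernel p.+1 x).
Proof.
pose G t := sin (pi * (x - t)) * cos (pi * (x - t)) ^+ (2 * p).+1.
have ck q : continuous (kernel q x) by exact: continuous_kernel.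
have csk : continuous (fun t => sin (pi * (x - t)) ^+ 2 * kernel p x t).
  by apply: continuousM_fun => //; apply: continuous_power; exact: continuous_sin_shift.
pose g t := pi * (((2 * p)%:R + 1) * (sin (pi * (x - t)) ^+ 2 * kernel p x t) + (-1) * kernel p.+1 x t).
have dG (t : R) : is_derive t 1 G (g t).
  have h1 := is_derive_sin_shift x t.
  have h2 := is_derive_power (2 * p).+1 (is_derive_cos_shift x t).
  apply: is_derive_eq; rewrite /GRing.scale/= /g kernelS /kernel -/(2 * p)%N.
  by rewrite [cos _ ^+ (2 * p).+1]exprS -natr1; ring.
have cg : continuous g.
  by apply: continuousZ_fun; apply: continuousD_fun; exact: continuousZ_fun.
have := Rintegral_FTC ler01 dG cg.
have -> : G 1 - G 0 = 0.
  rewrite /G subr0 mulrBr mulr1 sinB cosB cospi sinpi !mulr0 !mulrN1 !addr0 subr0.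
  by rewrite exprNn -signr_odd /= oddM /= expr1 mulN1r mulrNN subrr.
rewrite -/(int01 g) int01Z; last by apply: continuousD_fun; exact: continuousZ_fun.
move=> /eqP; rewrite mulf_eq0 gt_eqF ?pi_gt0//= int01D; try exact: continuousZ_fun.
by rewrite !int01Z// mulN1r subr_eq0 => /eqP.
Qed.

Lemma int01_kernel p x : int01 (kernel p x) = kernel_mass p.
Proof.
elim: p x => [|p IH] x /=.
  rewrite /kernel muln0 /int01; under eq_Rintegral do rewrite expr0.
  by rewrite Rintegral_itv_cst// subr0 mulr1.
have ck q : continuous (kernel q x) by exact: continuous_kernel.
have csk : continuous (fun t => sin (pi * (x - t)) ^+ 2 * kernel p x t).
  by apply: continuousM_fun => //; apply: continuous_power; exact: continuous_sin_shift.
have E : kernel_mass p = int01 (kernel p.+1 x) + int01 (fun t => sin (pi * (x - t)) ^+ 2 * kernel p x t).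
  rewrite -(IH x) -int01D//; congr int01; apply/funext => t.
  by rewrite kernelS -mulrDl cos2Dsin2 mul1r.
have := kernel_moments p x; rewrite E => <-; set V := int01 _.
have : (0 : R) <= (2 * p)%:R by []. move: (_%:R) => a a0.
have : a + 2 != 0 by rewrite gt_eqF// ltr_wpDl.
by move=> h; field.
Qed.

(** Concentration of the kernel: relatively to its mass, the mean of
    sin^2 (pi (x - t)) is O(1/p). *)
Lemma kernel_second_moment p x :
  int01 (fun t => sin (pi * (x - t)) ^+ 2 * kernel p x t) <= kernel_mass p / p.+1%:R.
Proof.
have V0 : 0 <= int01 (fun t => sin (pi * (x - t)) ^+ 2 * kernel p x t).
  by apply: Rintegral_itv_ge0 => t; rewrite mulr_ge0 ?sqr_ge0 ?kernel_ge0.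
rewrite ler_pdivlMr//; apply: (@le_trans _ _ (kernel_mass p.+1)).
  rewrite -(int01_kernel p.+1 x) -kernel_moments mulrC ler_wpM2r//.
  by rewrite natr1 ler_nat ltnS leq_pmull.
rewrite /= -mulrA ler_piMr ?(ltW (kernel_mass_gt0 p))//.
by rewrite ler_pdivrMr ?ltr_wpDl// mul1r lerD2l ler1n.
Qed.

Lemma le_sin_pi (v : R) : 0 <= v <= 2^-1 -> v <= sin (pi * v).
Proof.
move=> /andP[v0 v1]; have p0 := @pi_gt0 R; have p2 := @pi_ge2 R.
set y := pi * v; have y0 : 0 <= y by rewrite mulr_ge0// ltW.
have y1 : y <= pi / 2 by rewrite /y ler_pM2l.
have y2 : 0 <= y / 2 by rewrite divr_ge0.
have [z] := @MVT_segment R sin cos 0 (y / 2) y2 (fun x _ => is_derive_sin x)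
  (continuous_subspaceT (@continuous_sin R)).
rewrite in_itv/= sin0 !subr0 => /andP[z0 z1] Ez.
have c0 : 0 <= cos y by apply: cos_ge0_pihalf; rewrite y1 andbT; lra.
have c1 : 0 <= cos (y / 2) by apply: cos_ge0_pihalf; lra.
have cz : cos (y / 2) <= cos z.
  by rewrite leNgt ltr_cos ?in_itv/= -?leNgt//; lra.
have E : y = (y / 2) *+ 2 by rewrite mulr2n; field.
have Es : sin y = (cos (y / 2) * sin (y / 2)) *+ 2 by rewrite [in LHS]E sin_mulr2n.
have Ec : cos y = cos (y / 2) ^+ 2 *+ 2 - 1 by rewrite [in LHS]E cos_mulr2n.
have h1 : y * cos (y / 2) ^+ 2 <= sin y.
  have -> : sin y = y * (cos (y / 2) * cos z) by rewrite Es Ez mulr2n; field.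
  by rewrite ler_wpM2l// expr2 ler_wpM2l.
apply: le_trans h1; have h2 : 2^-1 <= cos (y / 2) ^+ 2 by move: Ec c0; rewrite mulr2n; lra.
apply: (@le_trans _ _ (y * 2^-1)); last by rewrite ler_wpM2l.
by rewrite /y; nra.
Qed.

(** |sin (pi (x - t))| is equivalent to the distance of x and t on the circle,
    so this is the mean value inequality for a periodic function; when x - t
    exceeds 1/2, t is replaced by t + 1. *)
Lemma periodic_sine_lipschitz f f' : (forall x : R, is_derive x 1 f (f' x)) ->
  continuous f' -> (forall t, f (t + 1) = f t) ->
  exists2 C, 0 < C & forall x t, 0 <= x <= 1 -> 0 <= t <= 1 ->
    `|f x - f t| <= C * `|sin (pi * (x - t))|.
Proof.
move=> df cf' pf; have cf := is_derive_continuous df.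
(* two periods, since t + 1 may replace t *)
have [c _ hc] := @EVT_max R (fun x => `|f' x|) 0 2 (ler0n R 2)
  (continuous_subspaceT (fun x => cvg_norm (cf' x))).
exists (`|f' c| + 1); first by rewrite ltr_wpDl.
have lip a b : 0 <= a -> a <= b -> b <= 2 -> b - a <= 2^-1 ->
    `|f b - f a| <= (`|f' c| + 1) * `|sin (pi * (b - a))|.
  move=> a0 ab b2 ba.
  have [z] := @MVT_segment R f f' a b ab (fun x _ => df x) (continuous_subspaceT cf).
  rewrite in_itv/= => /andP[z0 z1] ->; rewrite normrM ler_pM//.
    rewrite (le_trans (hc z _)) ?in_itv/= ?lerDl//.
    by rewrite (le_trans a0 z0) (le_trans z1 b2).
  have h0 : 0 <= b - a <= 2^-1 by rewrite subr_ge0 ab.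
  rewrite ger0_norm ?subr_ge0// (le_trans (le_sin_pi h0))//; exact: ler_norm.
have main x t : 0 <= t -> t <= x -> x <= 1 -> `|f x - f t| <= (`|f' c| + 1) * `|sin (pi * (x - t))|.
  move=> t0 tx x1; have [h|h] := leP (x - t) 2^-1; first by apply: lip => //; lra.
  have := lip x (t + 1) ltac:(lra) ltac:(lra) ltac:(lra) ltac:(lra).
  rewrite pf distrC.
  have -> : pi * (t + 1 - x) = - (pi * (x - t)) + pi by ring.
  by rewrite sinDpi sinN opprK.
move=> x t /andP[x0 x1] /andP[t0 t1]; case: (leP t x) => h; first exact: main.
rewrite distrC; have := main t x x0 (ltW h) t1.
by rewrite -(opprB x t) mulrN sinN normrN.
Qed.

(** The Lipschitz bound in terms of the sine is matched to the second moment of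
    the kernel through C s <= e + C^2 s^2 / (4 e). *)
Lemma kernel_approximation f f' p C e : (forall x : R, is_derive x 1 f (f' x)) ->
  0 < C -> 0 < e ->
  (forall x t, 0 <= x <= 1 -> 0 <= t <= 1 -> `|f x - f t| <= C * `|sin (pi * (x - t))|) ->
  C ^+ 2 / (4 * e ^+ 2) <= p.+1%:R ->
  forall x, 0 <= x <= 1 ->
    `|f x - (kernel_mass p)^-1 * int01 (fun t => f t * kernel p x t)| <= 2 * e.
Proof.
move=> df C0 e0 hC hp x x01; have cf := is_derive_continuous df.
have m0 := kernel_mass_gt0 p.
have ck : continuous (kernel p x) by exact: continuous_kernel.
have cs : continuous (fun t => sin (pi * (x - t)) ^+ 2 * kernel p x t).
  by apply: continuousM_fun => //; apply: continuous_power; exact: continuous_sin_shift.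
have cd : continuous (fun t => f x + (-1) * f t).
  by apply: continuousD_fun; [exact: continuous_cst_fun|exact: continuousZ_fun].
have -> : f x - (kernel_mass p)^-1 * int01 (fun t => f t * kernel p x t) =
    (kernel_mass p)^-1 * int01 (fun t => (f x + (-1) * f t) * kernel p x t).
  rewrite (_ : (fun t => (f x + (-1) * f t) * kernel p x t) =
      fun t => f x * kernel p x t + (-1) * (f t * kernel p x t)); last first.
    by apply/funext => t; ring.
  have cfk := continuousM_fun cf ck.
  rewrite int01D; [|exact: continuousZ_fun|exact: continuousZ_fun].
  by rewrite !int01Z// int01_kernel; field; rewrite gt_eqF.
rewrite normrM gtr0_norm ?invr_gt0// mulrC ler_pdivrMr//.
apply: (@le_trans _ _ (int01 (fun t => e * kernel p x t +
    (C ^+ 2 / (4 * e)) * (sin (pi * (x - t)) ^+ 2 * kernel p x t)))).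
  apply: le_norm_int01.
  - exact: continuousM_fun.
  - by apply: continuousD_fun; exact: continuousZ_fun.
  move=> t t01; have K0 := kernel_ge0 p x t.
  rewrite normrM (ger0_norm K0) mulrA -mulrDl ler_wpM2r//.
  rewrite mulN1r; apply: le_trans (hC x t x01 t01) _.
  rewrite -(real_normK (num_real (sin _))); move: `|sin _| => s.
  rewrite -subr_ge0 (_ : _ - _ = (2 * e - C * s) ^+ 2 / (4 * e)).
    by rewrite divr_ge0 ?sqr_ge0// mulr_ge0// ltW.
  by field; rewrite gt_eqF.
rewrite int01D; [|exact: continuousZ_fun|exact: continuousZ_fun].
rewrite !int01Z// int01_kernel.
have h2 : C ^+ 2 / (4 * e) * (kernel_mass p / p.+1%:R) <= e * kernel_mass p.
  rewrite mulrA [C ^+ 2 / _ * _]mulrC -mulrA [leRHS]mulrC ler_pM2l// ler_pdivrMr//.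
  have -> : C ^+ 2 / (4 * e) = e * (C ^+ 2 / (4 * e ^+ 2)) by field; rewrite gt_eqF.
  by rewrite ler_pM2l.
apply: (@le_trans _ _ (e * kernel_mass p + e * kernel_mass p)); last by lra.
rewrite lerD2l; apply: le_trans h2; rewrite ler_wpM2l//; last exact: kernel_second_moment.
by rewrite divr_ge0 ?sqr_ge0// mulr_ge0// ltW.
Qed.

(** The partial Fourier sum is the best approximation in the span, so it is at
    least as good as the convolution with the kernel, which is uniformly
    close to f. *)
Lemma parseval_tail f f' e : (forall x : R, is_derive x 1 f (f' x)) ->
  continuous f' -> (forall t, f (t + 1) = f t) -> 0 < e ->
  exists N0, forall N, (N0 <= N)%N ->
    ip f f - \sum_(1 <= j < N) ip f (phi j) ^+ 2 <= e.
Proof.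
move=> df cf' pf e0; have cf := is_derive_continuous df.
have [C C0 hC] := periodic_sine_lipschitz df cf' pf.
pose d := Num.sqrt e / 2; have d0 : 0 < d by rewrite divr_gt0// sqrtr_gt0.
pose p := Num.truncn (C ^+ 2 / (4 * d ^+ 2)).
have hp : C ^+ 2 / (4 * d ^+ 2) <= p.+1%:R.
  by apply: ltW; exact: truncnS_gt.
have app := kernel_approximation df C0 d0 hC hp.
have [N0 hN] := trig_spanZ (kernel_mass p)^-1 (kernel_convolution_span p cf).
exists N0 => N /hN[c Ec].
have us : uniq (index_iota 1 N) by exact: iota_uniq.
have s0 : all (fun j => 0 < j)%N (index_iota 1 N).
  by apply/allP => j; rewrite mem_index_iota => /andP[].
have := tpoly_pythagoras c (L2_continuous 1 cf) us s0.
set A := ip _ _ => EA.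
have : ip f f - \sum_(1 <= j < N) ip f (phi j) ^+ 2 <= A.
  by rewrite EA lerDr; apply: sumr_ge0 => j _; exact: sqr_ge0.
move=> /le_trans; apply; rewrite /A -/(int01 _).
have -> : e = int01 (fun=> e) by rewrite /int01 Rintegral_itv_cst// subr0 mulr1.
have ch : continuous (fun x => f x - tpoly (index_iota 1 N) c x).
  by apply: continuousD_fun => //; apply: continuousN_fun; exact: continuous_tpoly.
apply: le_int01; [exact: continuousM_fun|exact: continuous_cst_fun|].
move=> x x01; have := app x x01.
rewrite -[(kernel_mass p)^-1 * _]/((fun x => (kernel_mass p)^-1 * int01 (fun t => f t * kernel p x t)) x) Ec.
move=> h; rewrite -expr2 -(real_normK (num_real _)) -[leRHS](sqr_sqrtr (ltW e0)).
rewrite ler_pXn2r// ?nnegrE// ?sqrtr_ge0//.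
by move: h; rewrite /d mulrC divfK.
Qed.

End completeness.

(** * The Sobolev ball in Fourier coefficients *)

Section sobolev_ball.
Context {R : realType}.
Local Notation mu := (@lebesgue_measure R).
Local Notation phi := (@trig_basis R).
Implicit Types (f g S : R -> R) (k : nat) (r : R).

Lemma sobolev_continuous k r S : sobolev k r S -> continuous S.
Proof. by move=> [CS _]; exact: (Cper_continuous CS (leq0n k)). Qed.

Lemma sobolev_energy k r S : sobolev k r S ->
  \sum_(i < k.+1) ip (derive1n i S) (derive1n i S) <= r.
Proof.
move=> [CS]; have E (i : 'I_k.+1) : norm2 (derive1n i S) = (ip (derive1n i S) (derive1n i S))%:E.
  by apply: norm2E; apply: L2_continuous; apply: (Cper_continuous CS); rewrite -ltnS.
under eq_bigr do rewrite E.
by rewrite sumEFin lee_fin.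
Qed.

Lemma sobolev_top_energy k r S : sobolev k r S -> ip (derive1n k S) (derive1n k S) <= r.
Proof.
move=> /sobolev_energy; apply: le_trans; rewrite big_ord_recr/= lerDr.
by apply: sumr_ge0 => i _; exact: ip_ge0.
Qed.

Lemma sobolev_L2_energy k r S : sobolev k r S -> ip S S <= r.
Proof.
move=> /sobolev_energy; apply: le_trans; rewrite big_ord_recl/= lerDl.
by apply: sumr_ge0 => i _; exact: ip_ge0.
Qed.

Lemma index_iota_gt0 a N : (0 < a)%N -> all (fun j => 0 < j)%N (index_iota a N).
Proof. by move=> a0; apply/allP => j; rewrite mem_index_iota => /andP[/(leq_trans a0)]. Qed.

Lemma sobolev_fourier_energy k r S N : (0 < k)%N -> sobolev k r S ->
  \sum_(1 <= j < N.*2) freq j./2 ^+ (2 * k) * ip S (phi j) ^+ 2 <= r.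
Proof.
move=> k0 bS; have [CS _] := bS; apply: le_trans (sobolev_top_energy bS).
have cD := Cper_continuous CS (leqnn k).
case: N => [|N]; first by rewrite big_geq// ip_ge0.
rewrite big_ltn; last by rewrite doubleS.
have -> : freq 1./2 = 0 :> R by rewrite /freq mulr0.
rewrite expr0n muln_eq0/= gtn_eqF// mul0r add0r.
rewrite -[X in \sum_(X <= _ < _) _]/(1.*2) sum_pairs.
have := bessel (L2_continuous 1 cD) (iota_uniq (1.*2) _) (index_iota_gt0 N.+1.*2 (ltn0Sn 1)).
rewrite -/(index_iota _ _) sum_pairs; apply: le_trans.
rewrite le_eqVlt; apply/orP; left; apply/eqP.
rewrite !big_nat; apply: eq_bigr => m /andP[m0 _].
by rewrite (Cper_energy CS (leqnn k) m0) doubleK /= uphalf_double mulrDr.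
Qed.

(** The squared bias of the filter. Below the cutoff each term is
    (2 pi M)^(-2k) times a term of the energy of the k-th derivative; above it,
    Parseval's identity turns the remainder into a sum over the frequencies
    m >= M, whose terms are dominated in the same way. *)
Lemma sobolev_tail k r S M : (0 < k)%N -> (0 < M)%N -> sobolev k r S ->
  \sum_(1 <= j < M.*2) (freq j./2 / freq M) ^+ (2 * k) * ip S (phi j) ^+ 2 +
    (ip S S - \sum_(1 <= j < M.*2) ip S (phi j) ^+ 2) <= r / freq M ^+ (2 * k).
Proof.
move=> k0 M0 bS; have [CS _] := bS.
have w0 : 0 < freq M ^+ (2 * k) :> R by rewrite exprn_gt0// freq_gt0.
apply/ler_addgt0Pr => e e0.
have [dS cS] := Cper_derivn CS k0; have pS : forall t, S (t + 1) = S t by case: CS.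
have [N0 hN0] := parseval_tail dS cS pS e0.
pose N := maxn N0 M.
have := hN0 N.*2 _; have N0N : (N0 <= N.*2)%N.
  by apply: (leq_trans (leq_maxl N0 M)); rewrite -addnn leq_addr.
move=> /(_ N0N); have M2 : (1 <= M.*2)%N by rewrite double_gt0.
have MN : (M.*2 <= N.*2)%N by rewrite leq_double leq_maxr.
rewrite (@big_cat_nat _ _ _ M.*2)//= => h1.
have := sobolev_fourier_energy N k0 bS.
rewrite (@big_cat_nat _ _ _ M.*2)//= => h2.
have h3 : freq M ^+ (2 * k) * \sum_(M.*2 <= j < N.*2) ip S (phi j) ^+ 2 <=
   \sum_(M.*2 <= j < N.*2) freq j./2 ^+ (2 * k) * ip S (phi j) ^+ 2.
  rewrite mulr_sumr !big_nat; apply: ler_sum => j /andP[Mj _].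
  rewrite ler_wpM2r ?sqr_ge0// ler_pXn2r ?nnegrE ?freq_ge0 ?muln_gt0//.
  rewrite /freq ler_wpM2l ?mulr_ge0 ?pi_ge0// ler_nat.
  by rewrite -[M]doubleK half_leq.
have E : \sum_(1 <= j < M.*2) (freq j./2 / freq M) ^+ (2 * k) * ip S (phi j) ^+ 2 =
  (\sum_(1 <= j < M.*2) freq j./2 ^+ (2 * k) * ip S (phi j) ^+ 2) / freq M ^+ (2 * k).
  by rewrite mulr_suml; apply: eq_bigr => j _; rewrite expr_div_n mulrAC.
rewrite E; set P := \sum_(1 <= j < M.*2) _ in h2 *.
set Q := \sum_(M.*2 <= j < N.*2) ip S (phi j) ^+ 2 in h1 h3.
set A := \sum_(1 <= j < M.*2) ip S (phi j) ^+ 2 in h1 *.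
have h4 : P / freq M ^+ (2 * k) + Q <= r / freq M ^+ (2 * k).
  by rewrite ler_pdivlMr// mulrDl divfK ?gt_eqF// [Q * _]mulrC; lra.
by lra.
Qed.

(** The coefficients of the derivative of a trigonometric polynomial:
    differentiation rotates the pair (2m, 2m+1), hence the neighbouring
    indices j.+1 for the even j and j.-1 for the odd j. *)
Definition dcoef (c : nat -> R) (j : nat) : R :=
  if odd j then - freq j./2 * c j.-1 else freq j./2 * c j.+1.

Lemma is_derive_basis_cos m (x : R) : (0 < m)%N -> is_derive x 1 (phi m.*2) (- freq m * phi m.*2.+1 x).
Proof.
move=> m0; rewrite (_ : phi m.*2 = fun x => Num.sqrt 2 * cos (freq m * x)); last first.
  by apply/funext => y; rewrite trig_basis_cos.
have := is_derive_cosw (freq m) x => h.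
by apply: is_derive_eq; rewrite /GRing.scale/= trig_basis_sin//; ring.
Qed.

Lemma is_derive_basis_sin m (x : R) : (0 < m)%N -> is_derive x 1 (phi m.*2.+1) (freq m * phi m.*2 x).
Proof.
move=> m0; rewrite (_ : phi m.*2.+1 = fun x => Num.sqrt 2 * sin (freq m * x)); last first.
  by apply/funext => y; rewrite trig_basis_sin.
have := is_derive_sinw (freq m) x => h.
by apply: is_derive_eq; rewrite /GRing.scale/= trig_basis_cos//; ring.
Qed.

Lemma is_derive_sum_seq (s : seq nat) (F G : nat -> R -> R) (x : R) :
  (forall j, j \in s -> is_derive x 1 (F j) (G j x)) ->
  is_derive x 1 (fun x => \sum_(j <- s) F j x) (\sum_(j <- s) G j x).
Proof.
elim: s => [|j s IH] h.
  by under eq_fun do rewrite big_nil; rewrite big_nil; exact: is_derive_cst.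
under eq_fun do rewrite big_cons; rewrite big_cons.
have h1 := h j (mem_head _ _).
have h2 : is_derive x 1 (fun x => \sum_(j <- s) F j x) (\sum_(j <- s) G j x).
  by apply: IH => i si; apply: h; rewrite inE si orbT.
exact: is_deriveD.
Qed.

Lemma is_derive_tpoly a b c (x : R) : (0 < a)%N ->
  is_derive x 1 (tpoly (index_iota a.*2 b.*2) c) (tpoly (index_iota a.*2 b.*2) (dcoef c) x).
Proof.
move=> a0.
rewrite (_ : tpoly _ c = fun x => \sum_(m <- index_iota a b) (c m.*2 * phi m.*2 x + c m.*2.+1 * phi m.*2.+1 x)).
  rewrite /tpoly sum_pairs; 
  apply: (@is_derive_sum_seq _ (fun m y => c m.*2 * phi m.*2 y + c m.*2.+1 * phi m.*2.+1 y)
    (fun m y => dcoef c m.*2 * phi m.*2 y + dcoef c m.*2.+1 * phi m.*2.+1 y)) => m.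
  rewrite mem_index_iota => /andP[am _]; have m0 : (0 < m)%N by exact: leq_trans am.
  have h1 := is_derive_basis_cos x m0; have h2 := is_derive_basis_sin x m0.
  apply: is_derive_eq; rewrite /GRing.scale/= /dcoef /= odd_double/= doubleK uphalf_double; ring.
by apply/funext => y; rewrite /tpoly sum_pairs.
Qed.

Lemma derive1n_tpoly a b c i : (0 < a)%N ->
  derive1n i (tpoly (index_iota a.*2 b.*2) c) = tpoly (index_iota a.*2 b.*2) (iter i dcoef c).
Proof.
move=> a0; elim: i => [//|i IH]; rewrite derive1nS IH; apply/funext => x.
by rewrite derive1E; apply: derive_val; exact: is_derive_tpoly.
Qed.

Lemma Cper_tpoly a b (c : nat -> R) k : (0 < a)%N -> Cper k (tpoly (index_iota a.*2 b.*2) c).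
Proof.
move=> a0; split.
- by move=> t; apply: eq_bigr => j _; rewrite trig_basis_periodic.
- by move=> i t ik; rewrite derive1n_tpoly//; apply: ex_derive; exact: is_derive_tpoly.
- by rewrite derive1n_tpoly//; exact: continuous_tpoly.
Qed.

Lemma ip_tpoly s (c : nat -> R) : uniq s -> all (fun j => 0 < j)%N s ->
  ip (tpoly s c) (tpoly s c) = \sum_(j <- s) c j ^+ 2.
Proof.
move=> us s0; have L0 : L2fun 1 (fun=> 0 : R) by apply: L2_continuous; exact: continuous_cst_fun.
have [_ E _] := tpoly_distance c L0 us s0.
have z g : ip (fun=> 0) g = 0.
  by rewrite /ip; under eq_Rintegral do rewrite mul0r; rewrite Rintegral_cst// mul0r.
move: E; rewrite z big1 => [|j _]; last by rewrite z mulr0.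
rewrite mulr0 subr0 add0r => <-; apply: eq_Rintegral => x _; ring.
Qed.

Lemma dcoef_energy a b c (w : nat -> R) :
  \sum_(a.*2 <= j < b.*2) w j./2 * dcoef c j ^+ 2 =
  \sum_(a.*2 <= j < b.*2) w j./2 * freq j./2 ^+ 2 * c j ^+ 2.
Proof.
rewrite !sum_pairs; apply: eq_bigr => m _.
by rewrite /dcoef /= odd_double/= doubleK uphalf_double; ring.
Qed.

Lemma iter_dcoef_energy a b c (w : nat -> R) i :
  \sum_(a.*2 <= j < b.*2) w j./2 * iter i dcoef c j ^+ 2 =
  \sum_(a.*2 <= j < b.*2) w j./2 * freq j./2 ^+ (2 * i) * c j ^+ 2.
Proof.
elim: i w => [|i IH] w; first by apply: eq_bigr => j _; rewrite muln0 expr0 mulr1.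
rewrite iterS dcoef_energy (IH (fun m => w m * freq m ^+ 2)).
by apply: eq_bigr => j _; rewrite mulnS exprD mulrA.
Qed.

Definition sobolev_weight k m : R := \sum_(i < k.+1) freq m ^+ (2 * i).

(** The source of members of the ball for the lower bound: for trigonometric
    polynomials all the derivatives in the Sobolev energy are explicit. *)
Lemma sobolev_tpoly k r a b c : (0 < a)%N ->
  \sum_(a.*2 <= j < b.*2) sobolev_weight k j./2 * c j ^+ 2 <= r ->
  sobolev k r (tpoly (index_iota a.*2 b.*2) c).
Proof.
move=> a0 h; split; first exact: Cper_tpoly.
under eq_bigr => i _.
  rewrite derive1n_tpoly// norm2E; last by apply: L2_continuous; exact: continuous_tpoly.
  rewrite ip_tpoly ?iota_uniq//; last by apply: index_iota_gt0; rewrite double_gt0.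
  over.
rewrite sumEFin lee_fin; apply: le_trans h; rewrite le_eqVlt; apply/orP; left; apply/eqP.
under [RHS]eq_bigr do rewrite /sobolev_weight mulr_suml.
rewrite [RHS]exchange_big/=; apply: eq_bigr => i _.
rewrite (eq_bigr (fun j => 1 * iter i dcoef c j ^+ 2)) => [|j _]; last by rewrite mul1r.
rewrite (iter_dcoef_energy a b c (fun=> 1) i).
by apply: eq_bigr => j _; rewrite mul1r.
Qed.

End sobolev_ball.

(** * From estimators of a function to estimators of its coefficients *)

Section estimator_coefficients.
Context {R : realType} {n : nat}.
Local Notation D := (skorokhod R n).
Local Notation mu := (@lebesgue_measure R).
Local Notation phi := (@trig_basis R).

Lemma measurable_section (Sh : D -> R -> R) y : estimators Sh -> measurable_fun `[(0 : R), 1] (Sh y).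
Proof.
move=> mSh.
have := @measurable_comp _ _ _ _ _ _ ([set: D] `*` [set t : R | 0 <= t <= 1])
  (fun p : D * R => Sh p.1 p.2) (`[(0 : R)%R, 1%R]%classic : set (measurableTypeR R)) (fun t : R => (y, t)).
apply => //.
- by apply: measurableX => //; rewrite -set_itvcc; exact: measurable_itv.
- by move=> _ [t /= t01 <-]; split => //; move: t01; rewrite in_itv.
- by apply: measurable_funTS; exact: pair1_measurable.
Qed.

Lemma measurable_fourier_coefficient (Sh : D -> R -> R) j : estimators Sh ->
  measurable_fun setT (fun y => ip (Sh y) (phi j)).
Proof.
move=> mSh; rewrite /ip /Rintegral.
have m01 : measurable ([set: D] `*` [set t : R | 0 <= t <= 1]).
  by apply: measurableX => //; rewrite -set_itvcc; exact: measurable_itv.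
pose g (p : D * R) := (Sh p.1 p.2 * phi j p.2) * \1_(`[0%R, 1%R]%classic) p.2.
have mg : measurable_fun setT g.
  rewrite (_ : g = ((fun p => Sh p.1 p.2) \_ ([set: D] `*` [set t : R | 0 <= t <= 1])) \*
     (fun p => phi j p.2)).
    apply: measurable_funM; first by apply/(measurable_restrictT _ m01).
    by apply: measurableT_comp => //; apply: continuous_measurable; exact: continuous_trig_basis.
  apply/funext => -[y t]; rewrite /g /= patchE indicE.
  have -> : (t \in `[0%R, 1%R]%classic) = ((y, t) \in [set: D] `*` [set t : R | 0 <= t <= 1]).
    apply/idP/idP; rewrite !inE/= in_itv/=; by [|move=> [_ ->]].
  by case: ifP => _; rewrite ?mulr1 ?mulr0 ?mul0r.
have E y : (\int[mu]_(x in `[0%R, 1%R]) (Sh y x * phi j x)%:E =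
    \int[mu]_x ((EFin \o g)^\+ (y, x)) - \int[mu]_x ((EFin \o g)^\- (y, x)))%E.
  rewrite integral_mkcond integralE; congr (_ - _)%E; apply: eq_integral => x _;
    rewrite ?funeposE ?funenegE /g /= patchE indicE; case: ifP => _;
    by rewrite ?mulr1 ?mulr0.
under eq_fun do rewrite E.
have mG : measurable_fun setT (EFin \o g) by apply/measurable_EFinP.
have mpos (F : D * R -> \bar R) : measurable_fun setT F -> (forall p, (0 <= F p)%E) ->
    measurable_fun setT (fun y => \int[mu]_x F (y, x))%E.
  move=> mF F0; apply: (measurable_integral_snd mu (f := fun y x => F (y, x))) => [|//].
  by rewrite (_ : (fun p => _) = F)//; apply/funext => -[].
apply: measurableT_comp => //; apply: emeasurable_funB; apply: mpos => //.
- exact: measurable_funepos.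
- exact: measurable_funeneg.
Qed.

End estimator_coefficients.

Section coefficient_truncation.
Context {R : realType}.
Local Notation phi := (@trig_basis R).
Implicit Types (v w : nat -> R) (s : seq nat) (B : R).

(** A vector of squared norm above 4 B is further from the ball of radius
    sqrt B than 0 is, so replacing it by 0 does not increase the error; the
    truncated coefficients are bounded. *)
Definition truncate_vector s B v j : R := if \sum_(i <- s) v i ^+ 2 <= 4 * B then v j else 0.

Lemma truncate_vector_norm s B v : 0 <= B -> \sum_(j <- s) truncate_vector s B v j ^+ 2 <= 4 * B.
Proof.
move=> B0; rewrite /truncate_vector; case: (boolP (\sum_(i <- s) v i ^+ 2 <= 4 * B)) => [//|_].
by rewrite big1 ?mulr_ge0// => j _; rewrite expr0n.
Qed.

Lemma truncate_vector_dist s B v w : \sum_(j <- s) w j ^+ 2 <= B ->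
  \sum_(j <- s) (truncate_vector s B v j - w j) ^+ 2 <= \sum_(j <- s) (v j - w j) ^+ 2.
Proof.
move=> wB; rewrite /truncate_vector; case: (boolP (\sum_(i <- s) v i ^+ 2 <= 4 * B)) => [//|]; rewrite -ltNge => vB.
under eq_bigr do rewrite sub0r sqrrN.
have : \sum_(j <- s) (v j - w j) ^+ 2 >= \sum_(j <- s) (2^-1 * v j ^+ 2 - w j ^+ 2).
  apply: ler_sum => j _; rewrite -subr_ge0.
  rewrite (_ : _ - _ = 2^-1 * (v j - 2 * w j) ^+ 2); last by field.
  by rewrite mulr_ge0// sqr_ge0.
rewrite sumrB -mulr_sumr; lra.
Qed.

Lemma truncate_vector_bound s B v j : 0 <= B -> uniq s -> j \in s ->
  `|truncate_vector s B v j| <= 1 + 4 * B.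
Proof.
move=> B0 us js; have := truncate_vector_norm s v B0.
rewrite (bigD1_seq j)//= => h.
have {h} : truncate_vector s B v j ^+ 2 <= 4 * B.
  by apply: le_trans h; rewrite lerDl; apply: sumr_ge0 => i _; exact: sqr_ge0.
rewrite -(real_normK (num_real _)); have := normr_ge0 (truncate_vector s B v j).
by move: `|_| => z; nra.
Qed.

(** If g is not square integrable the right-hand side is infinite; otherwise
    this is Bessel's inequality, followed by the truncation. *)
Lemma L2_error_lower (g : R -> R) s (c : nat -> R) B : measurable_fun `[(0 : R), 1] g ->
  uniq s -> all (fun j => 0 < j)%N s -> \sum_(j <- s) c j ^+ 2 <= B ->
  ((\sum_(j <- s) (truncate_vector s B (fun j => ip g (phi j)) j - c j) ^+ 2)%:E <=
   norm2 (fun t => g t - tpoly s c t)%R)%E.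
Proof.
move=> mg us s0 cB.
have cT : continuous (tpoly s c) by exact: continuous_tpoly.
have mT : measurable_fun `[(0 : R), 1] (tpoly s c) by exact: continuous_measurable.
case: (pselect (L2fun 1 g)) => [Lg|nLg].
  have Lh : L2fun 1 (fun t => g t - tpoly s c t).
    rewrite (_ : (fun t => _) = fun t => g t - 1 * tpoly s c t).
      by apply: L2_sub_scale => //; exact: L2_continuous.
    by apply/funext => t; rewrite mul1r.
  rewrite norm2E// lee_fin tpoly_pythagoras//.
  apply: (le_trans (truncate_vector_dist (fun j => ip g (phi j)) cB)).
  have := bessel Lg us s0; rewrite -subr_ge0 => h.
  have -> : \sum_(j <- s) (c j - ip g (phi j)) ^+ 2 = \sum_(j <- s) (ip g (phi j) - c j) ^+ 2.
    by apply: eq_bigr => j _; rewrite -sqrrN opprB.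
  by rewrite lerDl.
rewrite [norm2 _](_ : _ = +oo%E) ?leey//; apply/eqP; rewrite -leye_eq leNgt.
apply/negP => h; apply: nLg.
have Lh : L2fun 1 (fun t => g t - tpoly s c t) by split => //; exact: measurable_funB.
rewrite (_ : g = fun t => (g t - tpoly s c t) - (-1) * tpoly s c t).
  by apply: L2_sub_scale => //; exact: L2_continuous.
by apply/funext => t; ring.
Qed.

End coefficient_truncation.

Section basis_energy.
Context {R : realType}.
Local Notation mu := (@lebesgue_measure R).
Local Notation phi := (@trig_basis R).

Lemma basis_energy n j : (1 < j)%N -> \int[mu]_(x in `[0%R, n%:R%R]) (phi j x ^+ 2) = n%:R.
Proof.
move=> j1; have [E|[m m0 E]|[m m0 E]] := trig_basisP (ltnW j1).
- by rewrite E in j1.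
- have c1 : continuous (fun x : R => 1 + cos (freq (2 * m) * x)).
    by apply: continuousD_fun; [exact: continuous_cst_fun|exact: continuous_cosw].
  have w0 : freq (2 * m) != 0 :> R by rewrite gt_eqF// freq_gt0// muln_gt0.
  have dF (x : R) : is_derive x 1 (fun x => x + (freq (2 * m))^-1 * sin (freq (2 * m) * x))
      (1 + cos (freq (2 * m) * x)).
    have h := is_derive_sinw (freq (2 * m)) x.
    by apply: is_derive_eq; rewrite /GRing.scale/= ?mulr0 ?addr0 mulKf.
  have := Rintegral_FTC (ler0n R n) dF c1.
  have -> : sin (freq (2 * m) * n%:R) = 0 :> R.
    by rewrite /freq -mulrA -natrM sin_nat_period.
  rewrite [freq _ * 0]mulr0 sin0 !mulr0 !addr0 subr0 => h; rewrite -[RHS]h; apply: eq_Rintegral => x _.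
  rewrite E trig_basis_cos// exprMn sqr_sqrtr//.
  have -> : freq (2 * m) * x = (freq m * x) *+ 2 by rewrite /freq natrM mulr2n; ring.
  by rewrite cos_mulr2n; ring.
- have c1 : continuous (fun x : R => 1 + - cos (freq (2 * m) * x)).
    by apply: continuousD_fun; [exact: continuous_cst_fun|apply: continuousN_fun; exact: continuous_cosw].
  have w0 : freq (2 * m) != 0 :> R by rewrite gt_eqF// freq_gt0// muln_gt0.
  have dF (x : R) : is_derive x 1 (fun x => x + (- (freq (2 * m))^-1) * sin (freq (2 * m) * x))
      (1 + - cos (freq (2 * m) * x)).
    have h := is_derive_sinw (freq (2 * m)) x.
    by apply: is_derive_eq; rewrite /GRing.scale/= ?mulr0 ?addr0 mulNr mulKf.
  have := Rintegral_FTC (ler0n R n) dF c1.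
  have -> : sin (freq (2 * m) * n%:R) = 0 :> R.
    by rewrite /freq -mulrA -natrM sin_nat_period.
  rewrite [freq _ * 0]mulr0 sin0 !mulr0 !addr0 subr0 => h; rewrite -[RHS]h; apply: eq_Rintegral => x _.
  rewrite E trig_basis_sin// exprMn sqr_sqrtr//.
  have -> : freq (2 * m) * x = (freq m * x) *+ 2 by rewrite /freq natrM mulr2n; ring.
  by rewrite cos_mulr2n cos2sin2; ring.
Qed.

End basis_energy.

(** * Bayes risk of the coefficients *)

Section scaled_bayes.
Context {R : realType} {n : nat}.
Local Notation D := (skorokhod R n).
Local Notation mu := (@lebesgue_measure R).
Local Notation N01 := (@normal_prob R 0 1).
Variables (Q : probability D R) (c : R).
Hypotheses (c0 : 0 < c) (wQ : wiener c Q).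

Lemma path_addA (h1 h2 : R -> R) (x : D) : cadlag n%:R h1 -> cadlag n%:R h2 ->
  path_add h1 (path_add h2 x) = path_add (fun t => h1 t + h2 t) x.
Proof.
move=> ch1 ch2; apply: skorokhod_eq => t tn.
by rewrite !path_addE// ?addrA//; exact: (cadlagD ch1 ch2).
Qed.

(** The known part h0 of the drift is absorbed in the functional, and the scale
    sg is factored out of the squared error. *)
Lemma scaled_bayes (F : D -> R) (K sg A : R) (psi h0 : R -> R) : 0 < sg ->
  measurable_fun setT F -> (forall x, `|F x| <= K) -> cadlag n%:R h0 ->
  continuous psi -> \int[mu]_(x in `[0%R, n%:R%R]) (psi x ^+ 2) <= A ->
  ((sg ^+ 2 / (1 + A / c))%:E <= \int[N01]_u \int[Q]_x
     ((F (path_add (fun t => h0 t + u * drift psi t) x) - sg * u) ^+ 2)%:E)%E.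
Proof.
move=> sg0 mF FK ch0 cpsi psiA; have cd := @cadlag_drift_path R n psi cpsi.
pose G (x : D) := sg^-1 * F (path_add h0 x).
have mG : measurable_fun setT G.
  apply: measurable_funM; first exact: measurable_cst.
  by apply: measurableT_comp; [exact: mF|exact: measurable_path_add].
have Gb x : `|G x| <= sg^-1 * K.
  by rewrite normrM gtr0_norm ?invr_gt0// ler_wpM2l ?invr_ge0 ?(ltW sg0).
have key := one_dimensional_bayes c0 wQ cpsi mG Gb psiA.
have GE u x : (F (path_add (fun t => h0 t + u * drift psi t) x) - sg * u) ^+ 2 =
    sg ^+ 2 * (G (path_add (fun t => u * drift psi t) x) - u) ^+ 2.
  rewrite -exprMn mulrBr; congr ((_ - _) ^+ 2).
  by rewrite /G mulVKf ?gt_eqF// path_addA//; exact: cadlagZ.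
have s20 : (0 <= (sg ^+ 2)%:E)%E by rewrite lee_fin sqr_ge0.
have mg : measurable_fun setT (fun p : R * D =>
    ((G (path_add (fun t => p.1 * drift psi t) p.2) - p.1) ^+ 2)%:E).
  apply/measurable_EFinP; apply: measurable_funX; apply: measurable_funB => //.
  by apply: measurableT_comp; [exact: mG|exact: measurable_drift_path].
move: G {mG Gb} GE key mg => G GE key mg.
have E u : (\int[Q]_x ((F (path_add (fun t => h0 t + u * drift psi t) x) - sg * u) ^+ 2)%:E =
    (sg ^+ 2)%:E * \int[Q]_x ((G (path_add (fun t => u * drift psi t) x) - u) ^+ 2)%:E)%E.
  rewrite -ge0_integralZl//.
  - by apply: eq_integral => x _; rewrite GE EFinM.
  - exact: (measurable_fun_pair2 u mg).
  - by move=> x _; rewrite lee_fin sqr_ge0.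
under eq_integral do rewrite E.
rewrite ge0_integralZl//.
- by rewrite EFinM; apply: lee_wpmul2l.
- apply: (measurable_integral_snd Q (f := fun (u : measurableTypeR R) (x : D) => ((G (path_add (fun t => u * drift psi t) x) - u) ^+ 2)%:E)) => //.
  by move=> u x; rewrite lee_fin sqr_ge0.
- by move=> u _; apply: integral_ge0 => x _; rewrite lee_fin sqr_ge0.
Qed.

End scaled_bayes.

Section bayes_lower_bound.
Context {R : realType} {n : nat}.
Local Notation D := (skorokhod R n).
Local Notation mu := (@lebesgue_measure R).
Local Notation N01 := (@normal_prob R 0 1).
Local Notation phi := (@trig_basis R).
Local Notation mR := (measurableTypeR R).
Variables (Q : probability D R) (c : R).
Hypotheses (c0 : 0 < c) (wQ : wiener c Q).
Variables (Sh : D -> R -> R) (a b : nat) (sigma : nat -> R) (B : R).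
Hypotheses (mSh : estimators Sh) (a0 : (0 < a)%N) (B0 : 0 <= B).
Hypothesis sigma_gt0 : forall j, (a.*2 <= j < b.*2)%N -> 0 < sigma j.
Let s := index_iota a.*2 b.*2.
Let d := (b.*2 - a.*2)%N.

(** The coordinates of t stand for the basis functions of index
    a.*2, ..., b.*2.-1, hence the shift by a.*2. *)
Definition prior_coef (t : d.-tuple mR) (j : nat) : R := sigma j * nth 0 t (j - a.*2).

Definition prior_drift (t : d.-tuple mR) (x : R) : R := drift (tpoly s (prior_coef t)) x.

Definition coef_estimate (y : D) (j : nat) : R :=
  truncate_vector s B (fun j => ip (Sh y) (phi j)) j.

Let us : uniq s. Proof. exact: iota_uniq. Qed.
Let s_gt0 : all (fun j => 0 < j)%N s.
Proof. by apply: index_iota_gt0; rewrite double_gt0. Qed.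

Lemma measurable_coef_estimate j : measurable_fun setT (coef_estimate^~ j).
Proof.
rewrite /coef_estimate /truncate_vector.
apply: measurable_fun_if => //.
- apply: measurable_fun_ler => //.
  by apply: measurable_sum => i; apply: measurable_funX; exact: measurable_fourier_coefficient.
- by apply: measurable_funTS; exact: measurable_fourier_coefficient.
Qed.

Lemma prior_coef_measurable j : measurable_fun setT (prior_coef^~ j).
Proof.
apply: measurable_funM => //; have [h|h] := ltnP (j - a.*2) d; last first.
  rewrite (_ : (fun t => _) = fun=> 0); first exact: measurable_cst.
  by apply/funext => t; rewrite nth_default// size_tuple.
rewrite (_ : (fun t => _) = (fun t : d.-tuple mR => tnth t (Ordinal h))).
  exact: measurable_tnth.
by apply/funext => t; rewrite (tnth_nth 0).
Qed.

Lemma driftZ (u : R) (g : R -> R) x : continuous g -> drift (fun t => u * g t) x = u * drift g x.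
Proof. by move=> cg; rewrite /drift RintegralZl//; exact: continuous_integrable. Qed.

Lemma drift_tpoly r cf x : drift (tpoly r cf) x = \sum_(j <- r) cf j * drift (phi j) x.
Proof.
elim: r => [|j r IH].
  rewrite big_nil /tpoly /drift.
  under eq_Rintegral do rewrite big_nil.
  by rewrite Rintegral_cst// mul0r.
rewrite big_cons -IH /tpoly /drift.
under eq_Rintegral do rewrite big_cons.
have cj := @continuous_trig_basis R j.
rewrite RintegralD//; last 2 first.
- by apply: continuous_integrable; exact: continuousZ_fun.
- by apply: continuous_integrable; exact: (@continuous_tpoly R r cf).
by congr (_ + _); exact: driftZ.
Qed.

Lemma prior_drift_measurable x : measurable_fun setT (prior_drift^~ x).
Proof.
rewrite /prior_drift; under eq_fun do rewrite drift_tpoly.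
by apply: measurable_sum => j; apply: measurable_funM => //; exact: prior_coef_measurable.
Qed.

Lemma cadlag_prior_drift t : cadlag n%:R (prior_drift t).
Proof. by apply: cadlag_drift_path; exact: continuous_tpoly. Qed.

Definition coef_risk (t : d.-tuple mR) (j : nat) : \bar R :=
  (\int[Q]_x ((coef_estimate (path_add (prior_drift t) x) j - prior_coef t j) ^+ 2)%:E)%E.

Lemma measurable_coef_error j : measurable_fun setT (fun p : d.-tuple mR * D =>
  ((coef_estimate (path_add (prior_drift p.1) p.2) j - prior_coef p.1 j) ^+ 2)%:E).
Proof.
apply/measurable_EFinP; apply: measurable_funX; apply: measurable_funB.
- apply: (@measurableT_comp _ _ _ _ _ _ (coef_estimate^~ j)); first exact: measurable_coef_estimate.
  apply: measurable_path_add => //.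
  + by move=> p; exact: cadlag_prior_drift.
  + by move=> t _; apply: (@measurableT_comp _ _ _ _ _ _ (prior_drift^~ t)) => //; exact: prior_drift_measurable.
- by apply: (@measurableT_comp _ _ _ _ _ _ (prior_coef^~ j)) => //; exact: prior_coef_measurable.
Qed.

Lemma measurable_coef_risk j : measurable_fun setT (coef_risk^~ j).
Proof.
apply: (measurable_integral_snd Q (f := fun t x => _)).
  exact: measurable_coef_error.
by move=> t x; rewrite lee_fin sqr_ge0.
Qed.

Lemma coef_risk_ge0 t j : (0 <= coef_risk t j)%E.
Proof. by apply: integral_ge0 => x _; rewrite lee_fin sqr_ge0. Qed.

Lemma prior_coef_set t (i : 'I_d) u j : prior_coef (tuple_set t i u) j =
  if (j - a.*2 == i)%N then sigma j * u else prior_coef t j.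
Proof.
rewrite /prior_coef; have [h|h] := ltnP (j - a.*2) d; last first.
  rewrite !nth_default ?size_tuple//; case: eqP => // E.
  by move: h; rewrite E leqNgt ltn_ord.
rewrite -[(j - a.*2)%N]/(val (Ordinal h)) -!tnth_nth tnth_mktuple -(inj_eq val_inj)/=.
by case: eqP.
Qed.

(** With the coordinates other than i fixed, the drift is affine in the
    i-th one, of direction sigma_j phi_j, whose energy on [0, n] is
    n sigma_j^2. *)
Lemma coordinate_bayes t (i : 'I_d) :
  ((sigma (i + a.*2) ^+ 2 / (1 + n%:R * sigma (i + a.*2) ^+ 2 / c))%:E <=
   \int[N01]_u coef_risk (tuple_set t i u) (i + a.*2))%E.
Proof.
set j := (i + a.*2)%N.
have js : j \in s.
  by rewrite mem_index_iota leq_addl/= /j addnC -ltn_subRL ltn_ord.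
have sj : 0 < sigma j by apply: sigma_gt0; move: js; rewrite mem_index_iota.
have cpsi : continuous (fun x => sigma j * phi j x).
  by apply: continuousZ_fun; exact: continuous_trig_basis.
have psiA : \int[mu]_(x in `[0%R, n%:R%R]) ((sigma j * phi j x) ^+ 2) <= n%:R * sigma j ^+ 2.
  under eq_Rintegral do rewrite exprMn.
  rewrite RintegralZl//; last first.
    by apply: continuous_integrable; apply: continuous_sqr; exact: continuous_trig_basis.
  rewrite basis_energy 1?mulrC//.
  by move: js a0; rewrite mem_index_iota; lia.
have mF := measurable_coef_estimate j.
have Fb x : `|coef_estimate x j| <= 1 + 4 * B by exact: truncate_vector_bound.
have ch0 := cadlag_prior_drift (tuple_set t i 0).
have key := scaled_bayes c0 wQ sj mF Fb ch0 cpsi psiA.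
suff E (u : R) : coef_risk (tuple_set t i u) j = (\int[Q]_x
    ((coef_estimate (path_add (fun z => prior_drift (tuple_set t i 0) z +
       u * drift (fun x => sigma j * phi j x)%R z) x) j - sigma j * u) ^+ 2)%:E)%E.
  by under eq_integral do rewrite E.
rewrite /coef_risk; apply: eq_integral => x _.
have -> : prior_coef (tuple_set t i u) j = sigma j * u.
  by rewrite prior_coef_set /j addnK eqxx.
suff -> : prior_drift (tuple_set t i u) = fun z => prior_drift (tuple_set t i 0) z +
    u * drift (fun x => sigma j * phi j x) z by [].
apply/funext => z; rewrite /prior_drift !drift_tpoly driftZ; last exact: continuous_trig_basis.
rewrite !(bigD1_seq j js us)/= !prior_coef_set /j addnK eqxx mulr0 mul0r add0r -/j.
rewrite addrC mulrA [u * _]mulrC; congr (_ + _).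
rewrite big_seq_cond [RHS]big_seq_cond; apply: eq_bigr => l /andP[ls lj]; rewrite !prior_coef_set.
case: eqP => // E; move: lj; rewrite /j -E subnK ?eqxx//.
by move: ls; rewrite mem_index_iota => /andP[].
Qed.

Lemma bayes_risk_lower :
  ((\sum_(a.*2 <= j < b.*2) sigma j ^+ 2 / (1 + n%:R * sigma j ^+ 2 / c))%:E <=
   \int[tuple_prior d]_t \sum_(j <- s) coef_risk t j)%E.
Proof.
rewrite ge0_integral_sum//; last 2 first.
- by move=> j _; exact: measurable_coef_risk.
- by move=> j t _; exact: coef_risk_ge0.
rewrite -sumEFin /s -[a.*2]add0n big_addn [leRHS]big_addn -/d !big_mkord.
apply: lee_sum => i _; rewrite (tuple_prior_resample i); last 2 first.
- exact: measurable_coef_risk.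
- by move=> t; exact: coef_risk_ge0.
rewrite -(prob_integral_cst (tuple_prior d) (_ / _)%:E); apply: ge0_le_integral => //.
- move=> t _; rewrite lee_fin divr_ge0 ?sqr_ge0// addr_ge0// divr_ge0 ?(ltW c0)//.
  by rewrite mulr_ge0 ?sqr_ge0.
- apply: (measurable_integral_snd N01 (f := fun t u => coef_risk (tuple_set t i u) (i + a.*2))).
    apply: (@measurableT_comp _ _ _ _ _ _ (coef_risk^~ _)); first exact: measurable_coef_risk.
    exact: measurable_tuple_set.
  by move=> t u; exact: coef_risk_ge0.
- by move=> t _; exact: coordinate_bayes.
Qed.

End bayes_lower_bound.

(** * From the prior to the Sobolev ball *)

Section measurable_loss.
Context {R : realType} {n : nat}.
Local Notation D := (skorokhod R n).
Local Notation mu := (@lebesgue_measure R).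

Lemma measurable_loss (Sh : D -> R -> R) (S : R -> R) : estimators Sh -> continuous S ->
  measurable_fun setT (fun y => norm2 (fun t => Sh y t - S t)).
Proof.
move=> mSh cS.
have m01 : measurable ([set: D] `*` [set t : R | 0 <= t <= 1]).
  by apply: measurableX => //; rewrite -set_itvcc; exact: measurable_itv.
pose A := [set: D] `*` [set t : R | 0 <= t <= 1].
pose g := (fun p : D * R => (Sh p.1 p.2 - S p.2) ^+ 2) \_ A.
have mg : measurable_fun setT g.
  apply/(measurable_restrictT _ m01); apply: measurable_funX; apply: measurable_funB => //.
  by apply: measurable_funTS; apply: measurableT_comp => //; exact: continuous_measurable.
have E y : norm2 (fun t => Sh y t - S t) = (\int[mu]_x (g (y, x))%:E)%E.
  rewrite /norm2 integral_mkcond; apply: eq_integral => x _.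
  rewrite /g !patchE.
  have -> : (x \in `[0%R, 1%R]%classic) = ((y, x) \in A).
    by apply/idP/idP; rewrite !inE/= in_itv/=; [|move=> [_ ->]].
  by case: ifP.
under eq_fun do rewrite E.
apply: (measurable_integral_snd mu (f := fun (y : D) (x : measurableTypeR R) => (g (y, x))%:E)).
  by apply/measurable_EFinP; rewrite (_ : (fun p => _) = g)//; apply/funext => -[].
by move=> y x; rewrite lee_fin /g patchE; case: ifP => //= _; exact: sqr_ge0.
Qed.

Lemma measurable_observation (S : R -> R) : continuous S ->
  measurable_fun setT (@observation R n S).
Proof.
move=> cS; rewrite (_ : observation S = path_add (drift S))//.
by apply: measurable_path_add => // _; exact: cadlag_drift_path.
Qed.

End measurable_loss.

Section ball_lower_bound.
Context {R : realType} {n : nat}.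
Local Notation D := (skorokhod R n).
Local Notation mu := (@lebesgue_measure R).
Local Notation phi := (@trig_basis R).
Local Notation mR := (measurableTypeR R).
Implicit Types (k a b : nat) (r : R) (sigma : nat -> R).

Lemma sobolev_weight_ge1 k m : 1 <= sobolev_weight k m :> R.
Proof.
rewrite /sobolev_weight big_ord_recl/= muln0 expr0 lerDl.
by apply: sumr_ge0 => i _; rewrite exprn_ge0// freq_ge0.
Qed.

Lemma le_freq m m' : (m <= m')%N -> freq m <= freq m' :> R.
Proof. by move=> mm; rewrite /freq ler_wpM2l ?mulr_ge0 ?pi_ge0// ler_nat. Qed.

Lemma le_sobolev_weight k m m' : (m <= m')%N -> sobolev_weight k m <= sobolev_weight k m' :> R.
Proof.
move=> mm; apply: ler_sum => i _; rewrite lerXn2r ?nnegrE ?freq_ge0//.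
exact: le_freq.
Qed.

Lemma off_ball (X r W : R) : 0 <= W -> W < r -> r <= X -> X * (r - W) ^+ 2 <= r * (X - W) ^+ 2.
Proof.
move=> W0 Wr rX; rewrite -subr_ge0.
rewrite (_ : _ - _ = (X - r) * (r * X - W ^+ 2)); last by ring.
apply: mulr_ge0; first by rewrite subr_ge0.
by rewrite subr_ge0; nra.
Qed.

(** X is the Sobolev energy of a draw from the prior, of mean W < r. Inside the
    ball the truncated coefficient risk is at most rho. Outside, the truncated
    estimate and the draw both have squared norm O(X / A), where A is the
    weight of the lowest frequency of the prior, and X > r > W gives
    X <= r (X - W)^2 / (r - W)^2. The mean of (X - W)^2 is the variance of a
    weighted sum of squares of independent normal variables. *)
Lemma ball_lower_bound (Q : probability D R) (c : R) (Sh : D -> R -> R) k r a b sigma rho :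
  0 < c -> wiener c Q -> estimators Sh -> (0 < a)%N -> 0 < r ->
  (forall j, (a.*2 <= j < b.*2)%N -> 0 < sigma j) ->
  \sum_(a.*2 <= j < b.*2) sobolev_weight k j./2 * sigma j ^+ 2 < r ->
  (forall S, sobolev k r S -> (risk Q Sh S <= rho)%E) ->
  ((\sum_(a.*2 <= j < b.*2) sigma j ^+ 2 / (1 + n%:R * sigma j ^+ 2 / c))%:E <= rho +
   (640 * r / (sobolev_weight k a *
      (r - \sum_(a.*2 <= j < b.*2) sobolev_weight k j./2 * sigma j ^+ 2) ^+ 2) *
    \sum_(a.*2 <= j < b.*2) (sobolev_weight k j./2 * sigma j ^+ 2) ^+ 2)%:E)%E.
Proof.
move=> c0 wQ mSh a0 r0 sg0; set W := \sum_(_ <= j < _) _ => Wr hrho.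
set s := index_iota a.*2 b.*2.
have us : uniq s by exact: iota_uniq.
have s_gt0 : all (fun j => 0 < j)%N s by apply: index_iota_gt0; rewrite double_gt0.
have A1 := sobolev_weight_ge1 k a; set A := sobolev_weight k a in A1 *.
have A0 : 0 < A by apply: lt_le_trans A1.
have W0 : 0 <= W.
  by apply: sumr_ge0 => j _; rewrite mulr_ge0 ?sqr_ge0// (le_trans ler01)// sobolev_weight_ge1.
(* bounds the squared norm of the coefficients of a draw inside the ball *)
pose B := r / A; have B0 : 0 <= B by rewrite divr_ge0 ?ltW.
have rho0 : (0 <= rho)%E.
  have b0 : sobolev k r (tpoly s (fun=> 0)).
    apply: sobolev_tpoly => //; rewrite big1 ?ltW// => j _.
    by rewrite expr0n mulr0.
  apply: le_trans (hrho _ b0); apply: integral_ge0 => x _; apply: integral_ge0 => t _.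
  by rewrite lee_fin sqr_ge0.
have key := bayes_risk_lower c0 wQ mSh a0 B0 sg0.
apply: (le_trans key).
set d := (b.*2 - a.*2)%N.
pose X (t : d.-tuple mR) := \sum_(j <- s) sobolev_weight k j./2 * prior_coef sigma t j ^+ 2.
pose w i := sobolev_weight k (i + a.*2)./2 * sigma (i + a.*2)%N ^+ 2.
have w0 i : 0 <= w i by rewrite mulr_ge0 ?sqr_ge0// (le_trans ler01)// sobolev_weight_ge1.
have WE : W = \sum_(i < d) w i by rewrite /W -[X in \sum_(X <= _ < _) _]add0n big_addn big_mkord.
have XE t : X t = weighted_squares w t.
  rewrite /X /s -[X in index_iota X _]add0n big_addn big_mkord.
  apply: eq_bigr => i _; rewrite /prior_coef addnK (tnth_nth 0) /w.
  by rewrite exprMn mulrA.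
(* 10 = 2 * 4 + 2: the squared norms of the truncated estimate, at most 4 B, and
   of the draw each count twice *)
pose K := 10 * r / (A * (r - W) ^+ 2).
have rW : 0 < r - W by rewrite subr_gt0.
have K0 : 0 <= K by rewrite divr_ge0 ?mulr_ge0 ?sqr_ge0// ltW.
have pointwise t : (\sum_(j <- s) coef_risk Q Sh sigma B t j <= rho + (K * (X t - W) ^+ 2)%:E)%E.
  have mE j : measurable_fun setT (fun x : D =>
      ((coef_estimate Sh a b B (path_add (prior_drift sigma t) x) j - prior_coef sigma t j) ^+ 2)%:E).
    exact: (measurable_fun_pair2 t (measurable_coef_error sigma B mSh j)).
  have -> : (\sum_(j <- s) coef_risk Q Sh sigma B t j = \int[Q]_x (\sum_(j <- s)
      (coef_estimate Sh a b B (path_add (prior_drift sigma t) x) j - prior_coef sigma t j) ^+ 2)%:E)%E.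
    under [RHS]eq_integral do rewrite -sumEFin.
    by rewrite ge0_integral_sum//; try (by move=> *; rewrite lee_fin sqr_ge0).
  have mS : measurable_fun setT (fun x : D => (\sum_(j <- s)
      (coef_estimate Sh a b B (path_add (prior_drift sigma t) x) j - prior_coef sigma t j) ^+ 2)%:E).
    apply/measurable_EFinP; apply: measurable_sum => j.
    by apply/measurable_EFinP; exact: mE.
  have normA : A * \sum_(j <- s) prior_coef sigma t j ^+ 2 <= X t.
    rewrite mulr_sumr /X !big_seq; apply: ler_sum => j; rewrite mem_index_iota => /andP[aj _].
    rewrite ler_wpM2r ?sqr_ge0//; apply: le_sobolev_weight.
    by rewrite -[a]doubleK half_leq.
  have [Xr|rX] := leP (X t) r.
    apply: (@le_trans _ _ rho); last by rewrite leeDl// lee_fin mulr_ge0 ?sqr_ge0.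
    have ball : sobolev k r (tpoly s (prior_coef sigma t)) by exact: sobolev_tpoly.
    apply: le_trans (hrho _ ball); rewrite /risk.
    have cT : continuous (tpoly s (prior_coef sigma t)) by exact: continuous_tpoly.
    apply: ge0_le_integral => //.
    - by move=> x _; rewrite lee_fin; apply: sumr_ge0 => j _; exact: sqr_ge0.
    - apply: (@measurableT_comp _ _ _ _ _ _ (fun y => norm2 (fun t0 => Sh y t0 - tpoly s (prior_coef sigma t) t0))).
        exact: measurable_loss.
      exact: measurable_observation.
    - move=> x _; apply: L2_error_lower => //; first exact: measurable_section.
      by rewrite /B ler_pdivlMr// mulrC (le_trans normA).
  rewrite (@le_trans _ _ (K * (X t - W) ^+ 2)%:E)//; last by rewrite leeDr.
  rewrite -(prob_integral_cst Q (K * (X t - W) ^+ 2)%:E); apply: ge0_le_integral => //.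
  - by move=> x _; rewrite lee_fin; apply: sumr_ge0 => j _; exact: sqr_ge0.
  move=> x _; rewrite lee_fin.
  set v := coef_estimate _ _ _ _ _; set th := prior_coef _ _.
  have h1 : \sum_(j <- s) (v j - th j) ^+ 2 <=
      2 * (\sum_(j <- s) v j ^+ 2) + 2 * \sum_(j <- s) th j ^+ 2.
    rewrite !mulr_sumr -big_split/=; apply: ler_sum => j _.
    rewrite -subr_ge0 (_ : _ - _ = (v j + th j) ^+ 2) ?sqr_ge0//; ring.
  have h2 : \sum_(j <- s) v j ^+ 2 <= 4 * B by exact: truncate_vector_norm.
  have h3 : \sum_(j <- s) th j ^+ 2 <= X t / A by rewrite ler_pdivlMr// mulrC.
  have h4 : B <= X t / A by rewrite /B ler_pM2r ?invr_gt0// ltW.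
  have h5 : 10 * (X t / A) <= K * (X t - W) ^+ 2.
    have := off_ball W0 Wr (ltW rX) => h.
    have -> : K * (X t - W) ^+ 2 = 10 * (r * (X t - W) ^+ 2 / (A * (r - W) ^+ 2)).
      by rewrite /K; field; rewrite !gt_eqF.
    rewrite ler_pM2l// ler_pdivlMr ?mulr_gt0 ?exprn_gt0//.
    by rewrite mulrA divfK ?gt_eqF.
  lra.
have mX : measurable_fun setT X.
  by rewrite (_ : X = weighted_squares w); [exact: measurable_weighted_squares|exact/funext].
apply: (@le_trans _ _ (\int[tuple_prior d]_t (rho + (K * (X t - W) ^+ 2)%:E))%E).
  apply: ge0_le_integral => //.
  - by move=> t _; apply: sume_ge0 => j _; exact: coef_risk_ge0.
  - apply: emeasurable_sum => j; exact: measurable_coef_risk.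
  - apply: emeasurable_funD => //; apply/measurable_EFinP; apply: measurable_funM => //.
    by apply: measurable_funX; apply: measurable_funB.
rewrite ge0_integralD//; last 2 first.
- by move=> t _; rewrite lee_fin mulr_ge0 ?sqr_ge0.
- apply/measurable_EFinP; apply: measurable_funM => //.
  by apply: measurable_funX; apply: measurable_funB.
rewrite prob_integral_cst leeD2l//.
under eq_integral do rewrite EFinM XE WE.
rewrite ge0_integralZl//; last 2 first.
- apply/measurable_EFinP; apply: measurable_funX; apply: measurable_funB => //.
  exact: measurable_weighted_squares.
- by move=> t _; rewrite lee_fin sqr_ge0.
have := tuple_prior_variance d w0 => hv.
apply: (@le_trans _ _ (K%:E * (64 * \sum_(i < d) w i ^+ 2)%:E)%E).
  by apply: lee_wpmul2l => //; rewrite lee_fin.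
rewrite -EFinM lee_fin le_eqVlt; apply/orP; left; apply/eqP.
have -> : \sum_(a.*2 <= j < b.*2) (sobolev_weight k j./2 * sigma j ^+ 2) ^+ 2 = \sum_(i < d) w i ^+ 2.
  by rewrite -[X in \sum_(X <= _ < _) _]add0n big_addn big_mkord.
by rewrite /K; field; rewrite !gt_eqF.
Qed.

End ball_lower_bound.

(** * Sums over a regular mesh *)

Section periodic_integrals.
Context {R : realType}.
Local Notation mu := (@lebesgue_measure R).
Local Notation phi := (@trig_basis R).

Lemma Rintegral_shift_ge0 (f : R -> R) (a : R) : continuous f -> (forall x, 0 <= f x) ->
  \int[mu]_(x in `[a, a + 1]) f x = \int[mu]_(x in `[0, 1]) f (x + a).
Proof.
move=> cf f0; rewrite /Rintegral; congr fine; rewrite integral_mkcond [RHS]integral_mkcond.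
pose F := (fun x : R => (f x)%:E) \_ `[a, a + 1].
have mF : measurable_fun setT F.
  have mI : measurable (`[a, a + 1]%classic : set (measurableTypeR R)) by exact: measurable_itv.
  by apply/(measurable_restrictT _ mI); apply/measurable_EFinP; exact: continuous_measurable.
have F0 u : (0 <= F u)%E by rewrite /F patchE; case: ifP => // _; rewrite lee_fin.
rewrite -[LHS]/(\int[mu]_x F x)%E -(integral_lebesgue_translate a mF F0).
apply: eq_integral => x _; rewrite /F !patchE.
have -> // : (x + a \in `[a, a + 1]%classic) = (x \in `[0, 1]%classic).
by apply/idP/idP; rewrite !inE/= !in_itv/=; lra.
Qed.

Lemma periodic_integral (g : R -> R) (N : nat) : continuous g -> (forall x, g (x + 1) = g x) ->
  \int[mu]_(x in `[0%R, N%:R%R]) g x = N%:R * int01 g.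
Proof.
suff main (f : R -> R) : continuous f -> (forall x : R, f (x + 1) = f x) -> (forall x, 0 <= f x) ->
    \int[mu]_(x in `[0%R, N%:R%R]) f x = N%:R * int01 f.
  move=> cg pg; have cn : continuous (fun x => `|g x|) by move=> x; apply: cvg_norm; exact: cg.
  have cs := continuousD_fun cn cg.
  have -> : \int[mu]_(x in `[0, N%:R]) g x = \int[mu]_(x in `[0, N%:R]) (`|g x| + g x)
      - \int[mu]_(x in `[0, N%:R]) `|g x|.
    rewrite -RintegralB//; [|exact: continuous_integrable|exact: continuous_integrable].
    by apply: eq_Rintegral => x _; rewrite addrC addKr.
  rewrite !main//.
  - by rewrite int01D//; ring.
  - by move=> x; rewrite pg.
  - by move=> x; rewrite pg.
  - by move=> x; have := ler_norm (- g x); rewrite normrN; lra.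
move=> cf pf f0; elim: N => [|N IH]; first by rewrite set_itv1 Rintegral_set1 mul0r.
rewrite (@Rintegral_split _ f 0 N%:R)// ?ler_nat// IH -[N.+1%:R]natr1 Rintegral_shift_ge0//.
rewrite mulrDl mul1r; congr (_ + _); apply: eq_Rintegral => x _.
elim: N {IH} x => [|N IH] x; first by rewrite addr0.
by rewrite -natr1 addrA pf.
Qed.

Lemma Rintegral_mesh (g : R -> R) (h : R) (N : nat) : continuous g -> 0 <= h ->
  \int[mu]_(x in `[0%R, (N%:R * h)%R]) g x =
  \sum_(i < N) \int[mu]_(x in `[(i%:R * h)%R, (i.+1%:R * h)%R]) g x.
Proof.
move=> cg h0; elim: N => [|N IH]; first by rewrite mul0r set_itv1 Rintegral_set1 big_ord0.
rewrite big_ord_recr/= -IH (@Rintegral_split _ g 0 (N%:R * h))// ?mulr_ge0//.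
by rewrite ler_wpM2r// ler_nat.
Qed.

Lemma basis_le2 j (x : R) : (0 < j)%N -> `|phi j x| <= 2.
Proof.
have s2 : Num.sqrt 2 <= 2 :> R by have := @sqr_sqrt2 R; have := sqrtr_ge0 (2 : R); nra.
have s0 : 0 <= Num.sqrt 2 :> R by exact: sqrtr_ge0.
move=> j0; have [->|[m m0 ->]|[m m0 ->]] := trig_basisP j0.
- by rewrite /trig_basis/= normr1 ler1n.
- rewrite trig_basis_cos// normrM ger0_norm//.
  rewrite (le_trans _ s2)// ler_piMr// ler_norml; apply/andP; split; [exact: cos_geN1|exact: cos_le1].
- rewrite trig_basis_sin// normrM ger0_norm//.
  rewrite (le_trans _ s2)// ler_piMr// ler_norml; apply/andP; split; [exact: sin_geN1|exact: sin_le1].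
Qed.

Lemma basis_lipschitz j (x y : R) : (0 < j)%N -> x <= y ->
  `|phi j x - phi j y| <= 2 * freq j./2 * (y - x).
Proof.
move=> j0 xy; have cphi : {within `[x, y], continuous (phi j)}.
  by apply: continuous_subspaceT; exact: continuous_trig_basis.
rewrite distrC; have [E|[m m0 E]|[m m0 E]] := trig_basisP j0.
- by rewrite E /trig_basis/= subrr normr0 /freq !mulr0 mul0r.
- have [z _] := @MVT_segment R (phi j) (fun x => - freq m * phi m.*2.+1 x) x y xy
     (fun z _ => ltac:(rewrite E; exact: is_derive_basis_cos)) cphi.
  move=> ->; rewrite normrM [`|y - x|]ger0_norm ?subr_ge0// ler_wpM2r ?subr_ge0//.
  rewrite normrM normrN (ger0_norm (freq_ge0 m)) E doubleK mulrC ler_wpM2r ?freq_ge0//.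
  exact: basis_le2.
- have [z _] := @MVT_segment R (phi j) (fun x => freq m * phi m.*2 x) x y xy
     (fun z _ => ltac:(rewrite E; exact: is_derive_basis_sin)) cphi.
  move=> ->; rewrite normrM [`|y - x|]ger0_norm ?subr_ge0// ler_wpM2r ?subr_ge0//.
  rewrite normrM (ger0_norm (freq_ge0 m)) E /= uphalf_double mulrC ler_wpM2r ?freq_ge0//.
  by apply: basis_le2; rewrite double_gt0.
Qed.

End periodic_integrals.

Section mesh.
Context {R : realType}.
Local Notation mu := (@lebesgue_measure R).
Local Notation phi := (@trig_basis R).
Variable h : R.
Hypothesis h0 : 0 < h.

Definition cell (i : nat) : set R := `](i%:R * h), (i.+1%:R * h)]%classic.

Definition step_function (c : nat -> R) (N : nat) (s : R) : R := \sum_(i < N) c i * \1_(cell i) s.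

Lemma sum_cells N (s : R) : \sum_(i < N) \1_(cell i) s = (0 < s <= N%:R * h)%R%:R :> R.
Proof.
elim: N => [|N IH].
  by rewrite big_ord0 mul0r; case: ltP => //= s0; rewrite leNgt s0.
rewrite big_ord_recr/= IH indicE /cell mem_setE in_itv/=.
have hN : 0 <= N%:R * h by rewrite mulr_ge0// ltW.
have hS : N%:R * h <= N.+1%:R * h by rewrite ler_wpM2r ?ler_nat// ltW.
have [s1|s1] := ltP (N%:R * h) s.
  by rewrite andbF add0r (le_lt_trans hN s1).
by rewrite andbT/= addr0 (le_trans s1 hS) andbT.
Qed.

(** The sum of the cells is 1 at s, so the difference is an average of the
    differences f (i h) - f s over the cells containing s. *)
Lemma step_function_close (f : R -> R) (w : R) N (s : R) : 0 < s <= N%:R * h ->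
  (forall x y, x <= y -> `|f x - f y| <= w * (y - x)) -> 0 <= w ->
  `|step_function (fun i => f (i%:R * h)) N s - f s| <= w * h.
Proof.
move=> sN lf w0.
have E : \sum_(i < N) \1_(cell i) s = 1 :> R by rewrite sum_cells sN.
have -> : step_function (fun i => f (i%:R * h)) N s - f s =
    \sum_(i < N) (f (i%:R * h) - f s) * \1_(cell i) s.
  by under [RHS]eq_bigr do rewrite mulrBl; rewrite sumrB -mulr_sumr E mulr1.
apply: (@le_trans _ _ (\sum_(i < N) w * h * \1_(cell i) s)); last by rewrite -mulr_sumr E mulr1.
apply: le_trans (ler_norm_sum _ _ _) _.
apply: ler_sum => i _; rewrite normrM [`|\1__ _|]ger0_norm// indicE /cell mem_setE in_itv/=.
case: (boolP (i%:R * h < s <= i.+1%:R * h)) => [/andP[s1 s2]|_]; rewrite /= ?mulr0// !mulr1.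
apply: (le_trans (lf _ _ (ltW s1))); rewrite ler_wpM2l//.
by move: s2; rewrite -natr1; lra.
Qed.

Lemma L2_bounded (T b : R) (f : R -> R) : measurable_fun `[0, T] f ->
  (forall x, `|f x| <= b) -> L2fun T f.
Proof.
move=> mf fb; split => //.
apply: (@le_lt_trans _ _ (\int[mu]_(s in `[0%R, T]) (b ^+ 2)%:E)%E).
  apply: ge0_le_integral => //.
  - by move=> x _; rewrite lee_fin sqr_ge0.
  - by apply/measurable_EFinP; exact: measurable_funX.
  - move=> x _; rewrite lee_fin -(real_normK (num_real (f x))) lerXn2r ?nnegrE//.
    by rewrite (le_trans _ (fb x)).
rewrite integral_cst//= lebesgue_measure_itv; case: ifP => _; last by rewrite mule0.
by rewrite -EFinD -EFinM ltry.
Qed.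

Lemma L2_indic (T a b : R) : L2fun T (\1_(`]a, b]%classic : set R)).
Proof.
apply: (@L2_bounded _ 1); first by apply: measurable_funTS; exact: measurable_indic.
by move=> x; rewrite indicE; case: (_ \in _); rewrite ?normr1// normr0.
Qed.

Lemma L2D_scale (T c : R) (f g : R -> R) : L2fun T f -> L2fun T g -> L2fun T (fun s => c * f s + g s).
Proof.
move=> Lf Lg; rewrite (_ : (fun s => _) = fun s => g s - (- c) * f s); first exact: L2_sub_scale.
by apply/funext => s; ring.
Qed.

Lemma step_functionS c N :
  step_function c N.+1 = fun s => c N * \1_(cell N) s + step_function c N s.
Proof. by apply/funext => s; rewrite /step_function big_ord_recr addrC. Qed.

Lemma L2_step_function (T : R) c N : L2fun T (step_function c N).
Proof.
elim: N => [|N IH].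
  rewrite (_ : step_function c 0 = fun=> 0); last by apply/funext => s; rewrite /step_function big_ord0.
  by apply: L2_continuous; exact: continuous_cst_fun.
by rewrite step_functionS; apply: L2D_scale => //; exact: L2_indic.
Qed.

End mesh.

Section discretized_integral.
Context {R : realType} {n : nat}.
Local Notation D := (skorokhod R n).
Local Notation mu := (@lebesgue_measure R).
Variables (Q : probability D R) (I : (R -> R) -> D -> R).
Hypothesis hI : stochastic_integral Q I.
Variable h : R.
Hypothesis h0 : 0 < h.

(** Linearity of the stochastic integral, starting from the increments over the
    cells. *)
Lemma stochastic_integral_step c N : N%:R * h <= n%:R ->
  {ae Q, forall x, I (step_function h c N) x =
     \sum_(i < N) c i * (x (i.+1%:R * h) - x (i%:R * h))}.
Proof.
have [_ hind hlin _] := hI.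
have L0 : L2fun n%:R (fun=> 0 : R) by apply: L2_continuous; exact: continuous_cst_fun.
elim: N => [|N IH] hN.
  rewrite (_ : step_function h c 0 = fun=> 0); last by apply/funext => s; rewrite /step_function big_ord0.
  apply: filterS (hlin (-1) _ _ L0 L0) => x; rewrite (_ : (fun s => -1 * 0 + 0) = fun=> 0).
    by move=> E; rewrite big_ord0 E; ring.
  by apply/funext => s; ring.
have hN' : N%:R * h <= n%:R by apply: le_trans hN; rewrite ler_wpM2r ?ler_nat// ltW.
rewrite step_functionS.
have hNN : N%:R * h <= N.+1%:R * h by rewrite ler_wpM2r ?ler_nat// ltW.
have hi := hind (N%:R * h) (N.+1%:R * h) (mulr_ge0 (ler0n _ _) (ltW h0)) hNN hN.
have hl := hlin (c N) _ _ (L2_indic n%:R (N%:R * h) (N.+1%:R * h)) (L2_step_function h n%:R c N).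
apply: filterS3 (IH hN') hi hl => x E1 E2 E3.
by rewrite E3 E2 E1 big_ord_recr/= addrC.
Qed.

Lemma stochastic_integral_diff f g : L2fun n%:R f -> L2fun n%:R g ->
  {ae Q, forall x, I f x = I g x + I (fun s => f s - g s) x}.
Proof.
have [_ _ hlin _] := hI.
move=> Lf Lg; have Lh : L2fun n%:R (fun s => f s - g s).
  rewrite (_ : (fun s => _) = fun s => f s - 1 * g s); first exact: L2_sub_scale.
  by apply/funext => s; rewrite mul1r.
apply: filterS (hlin 1 _ _ Lg Lh) => x; rewrite mul1r (_ : (fun s => 1 * g s + (f s - g s)) = f)//.
by apply/funext => s; ring.
Qed.

End discretized_integral.

(** * Noise variances *)

Section second_moments.
Context d (T : measurableType d) {R : realType} (P : probability T R).

Lemma integral_affine_sqr (X : T -> R) (al be v : R) : measurable_fun setT X ->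
  ('E_P[X] = 0)%E -> (\int[P]_x (X x ^+ 2)%:E = v%:E)%E ->
  (\int[P]_x ((al + be * X x) ^+ 2)%:E = (al ^+ 2 + be ^+ 2 * v)%:E)%E.
Proof.
move=> mX; rewrite unlock => EX X2.
have iX2 : P.-integrable setT (EFin \o (fun x => X x ^+ 2)).
  apply/integrableP; split; first by apply/measurable_EFinP; exact: measurable_funX.
  under eq_integral do rewrite /= ger0_norm ?sqr_ge0//.
  by rewrite X2 ltry.
have ic (c : R) : P.-integrable setT (EFin \o (fun=> c)).
  by apply: finite_measure_integrable_cst.
have iX : P.-integrable setT (EFin \o X).
  apply: (@le_integrable _ _ _ P _ _ _ (fun x => (1%:E + (X x ^+ 2)%:E)%E)) => //.
  - by apply/measurable_EFinP.
  - move=> x _; rewrite /= lee_fin [leRHS]ger0_norm ?addr_ge0 ?sqr_ge0//.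
    by rewrite -(real_normK (num_real (X x))); have := normr_ge0 (X x); nra.
  - by apply: integrableD => //; exact: ic.
have ibX : P.-integrable setT (EFin \o (fun x => 2 * al * be * X x)).
  exact: (integrableZl measurableT (2 * al * be) iX).
have ibX2 : P.-integrable setT (EFin \o (fun x => be ^+ 2 * X x ^+ 2)).
  exact: (integrableZl measurableT (be ^+ 2) iX2).
have isum : P.-integrable setT (EFin \o (fun x => 2 * al * be * X x + be ^+ 2 * X x ^+ 2)).
  exact: (integrableD measurableT ibX ibX2).
transitivity (\int[P]_x ((al ^+ 2)%:E + ((2 * al * be * X x)%:E + (be ^+ 2 * X x ^+ 2)%:E)))%E.
  by apply: eq_integral => x _; rewrite -!EFinD; congr EFin; ring.
rewrite integralD//; last exact: ic.
rewrite integralD// prob_integral_cst.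
under eq_integral do rewrite EFinM.
rewrite integralZl// EX mule0 add0e.
under eq_integral do rewrite EFinM.
by rewrite integralZl// X2 -EFinM -EFinD.
Qed.

End second_moments.

Section noise_variances.
Context {R : realType} {n : nat}.
Local Notation D := (skorokhod R n).
Variables (Q : probability D R) (I : (R -> R) -> D -> R).
Local Notation v := (noise_coef_var Q I).

Lemma seq_card0 : seq_card (fun=> 0 : R) = 0%E.
Proof. by rewrite /seq_card; apply: eseries0 => j _ _; rewrite normr0 ltxx. Qed.

Lemma L2n_ge0 : (0 <= L2n Q I)%E.
Proof.
apply: (@le_trans _ _ ('E_Q[fun w => ((\sum_(j \in [set j | (1 <= j)%N])
                       (fun=> 0) j * ((noise_coef I j w) ^+ 2 - v j)) ^+ 2)%R])%E).
  by apply: expectation_ge0 => x; exact: sqr_ge0.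
rewrite /L2n; apply: ereal_sup_ubound; exists (fun=> 0) => //.
split; first by rewrite /seq_norm2 eseries0// => j _ _; rewrite expr0n.
by rewrite seq_card0 lee_fin.
Qed.

(** The sum of g_j (v_j - vs) is one of the sums in the supremum defining
    L_(1,n): its coefficients are in [-1, 1] and at most n of them are
    nonzero. *)
Lemma noise_variance_sum (vs l : R) (N : nat) (g : nat -> R) : (N.-1 <= n)%N ->
  (L1n Q I vs + L2n Q I <= l%:E)%E -> (forall j, 0 <= g j <= 1) ->
  \sum_(1 <= j < N) g j * v j <= vs * (\sum_(1 <= j < N) g j) + l.
Proof.
move=> Nn L12 g01.
have L1 : (L1n Q I vs <= l%:E)%E by apply: le_trans L12; rewrite leeDl// L2n_ge0.
pose x j := if (j < N)%N then g j else 0.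
suff : `|\sum_(j \in [set j | (1 <= j)%N]) x j * (v j - vs)| <= l.
  have -> : \sum_(j \in [set j | (1 <= j)%N]) x j * (v j - vs) =
      \sum_(1 <= j < N) x j * (v j - vs).
    rewrite (@fsbig_seq _ _ _ _ (index_iota 1 N)) ?iota_uniq//.
    apply/esym/fsbig_widen.
      by move=> j /=; rewrite mem_index_iota => /andP[].
    move=> j /= [j1]; rewrite mem_index_iota j1/= => /negP; rewrite -leqNgt => Nj.
    by rewrite /x ltnNge Nj mul0r.
  rewrite ler_norml => /andP[_]; rewrite -subr_ge0 => h.
  rewrite -subr_ge0; apply: le_trans h _; rewrite le_eqVlt; apply/orP; left; apply/eqP.
  have -> : \sum_(1 <= j < N) x j * (v j - vs) = \sum_(1 <= j < N) g j * v j - vs * \sum_(1 <= j < N) g j.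
    rewrite mulr_sumr -sumrB !big_nat; apply: eq_bigr => j /andP[_ jN].
    by rewrite /x jN; ring.
  ring.
rewrite -lee_fin; apply: le_trans L1; apply: ereal_sup_ubound; exists x => //; split.
  by move=> j _; rewrite /x; case: ifP => _; have := g01 j; lra.
rewrite /seq_card; apply: lime_le.
  by apply: is_cvg_nneseries => j _ _; rewrite lee_fin.
apply: nearW => K; rewrite sumEFin lee_fin.
apply: (@le_trans _ _ (\sum_(1 <= j < K) (j < N)%:R)).
  apply: ler_sum => j _; rewrite /x; case: ifP => // _; first by case: (_ < _).
  by rewrite normr0 ltxx.
rewrite -natr_sum ler_nat (leq_trans _ Nn)//.
elim: K => [|K IH]; first by rewrite big_geq.
case: K IH => [|K] IH; first by rewrite big_geq.
have aux (m : nat) : (\sum_(1 <= j < m.+1) (j < N) = minn m N.-1)%N.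
  elim: m => [|m IHm]; first by rewrite big_geq// min0n.
  by rewrite big_nat_recr//= IHm; case: ltnP; lia.
by rewrite aux geq_minr.
Qed.

End noise_variances.

(** * The filtered estimator *)

Section estimator.
Context {R : realType} {n : nat}.
Local Notation D := (skorokhod R n).
Local Notation mu := (@lebesgue_measure R).
Local Notation phi := (@trig_basis R).

Definition pinsker_filter (k M j : nat) : R := 1 - (freq j./2 / freq M) ^+ k.

(** The Riemann sum of n^-1 int_0^n phi_j dy over the mesh i h: a combination
    of coordinates of the path, hence a measurable function of the
    observation. *)
Definition empirical_coef (h : R) (N : nat) (y : D) (j : nat) : R :=
  n%:R^-1 * \sum_(i < N) phi j (i%:R * h) * (y (i.+1%:R * h) - y (i%:R * h)).

Definition pinsker_estimator (k M : nat) (h : R) (N : nat) (y : D) : R -> R :=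
  tpoly (index_iota 1 M.*2) (fun j => pinsker_filter k M j * empirical_coef h N y j).

Lemma measurable_empirical_coef h N j : measurable_fun setT (fun y => empirical_coef h N y j).
Proof.
apply: measurable_funM => //; apply: measurable_sum => i; apply: measurable_funM => //.
by apply: measurable_funB; exact: measurable_coordinate.
Qed.

Lemma estimators_pinsker k M h N : estimators (pinsker_estimator k M h N).
Proof.
apply: measurable_funTS; apply: measurable_sum => j; apply: measurable_funM.
- apply: measurable_funM => //.
  by apply: (@measurableT_comp _ _ _ _ _ _ (fun y => empirical_coef h N y j)) => //;
    exact: measurable_empirical_coef.
- by apply: measurableT_comp => //; apply: continuous_measurable; exact: continuous_trig_basis.
Qed.

Lemma pinsker_filter_itv k M j : (0 < M)%N -> (j < M.*2)%N -> 0 <= pinsker_filter k M j <= 1.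
Proof.
move=> M0 jM; rewrite /pinsker_filter.
have h0 : 0 <= freq j./2 / freq M :> R by rewrite divr_ge0 ?freq_ge0.
have h1 : freq j./2 / freq M <= 1 :> R.
  by rewrite ler_pdivrMr ?freq_gt0// mul1r le_freq//; lia.
have := exprn_ge0 k h0; have := exprn_ile1 k h0 h1; lra.
Qed.

Lemma increment_split (S : R -> R) (x : D) a b : continuous S -> 0 <= a -> a <= b -> b <= n%:R ->
  observation S x b - observation S x a = \int[mu]_(s in `[a, b]) S s + (x b - x a).
Proof.
move=> cS a0 ab bn; have iS := @continuous_integrable R S 0 n%:R cS.
rewrite !observationE//; last 2 first.
- by rewrite a0 (le_trans ab).
- by rewrite bn (le_trans a0).
by rewrite -(driftB cS a0 ab) /drift; ring.
Qed.

(** Over n periods the mean of S phi_j is its Fourier coefficient, and on a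
    cell phi_j varies by at most 2 freq h; |S| is dominated by 1 + S^2. *)
Lemma drift_coef_error (S : R -> R) (h : R) (N j : nat) : (0 < n)%N -> 0 < h ->
  N%:R * h = n%:R -> (0 < j)%N -> continuous S -> (forall t, S (t + 1) = S t) ->
  `|n%:R^-1 * (\sum_(i < N) phi j (i%:R * h) *
        \int[mu]_(s in `[(i%:R * h)%R, (i.+1%:R * h)%R]) S s) - ip S (phi j)| <=
  2 * freq j./2 * h * (1 + ip S S).
Proof.
move=> n0 h0 Nh j0 cS pS; have nR : 0 < n%:R :> R by rewrite ltr0n.
have cphi := @continuous_trig_basis R j.
have cSp := continuousM_fun cS cphi.
have cS2 : continuous (fun t => 1 + S t * S t).
  by apply: continuousD_fun; [exact: continuous_cst_fun|exact: continuousM_fun].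
have E1 : ip S (phi j) = n%:R^-1 * \sum_(i < N)
    \int[mu]_(s in `[(i%:R * h)%R, (i.+1%:R * h)%R]) (S s * phi j s).
  rewrite -(Rintegral_mesh N cSp (ltW h0)) Nh periodic_integral//.
    by rewrite mulKf// gt_eqF.
  by move=> x; rewrite pS trig_basis_periodic.
have E2 : 1 + ip S S = n%:R^-1 * \sum_(i < N)
    \int[mu]_(s in `[(i%:R * h)%R, (i.+1%:R * h)%R]) (1 + S s * S s).
  rewrite -(Rintegral_mesh N cS2 (ltW h0)) Nh periodic_integral//.
    rewrite mulKf ?gt_eqF// int01D; [|exact: continuous_cst_fun|exact: continuousM_fun].
    by congr (_ + _); rewrite /int01 Rintegral_itv_cst// subr0 mulr1.
  by move=> x; rewrite pS.
rewrite E1 E2 -mulrBr -sumrB normrM gtr0_norm ?invr_gt0// mulrCA ler_pM2l ?invr_gt0//.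
rewrite mulr_sumr; apply: le_trans (ler_norm_sum _ _ _) _; apply: ler_sum => i _.
set u := i%:R * h; have uv : u <= i.+1%:R * h by rewrite /u ler_wpM2r ?ler_nat// ltW.
have cd : continuous (fun s => phi j u * S s + (-1) * (S s * phi j s)).
  by apply: continuousD_fun; exact: continuousZ_fun.
have -> : phi j u * \int[mu]_(s in `[u, (i.+1%:R * h)%R]) S s -
    \int[mu]_(s in `[u, (i.+1%:R * h)%R]) (S s * phi j s) =
    \int[mu]_(s in `[u, (i.+1%:R * h)%R]) (phi j u * S s + (-1) * (S s * phi j s)).
  rewrite RintegralD//; last 2 first.
  - by apply: continuous_integrable; exact: continuousZ_fun.
  - by apply: continuous_integrable; exact: continuousZ_fun.
  rewrite !RintegralZl// ?mulN1r//; exact: continuous_integrable.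
rewrite -RintegralZl//; last exact: continuous_integrable.
have wf0 : 0 <= 2 * freq j./2 :> R by rewrite mulr_ge0 ?freq_ge0.
have w0 : 0 <= 2 * freq j./2 * h by rewrite mulr_ge0// (ltW h0).
apply: le_trans (le_normr_Rintegral _ _) _ => //; first exact: continuous_integrable.
apply: le_Rintegral => //.
- by apply: continuous_integrable => s; apply: cvg_norm; exact: cd.
- by apply: continuous_integrable; exact: continuousZ_fun.
move=> s /=; rewrite in_itv/= => /andP[us sv].
have -> : phi j u * S s + (-1) * (S s * phi j s) = (phi j u - phi j s) * S s by ring.
rewrite normrM; apply: ler_pM => //.
  apply: (le_trans (basis_lipschitz j0 us)).
  rewrite ler_wpM2l//.
  by move: sv; rewrite /u -natr1; lra.
rewrite -expr2 -(real_normK (num_real (S s))); have := normr_ge0 (S s); nra.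
Qed.

(** The integrand is the difference of phi_j and its step approximation, of
    size at most 2 freq h, and the second moment of the stochastic integral is
    controlled by the energy of its integrand. *)
Lemma discretization_moment (Q : probability D R) (I : (R -> R) -> D -> R) (sig h : R) (N j : nat) :
  0 < h -> N%:R * h = n%:R -> (0 < j)%N -> 0 <= sig ->
  (forall f, L2fun n%:R f -> ('E_Q[fun w => ((I f w) ^+ 2)%R]
          <= sig%:E * \int[mu]_(s in `[0%R, n%:R]) ((f s) ^+ 2)%:E)%E) ->
  (\int[Q]_x ((I (fun s => step_function h (fun i => phi j (i%:R * h)) N s - phi j s) x) ^+ 2)%:E <=
   (sig * (n%:R * (2 * freq j./2 * h) ^+ 2))%:E)%E.
Proof.
move=> h0 Nh j0 sig0 hm.
set f := fun s => _ - _.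
have Lf : L2fun n%:R f.
  rewrite (_ : f = fun s => step_function h (fun i => phi j (i%:R * h)) N s - 1 * phi j s).
    by apply: L2_sub_scale; [exact: L2_step_function|exact: L2_trig_basis].
  by apply/funext => s; rewrite mul1r.
have := hm f Lf; rewrite unlock => /le_trans; apply.
rewrite EFinM lee_wpmul2l//.
have [mf _] := Lf.
have mf2 : measurable_fun `](0 : R), n%:R] (fun s => (f s ^+ 2)%:E).
  apply/measurable_EFinP; apply: measurable_funX; apply: measurable_funS mf => //.
  by apply: subset_itv; rewrite bnd_simp.
rewrite -integral_itv_obnd_cbnd//.
set w := 2 * freq j./2.
have w0 : 0 <= w by rewrite mulr_ge0 ?freq_ge0.
apply: (@le_trans _ _ (\int[mu]_(s in `]0%R, n%:R]) ((w * h) ^+ 2)%:E)%E).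
  apply: ge0_le_integral => //.
  - by move=> s _; rewrite lee_fin sqr_ge0.
  - move=> s /=; rewrite in_itv/= -Nh => sN; rewrite lee_fin.
    rewrite -(real_normK (num_real (f s))) lerXn2r ?nnegrE//.
      by rewrite mulr_ge0// ltW.
    by apply: step_function_close => // x y xy; exact: basis_lipschitz.
rewrite integral_cst//= lebesgue_measure_itv/= lte_fin; case: ifP => _.
  by rewrite oppr0 adde0 -EFinM lee_fin mulrC.
by rewrite mule0 lee_fin mulr_ge0 ?sqr_ge0.
Qed.

End estimator.

(** * Risk of the filtered estimator *)

Section pinsker_risk.
Context {R : realType} {n : nat}.
Local Notation D := (skorokhod R n).
Local Notation mu := (@lebesgue_measure R).
Local Notation phi := (@trig_basis R).

Lemma norm2_tpoly_sub (S : R -> R) s (c : nat -> R) : continuous S -> uniq s ->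
  all (fun j => 0 < j)%N s ->
  norm2 (fun t => tpoly s c t - S t) =
  (\sum_(j <- s) (c j - ip S (phi j)) ^+ 2 + (ip S S - \sum_(j <- s) ip S (phi j) ^+ 2))%:E.
Proof.
move=> cS us s0; rewrite -(tpoly_pythagoras c (L2_continuous 1 cS) us s0).
have cT : continuous (tpoly s c) by exact: continuous_tpoly.
rewrite norm2E; last by apply: L2_continuous; apply: continuousD_fun => //; exact: continuousN_fun.
by congr EFin; apply: eq_Rintegral => t _; ring.
Qed.

Lemma half_freq_scaled (h : R) j M : 0 <= h -> (j < M.*2)%N ->
  0 <= 2 * freq j./2 * h <= 2 * freq M * h.
Proof.
move=> h0 jM; have f0 := @freq_ge0 R j./2.
have fM : freq j./2 <= freq M :> R by apply: le_freq; lia.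
have f2 : 0 <= 2 * freq j./2 :> R by rewrite mulr_ge0.
by rewrite (mulr_ge0 f2 h0)/= ler_wpM2r// ler_wpM2l.
Qed.

Lemma sqrD_le (eta a b : R) : 0 < eta -> (a + b) ^+ 2 <= (1 + eta) * a ^+ 2 + (1 + eta^-1) * b ^+ 2.
Proof.
move=> e0; rewrite -subr_ge0.
rewrite (_ : _ - _ = eta^-1 * (eta * a - b) ^+ 2); last by field; rewrite gt_eqF.
by rewrite mulr_ge0 ?sqr_ge0// invr_ge0 ltW.
Qed.

Variables (Q : probability D R) (I : (R -> R) -> D -> R).
Hypothesis hI : stochastic_integral Q I.

(** The stochastic integral of the step function, written as I (phi_j) plus
    the integral of the discretization error. *)
Lemma empirical_coef_observation (S : R -> R) (h : R) (N : nat) : (0 < n)%N -> 0 < h ->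
  N%:R * h = n%:R -> continuous S ->
  {ae Q, forall x, forall j,
    empirical_coef h N (observation S x) j =
    n%:R^-1 * (\sum_(i < N) phi j (i%:R * h) *
        \int[mu]_(s in `[(i%:R * h)%R, (i.+1%:R * h)%R]) S s) +
    n%:R^-1 * (I (phi j) x +
      I (fun s => step_function h (fun i => phi j (i%:R * h)) N s - phi j s) x)}.
Proof.
move=> n0 h0 Nh cS; apply: ae_foralln => j.
have Nn : N%:R * h <= n%:R by rewrite Nh.
have Lf := L2_step_function h n%:R (fun i => phi j (i%:R * h)) N.
apply: filterS2 (stochastic_integral_step hI h0 (fun i => phi j (i%:R * h)) Nn)
  (stochastic_integral_diff hI Lf (@L2_trig_basis R n%:R j)) => x E1 E2.
rewrite -E2 E1 -mulrDr /empirical_coef -big_split/=; congr (_ * _); apply: eq_bigr => i _.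
rewrite -mulrDr increment_split//.
- by rewrite mulr_ge0// ltW.
- by rewrite ler_wpM2r ?ler_nat// ltW.
- by rewrite -Nh ler_wpM2r ?ler_nat// ltW.
Qed.

Variables (vs vs_up sig sig_up l : R).
Hypothesis moments : forall f, L2fun n%:R f ->
  ('E_Q[I f] = 0 /\ 'E_Q[fun w => ((I f w) ^+ 2)%R]
          <= sig%:E * \int[mu]_(s in `[0%R, n%:R]) ((f s) ^+ 2)%:E)%E.
Hypotheses (sig_ge0 : 0 <= sig) (sig_le : sig <= sig_up) (vs_le : vs <= vs_up).
Hypothesis L12 : (L1n Q I vs + L2n Q I <= l%:E)%E.

Lemma noise_second_moment j : (0 < n)%N ->
  (\int[Q]_x ((I (phi j) x) ^+ 2)%:E = (n%:R * noise_coef_var Q I j)%:E)%E.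
Proof.
move=> n0; have nR : 0 < n%:R :> R by rewrite ltr0n.
have Lp := @L2_trig_basis R n%:R j.
have mI : measurable_fun setT (I (phi j)) by case: hI => + _ _ _; exact.
have [_] := moments Lp; rewrite unlock => h.
have m0 : (0 <= \int[Q]_x ((I (phi j) x) ^+ 2)%:E)%E.
  by apply: integral_ge0 => x _; rewrite lee_fin sqr_ge0.
have fin : (\int[Q]_x ((I (phi j) x) ^+ 2)%:E \is a fin_num)%E.
  rewrite ge0_fin_numE//; apply: le_lt_trans h _.
  by case: Lp => _ /lte_mul_pinfty; apply; rewrite ?lee_fin.
rewrite /noise_coef_var unlock /noise_coef.
have -> : (\int[Q]_x (((Num.sqrt n%:R)^-1 * I (phi j) x) ^+ 2)%:E =
   (n%:R^-1)%:E * \int[Q]_x ((I (phi j) x) ^+ 2)%:E)%E.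
  rewrite -ge0_integralZl//; last 2 first.
  - by apply/measurable_EFinP; exact: measurable_funX.
  - by move=> x _; rewrite lee_fin sqr_ge0.
  by apply: eq_integral => x _; rewrite -EFinM exprMn exprVn sqr_sqrtr.
by rewrite fineM// mulrA /= divff ?gt_eqF// mul1r fineK.
Qed.

(** For each j the error splits into A_j = (g_j - 1) theta_j + g_j I(phi_j) / n,
    whose mean square is the squared bias plus the variance, and the
    discretization errors e_j (drift) and Z_j (noise), separated from A_j with
    the weights 1 + eta and 1 + 1/eta. *)
Lemma pinsker_estimator_risk k r M N (h eta : R) (S : R -> R) : (0 < n)%N -> (0 < k)%N ->
  (0 < M)%N -> (M.*2.-1 <= n)%N -> 0 < h -> N%:R * h = n%:R -> 0 < eta -> sobolev k r S ->
  (risk Q (pinsker_estimator k M h N) S <=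
   ((1 + eta) * (r / freq M ^+ (2 * k) +
        (vs_up * (\sum_(1 <= j < M.*2) pinsker_filter k M j ^+ 2) + l) / n%:R) +
    (1 + eta^-1) * (M.*2%:R * (2 * (2 * freq M * h * (1 + r)) ^+ 2 +
        2 * sig_up * (2 * freq M * h) ^+ 2 / n%:R)))%:E)%E.
Proof.
move=> n0 k0 M0 Mn h0 Nh e0 bS; have nR : 0 < n%:R :> R by rewrite ltr0n.
have cS := sobolev_continuous bS; have rS := sobolev_L2_energy bS.
have pS : forall t, S (t + 1) = S t by case: bS => -[].
have r0 : 0 <= r by apply: le_trans rS; exact: ip_ge0.
set s := index_iota 1 M.*2; set g := pinsker_filter k M.
have us : uniq s by exact: iota_uniq.
have s0 : all (fun j => 0 < j)%N s by exact: index_iota_gt0.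
have g01 j : j \in s -> 0 <= g j <= 1.
  by rewrite mem_index_iota => /andP[_ jM]; exact: pinsker_filter_itv.
pose th j := ip S (phi j).
pose Dj j := n%:R^-1 * (\sum_(i < N) phi j (i%:R * h) *
        \int[mu]_(s in `[(i%:R * h)%R, (i.+1%:R * h)%R]) S s).
pose e j := Dj j - th j.
pose X j := I (phi j).
pose fj j := fun t => step_function h (fun i => phi j (i%:R * h)) N t - phi j t.
pose Z j := I (fj j).
have Lf j : L2fun n%:R (fj j).
  rewrite (_ : fj j = fun t => step_function h (fun i => phi j (i%:R * h)) N t - 1 * phi j t).
    by apply: L2_sub_scale; [exact: L2_step_function|exact: L2_trig_basis].
  by apply/funext => t; rewrite mul1r.
have mX j : measurable_fun setT (X j) by case: hI => + _ _ _; apply; exact: L2_trig_basis.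
have mZ j : measurable_fun setT (Z j) by case: hI => + _ _ _; apply; exact: Lf.
set ep := 2 * freq M * h.
have [ep0 wep] : 0 <= ep /\ forall j, j \in s -> 0 <= 2 * freq j./2 * h <= ep.
  split; first by have /andP[/le_trans] := half_freq_scaled (ltW h0) (ltac:(by rewrite double_gt0) : 0 < M.*2)%N; apply.
  by move=> j; rewrite mem_index_iota => /andP[_ jM]; exact: half_freq_scaled (ltW h0) jM.
clearbody ep.
have ee j : j \in s -> e j ^+ 2 <= (ep * (1 + r)) ^+ 2.
  move=> js; have j0 : (0 < j)%N by exact: (allP s0).
  rewrite -(real_normK (num_real (e j))) lerXn2r ?nnegrE ?mulr_ge0 ?addr_ge0//.
  apply: le_trans (drift_coef_error n0 h0 Nh j0 cS pS) _.
  have /andP[w0 w1] := wep j js.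
  by apply: ler_pM => //; rewrite ?addr_ge0 ?ip_ge0// lerD2l.
have eZ j : j \in s -> (\int[Q]_x ((Z j x) ^+ 2)%:E <= (sig_up * (n%:R * ep ^+ 2))%:E)%E.
  move=> js; have j0 : (0 < j)%N by exact: (allP s0).
  apply: le_trans (discretization_moment h0 Nh j0 sig_ge0 (fun f Lf => (moments Lf).2)) _.
  have /andP[w0 w1] := wep j js.
  rewrite lee_fin; apply: ler_pM => //; first by rewrite mulr_ge0// sqr_ge0.
  by rewrite ler_wpM2l// lerXn2r ?nnegrE.
pose v j := noise_coef_var Q I j.
pose A j := fun x : D => (g j - 1) * th j + g j / n%:R * X j x.
have eA j : (\int[Q]_x ((A j x) ^+ 2)%:E = ((1 - g j) ^+ 2 * th j ^+ 2 + g j ^+ 2 * v j / n%:R)%:E)%E.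
  rewrite (integral_affine_sqr _ _ (mX j) (moments (@L2_trig_basis R n%:R j)).1 (noise_second_moment j n0)).
  by congr EFin; rewrite /v; field; rewrite gt_eqF.
set tail := ip S S - \sum_(j <- s) th j ^+ 2.
have tail0 : 0 <= tail by rewrite subr_ge0; apply: bessel => //; exact: L2_continuous.
pose b1 := 2 * (ep * (1 + r)) ^+ 2; have b10 : 0 <= b1 by rewrite mulr_ge0 ?sqr_ge0.
have e1 : 0 <= 1 + eta by rewrite addr_ge0// ltW.
have e2 : 0 <= 1 + eta^-1 by rewrite addr_ge0// invr_ge0 ltW.
pose V j := fun x : D => (((1 + eta)%:E * ((A j x) ^+ 2)%:E +
    ((1 + eta^-1) * b1)%R%:E) + ((1 + eta^-1) * (2 / n%:R ^+ 2))%R%:E * ((Z j x) ^+ 2)%:E)%E.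
have c20 : 0 <= (1 + eta^-1) * (2 / n%:R ^+ 2) by rewrite mulr_ge0// divr_ge0// sqr_ge0.
have V0 j x : (0 <= V j x)%E.
  by apply: adde_ge0; [apply: adde_ge0|]; rewrite -?EFinM lee_fin; apply: mulr_ge0 => //; exact: sqr_ge0.
have mA2 j : measurable_fun setT (fun x => ((A j x) ^+ 2)%:E).
  by apply/measurable_EFinP; apply: measurable_funX; apply: measurable_funD => //; exact: measurable_funM.
have mZ2 j : measurable_fun setT (fun x => ((Z j x) ^+ 2)%:E).
  by apply/measurable_EFinP; exact: measurable_funX.
have mV j : measurable_fun setT (V j).
  by apply: emeasurable_funD; [apply: emeasurable_funD => //|]; exact: measurable_funeM.
have intV j : j \in s -> (\int[Q]_x V j x <= ((1 + eta) * ((1 - g j) ^+ 2 * th j ^+ 2 + g j ^+ 2 * v j / n%:R)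
    + (1 + eta^-1) * (b1 + 2 * sig_up * ep ^+ 2 / n%:R))%:E)%E.
  move=> js; rewrite /V.
  pose F1 x := ((1 + eta)%:E * ((A j x) ^+ 2)%:E)%E.
  pose F2 (x : D) := (((1 + eta^-1) * b1)%R%:E : \bar R).
  pose F3 x := (((1 + eta^-1) * (2 / n%:R ^+ 2))%R%:E * ((Z j x) ^+ 2)%:E)%E.
  have F10 x : [set: D] x -> (0 <= F1 x)%E by move=> _; rewrite /F1 -EFinM lee_fin mulr_ge0 ?sqr_ge0.
  have F20 x : [set: D] x -> (0 <= F2 x)%E by move=> _; rewrite lee_fin mulr_ge0.
  have F30 x : [set: D] x -> (0 <= F3 x)%E by move=> _; rewrite /F3 -EFinM lee_fin mulr_ge0 ?sqr_ge0.
  have F120 x : [set: D] x -> (0 <= F1 x + F2 x)%E by move=> hx; rewrite adde_ge0 ?F10 ?F20.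
  have mF1 : measurable_fun setT F1 by exact: measurable_funeM.
  have mF2 : measurable_fun setT F2 by exact: measurable_cst.
  have mF3 : measurable_fun setT F3 by exact: measurable_funeM.
  have mF12 : measurable_fun setT (fun x => F1 x + F2 x)%E by exact: emeasurable_funD.
  rewrite (ge0_integralD Q measurableT F120 mF12 F30 mF3) (ge0_integralD Q measurableT F10 mF1 F20 mF2).
  rewrite /F1 /F2 /F3 {F1 F2 F3 F10 F20 F30 F120 mF1 mF2 mF3 mF12}.
  rewrite ge0_integralZl//; last by move=> x _; rewrite lee_fin sqr_ge0.
  rewrite ge0_integralZl//; last by move=> x _; rewrite lee_fin sqr_ge0.
  rewrite prob_integral_cst eA -EFinM -EFinD.
  apply: (@le_trans _ _ (((1 + eta) * ((1 - g j) ^+ 2 * th j ^+ 2 + g j ^+ 2 * v j / n%:R) +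
     (1 + eta^-1) * b1)%:E + ((1 + eta^-1) * (2 / n%:R ^+ 2))%:E * (sig_up * (n%:R * ep ^+ 2))%:E)%E).
    by rewrite leeD2l// lee_wpmul2l ?lee_fin//; exact: eZ.
  rewrite -EFinM -EFinD lee_fin -addrA lerD2l [leRHS]mulrDr lerD2l.
  rewrite le_eqVlt; apply/orP; left; apply/eqP; field.
  by rewrite !gt_eqF.
have cT (c : nat -> R) : continuous (tpoly s c) by exact: continuous_tpoly.
apply: (@le_trans _ _ (\int[Q]_x (\sum_(j <- s) V j x + tail%:E))%E).
  rewrite /risk; apply: ae_ge0_le_integral => //.
  - by move=> x _; apply: integral_ge0 => t _; rewrite lee_fin sqr_ge0.
  - apply: (@measurableT_comp _ _ _ _ _ _ (fun y => norm2 (fun t0 => pinsker_estimator k M h N y t0 - S t0))).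
      by apply: measurable_loss => //; exact: estimators_pinsker.
    exact: measurable_observation.
  - by move=> x _; apply: adde_ge0; [apply: sume_ge0 => j _; exact: V0|rewrite lee_fin].
  - by apply: emeasurable_funD => //; apply: emeasurable_sum => j; exact: mV.
  apply: filterS (empirical_coef_observation n0 h0 Nh cS) => x hx _.
  rewrite /pinsker_estimator norm2_tpoly_sub// EFinD leeD2r// -sumEFin.
  rewrite big_seq [leRHS]big_seq; apply: lee_sum => j js.
  have /andP[g0 g1] := g01 j js.
  have -> : pinsker_filter k M j * empirical_coef h N (observation S x) j - ip S (phi j) =
     A j x + g j * (e j + n%:R^-1 * Z j x).
    by rewrite (hx j) -/(Dj j) -/(X j) /A /e /th -/(g j) -/(fj j) -/(Z j); field; rewrite gt_eqF.
  apply: (@le_trans _ _ ((1 + eta) * A j x ^+ 2 + (1 + eta^-1) *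
     (2 * e j ^+ 2 + 2 * (n%:R^-1 * Z j x) ^+ 2))%:E).
    rewrite lee_fin; apply: le_trans (sqrD_le _ _ e0) _; rewrite lerD2l ler_wpM2l//.
    set y := _ * Z j x; apply: (@le_trans _ _ ((e j + y) ^+ 2)).
      by rewrite exprMn ler_piMl ?sqr_ge0// exprn_ile1.
    by rewrite -subr_ge0 (_ : _ - _ = (e j - y) ^+ 2) ?sqr_ge0//; ring.
  rewrite /V -!EFinM -!EFinD lee_fin -addrA lerD2l mulrDr lerD//.
    by rewrite ler_wpM2l// /b1 ler_wpM2l//; exact: ee.
  by rewrite exprMn exprVn !mulrA.
rewrite ge0_integralD//; last 2 first.
- by move=> x _; apply: sume_ge0 => j _; exact: V0.
- by apply: emeasurable_sum => j; exact: mV.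
rewrite prob_integral_cst ge0_integral_sum//.
have sumV : (\sum_(j <- s) \int[Q]_x V j x <= (\sum_(j <- s)
   ((1 + eta) * ((1 - g j) ^+ 2 * th j ^+ 2 + g j ^+ 2 * v j / n%:R)
    + (1 + eta^-1) * (b1 + 2 * sig_up * ep ^+ 2 / n%:R)))%:E)%E.
  rewrite -sumEFin big_seq [leRHS]big_seq; apply: lee_sum => j js; exact: intV.
apply: le_trans (leeD2r _ sumV) _.
rewrite -EFinD lee_fin big_split/= -mulr_sumr big_split/= -mulr_suml.
have hv : \sum_(j <- s) g j ^+ 2 * v j <= vs_up * (\sum_(j <- s) g j ^+ 2) + l.
  pose g' j := if (j < M.*2)%N then g j ^+ 2 else 0.
  have Eg (F : nat -> R) : \sum_(j <- s) g j ^+ 2 * F j = \sum_(1 <= j < M.*2) g' j * F j.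
    by rewrite /s !big_nat; apply: eq_bigr => j /andP[_ jM]; rewrite /g' jM.
  have Eg1 : \sum_(j <- s) g j ^+ 2 = \sum_(1 <= j < M.*2) g' j.
    by rewrite /s !big_nat; apply: eq_bigr => j /andP[_ jM]; rewrite /g' jM.
  rewrite Eg Eg1; have g'0 : forall j, 0 <= g' j <= 1.
    move=> j; rewrite /g'; case: ifP => jM; last by rewrite lexx ler01.
    have /andP[a1 a2] : 0 <= g j <= 1 by exact: pinsker_filter_itv.
    by rewrite sqr_ge0 exprn_ile1.
  apply: le_trans (noise_variance_sum Mn L12 g'0) _; rewrite lerD2r ler_wpM2r//.
  by apply: sumr_ge0 => j _; have /andP[] := g'0 j.
have htail := sobolev_tail k0 M0 bS.
have hb : \sum_(j <- s) (1 - g j) ^+ 2 * th j ^+ 2 + tail <= r / freq M ^+ (2 * k).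
  apply: le_trans htail; rewrite lerD2r le_eqVlt; apply/orP; left; apply/eqP.
  apply: eq_bigr => j _; rewrite /g /pinsker_filter opprB addrCA subrr addr0.
  by rewrite -exprM mulnC.
have hc : \sum_(j <- s) (1 + eta^-1) * (b1 + 2 * sig_up * ep ^+ 2 / n%:R) <=
    (1 + eta^-1) * (M.*2%:R * (b1 + 2 * sig_up * ep ^+ 2 / n%:R)).
  have CE (C : R) : \sum_(j <- s) C = (M.*2 - 1)%:R * C by rewrite sumr_const_nat mulr_natl.
  rewrite CE [leRHS]mulrCA ler_wpM2r//.
    rewrite mulr_ge0//.
    by rewrite addr_ge0// divr_ge0// !mulr_ge0 ?sqr_ge0// (le_trans sig_ge0).
  by rewrite ler_nat leq_subr.
set P1 := \sum_(j <- s) (1 - g j) ^+ 2 * th j ^+ 2 in hb *.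
set P2 := \sum_(j <- s) g j ^+ 2 * v j in hv *.
set P3 := \sum_(j <- s) (1 + eta^-1) * _ in hc *.
have hv' : P2 / n%:R <= (vs_up * (\sum_(j <- s) g j ^+ 2) + l) / n%:R.
  by rewrite ler_pM2r// invr_gt0.
have h1 : (1 + eta) * (P1 + P2 / n%:R) + tail <= (1 + eta) * (r / freq M ^+ (2 * k) +
    (vs_up * (\sum_(j <- s) g j ^+ 2) + l) / n%:R).
  apply: (@le_trans _ _ ((1 + eta) * (P1 + P2 / n%:R + tail))).
    by rewrite [leRHS]mulrDr lerD2l ler_peMl// lerDl ltW.
  by rewrite ler_wpM2l//; lra.
rewrite addrAC; apply: lerD => //.
Qed.

End pinsker_risk.

(** * Sums of filters *)

Section power_sums.
Context {R : realType}.

Lemma subrX_bounds k (x y : R) : 0 <= y -> y <= x ->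
  k.+1%:R * y ^+ k * (x - y) <= x ^+ k.+1 - y ^+ k.+1 <= k.+1%:R * x ^+ k * (x - y).
Proof.
move=> y0 yx; have x0 : 0 <= x by apply: le_trans yx.
have d0 : 0 <= x - y by rewrite subr_ge0.
rewrite subrXX [(x - y) * _]mulrC; apply/andP; split; apply: ler_wpM2r => //.
- rewrite mulr_natl -[k.+1 in leLHS]card_ord -sumr_const; apply: ler_sum => i _.
  rewrite -[X in y ^+ X](@subnK i k) ?exprD//; last by rewrite -ltnS.
  rewrite ler_wpM2r ?exprn_ge0// lerXn2r ?nnegrE//.
- rewrite mulr_natl -[k.+1 in leRHS]card_ord -sumr_const; apply: ler_sum => i _.
  rewrite -[X in x ^+ X](@subnK i k) ?exprD//; last by rewrite -ltnS.
  rewrite ler_wpM2l ?exprn_ge0// lerXn2r ?nnegrE//.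
Qed.

Lemma power_sum_le k M : \sum_(0 <= m < M) m%:R ^+ k <= M%:R ^+ k.+1 / k.+1%:R :> R.
Proof.
rewrite ler_pdivlMr//; elim: M => [|M IH]; first by rewrite big_geq// mul0r exprn_ge0.
rewrite big_nat_recr//= mulrDl.
have /andP[h _] := @subrX_bounds k M.+1%:R M%:R (ler0n _ _) (ltac:(by rewrite ler_nat)).
rewrite -[in X in _ * (X - _)]natr1 addrAC subrr add0r mulr1 in h.
by rewrite [M%:R ^+ k * _]mulrC; lra.
Qed.

Lemma power_sum_ge k M : M%:R ^+ k.+1 / k.+1%:R - M%:R ^+ k <= \sum_(0 <= m < M) m%:R ^+ k :> R.
Proof.
suff : M%:R ^+ k.+1 / k.+1%:R <= \sum_(0 <= m < M.+1) m%:R ^+ k :> R.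
  by rewrite big_nat_recr//= lerBlDr.
rewrite ler_pdivrMr//; elim: M => [|M IH].
  rewrite expr0n mulr_ge0//; apply: sumr_ge0 => m _; exact: exprn_ge0.
rewrite big_nat_recr//= mulrDl.
have /andP[_ h] := @subrX_bounds k M.+1%:R M%:R (ler0n _ _) (ltac:(by rewrite ler_nat)).
rewrite -[in X in _ * (X - _)]natr1 addrAC subrr add0r mulr1 in h.
by rewrite [M.+1%:R ^+ k * _]mulrC; lra.
Qed.

Lemma freq_ratio m M : (0 < M)%N -> freq m / freq M = m%:R / M%:R :> R.
Proof.
move=> M0; have p2 : 2 * pi != 0 :> R by rewrite mulf_neq0// gt_eqF// pi_gt0.
by rewrite /freq -mulf_div divff// mul1r.
Qed.

(** The sum of (1 - x^k)^2 over x = m/M is a Riemann sum of its integral on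
    [0, 1], which is 2 k^2 / ((k+1) (2k+1)). Each frequency m > 0 counts
    twice. *)
Lemma pinsker_filter_sum k M : (0 < k)%N -> (0 < M)%N ->
  \sum_(1 <= j < M.*2) pinsker_filter k M j ^+ 2 <=
  4 * k%:R ^+ 2 / (k.+1%:R * (2 * k).+1%:R) * M%:R + 3 :> R.
Proof.
move=> k0 M0; have MR : 0 < M%:R :> R by rewrite ltr0n.
have step : \sum_(1 <= j < M.*2) pinsker_filter k M j ^+ 2 =
    1 + 2 * \sum_(1 <= m < M) (1 - (m%:R / M%:R) ^+ k) ^+ 2 :> R.
  rewrite big_ltn; last by lia.
  congr (_ + _).
    by rewrite /pinsker_filter /freq mulr0 mul0r expr0n gtn_eqF// subr0 expr1n.
  rewrite -[X in \sum_(X <= _ < _) _]/(1.*2) sum_pairs mulr_sumr; apply: eq_bigr => m _.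
  rewrite /pinsker_filter doubleK /= uphalf_double freq_ratio//; ring.
have full : \sum_(1 <= m < M) (1 - (m%:R / M%:R) ^+ k) ^+ 2 =
    \sum_(0 <= m < M) (1 - (m%:R / M%:R) ^+ k) ^+ 2 - 1 :> R.
  by rewrite [in RHS]big_ltn// mul0r expr0n gtn_eqF// subr0 expr1n addrC addKr.
have expand : \sum_(0 <= m < M) (1 - (m%:R / M%:R) ^+ k) ^+ 2 = M%:R -
    2 * ((\sum_(0 <= m < M) m%:R ^+ k) / M%:R ^+ k) +
    (\sum_(0 <= m < M) m%:R ^+ (2 * k)) / M%:R ^+ (2 * k) :> R.
  have E m : (1 - (m%:R / M%:R) ^+ k) ^+ 2 = 1 - 2 * (m%:R ^+ k / M%:R ^+ k) +
      m%:R ^+ (2 * k) / M%:R ^+ (2 * k) :> R.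
    rewrite expr_div_n [(2 * k)%N]mulnC !exprM.
    by move: (_ ^+ k) (_ ^+ k) (expf_neq0 k (lt0r_neq0 MR)) => u w w0; field.
  under eq_bigr do rewrite E.
  by rewrite big_split/= sumrB sumr_const_nat subn0 -mulr_sumr -!mulr_suml.
have h1 := power_sum_ge k M; have h2 := power_sum_le (2 * k) M.
have Mk : 0 < M%:R ^+ k :> R by rewrite exprn_gt0.
have M2k : 0 < M%:R ^+ (2 * k) :> R by rewrite exprn_gt0.
have g1 : M%:R / k.+1%:R - 1 <= (\sum_(0 <= m < M) m%:R ^+ k) / M%:R ^+ k :> R.
  rewrite ler_pdivlMr// mulrBl mul1r; apply: le_trans h1.
  by rewrite exprS mulrAC.
have g2 : (\sum_(0 <= m < M) m%:R ^+ (2 * k)) / M%:R ^+ (2 * k) <= M%:R / (2 * k).+1%:R :> R.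
  rewrite ler_pdivrMr//; apply: le_trans h2 _.
  by rewrite exprS mulrAC.
rewrite step full expand.
have -> : 4 * k%:R ^+ 2 / (k.+1%:R * (2 * k).+1%:R) * M%:R =
   2 * (M%:R - 2 * (M%:R / k.+1%:R) + M%:R / (2 * k).+1%:R) :> R.
  have e2 : (2 * k).+1%:R = 2 * k%:R + 1 :> R by rewrite -natr1 natrM.
  have e1 : k.+1%:R = k%:R + 1 :> R by rewrite -natr1.
  have n1 : k.+1%:R != 0 :> R by []. have n2 : (2 * k).+1%:R != 0 :> R by [].
  by move: n1 n2; rewrite e1 e2 => n1 n2; field; rewrite n1 n2.
move: g1 g2; move: (_ / M%:R ^+ k) (_ / M%:R ^+ (2 * k)) (_ / k.+1%:R) (_ / (2 * k).+1%:R).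
by move=> u w z1 z2; lra.
Qed.

(** The integral of 1 - x^k on [0, 1] is k / (k+1); each of the a lowest
    frequencies removes at most 1. *)
Lemma lower_filter_sum k a M : (0 < M)%N ->
  M%:R * k%:R / k.+1%:R - a%:R <= \sum_(a <= m < M) (1 - (m%:R / M%:R) ^+ k) :> R.
Proof.
move=> M0; have MR : 0 < M%:R :> R by rewrite ltr0n.
have kR : M%:R * k%:R / k.+1%:R = M%:R - M%:R / k.+1%:R :> R.
  have n1 : k.+1%:R != 0 :> R by [].
  by move: n1; rewrite -natr1 => n1; field.
have [aM|Ma] := leqP a M; last first.
  rewrite big_geq ?(ltnW Ma)// subr_le0 kR (@le_trans _ _ M%:R)//.
    by rewrite gerBl divr_ge0.
  by rewrite ler_nat ltnW.
have Mk : 0 < M%:R ^+ k :> R by rewrite exprn_gt0.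
have full : \sum_(0 <= m < M) (1 - (m%:R / M%:R) ^+ k) =
    M%:R - (\sum_(0 <= m < M) m%:R ^+ k) / M%:R ^+ k :> R.
  rewrite sumrB sumr_const_nat subn0 mulr_suml; congr (_ - _).
  by apply: eq_bigr => m _; rewrite expr_div_n.
have g : (\sum_(0 <= m < M) m%:R ^+ k) / M%:R ^+ k <= M%:R / k.+1%:R :> R.
  by rewrite ler_pdivrMr// (le_trans (power_sum_le k M))// exprS mulrAC.
have h : \sum_(0 <= m < a) (1 - (m%:R / M%:R) ^+ k) <= a%:R :> R.
  have -> : a%:R = \sum_(0 <= m < a) 1 :> R by rewrite sumr_const_nat subn0.
  by apply: ler_sum => m _; rewrite gerBl exprn_ge0// divr_ge0.
rewrite kR; move: full; rewrite (@big_cat_nat _ _ _ a 0 M)//=.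
move: (\sum_(0 <= m < a) _) h (\sum_(a <= m < M) _) => u ua w.
by move: (_ / M%:R ^+ k) (_ / k.+1%:R) g => z z1 zg E; lra.
Qed.

End power_sums.

(** * Minimax bounds at a fixed horizon *)

Section minimax_upper_bound.
Context {R : realType} {n : nat}.
Local Notation D := (skorokhod R n).
Local Notation mu := (@lebesgue_measure R).
Variables (QQ : set (probability D R)) (I : probability D R -> (R -> R) -> D -> R).
Variables (vs sig : probability D R -> R) (vs_up sig_up l : R).
Hypothesis hI : forall Q, QQ Q -> stochastic_integral Q (I Q).
Hypothesis moments : forall Q f, QQ Q -> L2fun n%:R f ->
  ('E_Q[I Q f] = 0 /\ 'E_Q[fun w => ((I Q f w) ^+ 2)%R]
          <= (sig Q)%:E * \int[mu]_(s in `[0%R, n%:R]) ((f s) ^+ 2)%:E)%E.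
Hypotheses (sig_itv : forall Q, QQ Q -> 0 <= sig Q <= sig_up).
Hypotheses (vs_le : forall Q, QQ Q -> vs Q <= vs_up).
Hypothesis L12 : forall Q, QQ Q -> (L1n Q (I Q) (vs Q) + L2n Q (I Q) <= l%:E)%E.
Hypothesis sig_up_ge0 : 0 <= sig_up.

(** The error terms due to the mesh are K h^2 with K depending on n, M and
    eta but not on S or Q, so at fixed n they are removed by choosing eta and
    then h = 1/p; the infimum over estimators absorbs the choice. *)
Lemma minimax_upper_bound k r M : (0 < n)%N -> (0 < k)%N -> (0 < M)%N ->
  (M.*2.-1 <= n)%N -> 0 <= r ->
  (minimax_risk QQ (sobolev k r) <= (r / freq M ^+ (2 * k) +
        (vs_up * (\sum_(1 <= j < M.*2) pinsker_filter k M j ^+ 2) + l) / n%:R)%:E)%E.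
Proof.
move=> n0 k0 M0 Mn r0; have nR : 0 < n%:R :> R by rewrite ltr0n.
set U := r / _ + _.
apply/lee_addgt0Pr => de de0.
pose eta := de / (2 * (`|U| + 1)).
have U0 : 0 < 2 * (`|U| + 1) by rewrite mulr_gt0// ltr_wpDl.
have eta0 : 0 < eta by rewrite divr_gt0.
have etaU : eta * U <= de / 2.
  rewrite /eta mulrAC ler_pdivrMr// -mulrA ler_pM2l// mulrA mulVf// mul1r.
  by rewrite (le_trans (ler_norm U))// lerDl.
pose K := (1 + eta^-1) * (M.*2%:R * (2 * (2 * freq M * (1 + r)) ^+ 2 +
        2 * sig_up * (2 * freq M) ^+ 2 / n%:R)).
have K0 : 0 <= K.
  have e1 : 0 <= 1 + eta^-1 by rewrite addr_ge0// invr_ge0 ltW.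
  rewrite mulr_ge0// mulr_ge0// addr_ge0//; first by rewrite mulr_ge0 ?sqr_ge0.
  by rewrite divr_ge0// mulr_ge0 ?sqr_ge0// mulr_ge0.
pose p := (Num.truncn (2 * K / de)).+1.
have pK : 2 * K / de < p%:R by rewrite /p; exact: truncnS_gt.
have p0 : 0 < p%:R :> R by rewrite ltr0n.
pose h : R := p%:R^-1; have h0 : 0 < h by rewrite invr_gt0.
have h1 : h <= 1 by rewrite invf_le1// ler1n.
have Nh : (n * p)%:R * h = n%:R by rewrite natrM mulfK// gt_eqF.
have hK : K * h ^+ 2 <= de / 2.
  have : K * h <= de / 2.
    rewrite /h ler_pdivrMr//; move: pK; rewrite ltr_pdivrMr//; lra.
  by apply: le_trans; rewrite expr2 mulrA ler_piMr// mulr_ge0// ltW.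
apply: (@le_trans _ _ (ereal_sup [set robust_risk QQ (pinsker_estimator k M h (n * p)) S
    | S in sobolev k r])).
  by apply: ereal_inf_lbound; exists (pinsker_estimator k M h (n * p)) => //; exact: estimators_pinsker.
apply: ge_ereal_sup => _ [S bS <-]; apply: ge_ereal_sup => _ [Q QQQ <-].
have /andP[s0 s1] := sig_itv QQQ.
apply: le_trans (pinsker_estimator_risk (hI QQQ) (fun f => moments QQQ) s0 s1 (vs_le QQQ)
  (L12 QQQ) n0 k0 M0 Mn h0 Nh eta0 bS) _.
rewrite -/U -EFinD lee_fin.
set K' := (1 + eta^-1) * _.
have -> : K' = K * h ^+ 2 by rewrite /K' /K; field; rewrite !gt_eqF.
lra.
Qed.

End minimax_upper_bound.

Section prior_variances.
Context {R : realType}.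
Implicit Types (k m M a p j : nat) (t eta : R).

Lemma half_range a M j : (a.*2 <= j < M.*2)%N -> (j./2 < M)%N /\ (a <= j./2)%N.
Proof. lia. Qed.

Lemma le_freqn m : m%:R <= freq m :> R.
Proof.
rewrite /freq ler_peMl// (le_trans _ (ler_wpM2l (ler0n R 2) (@pi_ge2 R)))//.
by rewrite -natrM ler1n.
Qed.

Lemma freqX m l : freq m ^+ l = (2 * pi) ^+ l * m%:R ^+ l :> R.
Proof. by rewrite /freq exprMn. Qed.

(** The lower derivatives are negligible at high frequencies. *)
Lemma sobolev_weight_le k m : (0 < m)%N ->
  sobolev_weight k m <= freq m ^+ (2 * k) * (1 + k%:R / m%:R) :> R.
Proof.
move=> m0; have mR : 0 < m%:R :> R by rewrite ltr0n.
have wm := le_freqn m; have w1 : 1 <= freq m :> R by apply: le_trans wm; rewrite ler1n.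
have w0 : 0 <= freq m :> R by exact: freq_ge0.
rewrite /sobolev_weight big_ord_recr/= addrC mulrDr mulr1 lerD2l mulrA ler_pdivlMr// mulr_suml.
apply: (@le_trans _ _ (\sum_(i < k) freq m ^+ (2 * k))); last by rewrite sumr_const card_ord mulr_natr.
apply: ler_sum => i _.
have -> : (2 * k = 2 * i + 2 * (k - i))%N by rewrite -mulnDr subnKC// ltnW.
rewrite exprD ler_wpM2l ?exprn_ge0//; apply: (le_trans wm).
have ki : (1 <= 2 * (k - i))%N by have := ltn_ord i; lia.
by rewrite -[leLHS]expr1; apply: ler_weXn2l.
Qed.

Lemma sobolev_weight_ge k p a M : (0 < p)%N -> M%:R <= p%:R * a%:R :> R ->
  (2 * pi) ^+ (2 * k) * M%:R ^+ (2 * k) / p%:R ^+ (2 * k) <= sobolev_weight k a :> R.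
Proof.
move=> p0 Ma; have pR : 0 < p%:R :> R by rewrite ltr0n.
have p2 : 0 <= (2 * pi) ^+ (2 * k) :> R by rewrite exprn_ge0// mulr_ge0 ?pi_ge0.
rewrite ler_pdivrMr ?exprn_gt0//.
apply: (@le_trans _ _ (freq a ^+ (2 * k) * p%:R ^+ (2 * k))).
  rewrite freqX -mulrA ler_wpM2l// -exprMn lerXn2r ?nnegrE ?mulr_ge0//.
  by rewrite mulrC.
rewrite ler_wpM2r ?exprn_ge0// /sobolev_weight big_ord_recr/= lerDr.
by apply: sumr_ge0 => i _; rewrite exprn_ge0// freq_ge0.
Qed.

(** Pinsker's least favourable variances: they maximize the sum of the Bayes
    risks at a given energy, for weights proportional to m^(2k) and a noise
    variance t. *)
Definition prior_var t k M m : R := t * ((M%:R / m%:R) ^+ k - 1).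

Lemma prior_var_gt0 t k M m : 0 < t -> (0 < k)%N -> (0 < m)%N -> (m < M)%N ->
  0 < prior_var t k M m.
Proof.
move=> t0 k0 m0 mM; rewrite mulr_gt0// subr_gt0 exprn_egt1 ?gtn_eqF//.
by rewrite ltr_pdivlMr ?ltr0n// mul1r ltr_nat.
Qed.

Lemma weighted_prior_var_le t k M a m : 0 <= t -> (0 < a)%N -> (a <= m)%N -> (m < M)%N ->
  sobolev_weight k m * prior_var t k M m <=
  t * (1 + k%:R / a%:R) * (2 * pi) ^+ (2 * k) * (M%:R ^+ k * m%:R ^+ k - m%:R ^+ (2 * k)).
Proof.
move=> t0 a0 am mM; have m0 : (0 < m)%N by exact: leq_trans am.
have mR : 0 < m%:R :> R by rewrite ltr0n.
have aR : 0 < a%:R :> R by rewrite ltr0n.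
have y0 : 0 <= (M%:R / m%:R) ^+ k - 1 :> R.
  by rewrite subr_ge0 exprn_ege1// ler_pdivlMr// mul1r ler_nat ltnW.
apply: (@le_trans _ _ (freq m ^+ (2 * k) * (1 + k%:R / a%:R) * prior_var t k M m)).
  rewrite ler_wpM2r ?mulr_ge0//; apply: le_trans (sobolev_weight_le k m0) _.
  rewrite ler_wpM2l ?exprn_ge0 ?freq_ge0// lerD2l ler_wpM2l// lef_pV2 ?posrE//.
  by rewrite ler_nat.
rewrite freqX /prior_var expr_div_n [(2 * k)%N]mulnC exprM [m%:R ^+ (k * 2)]exprM.
rewrite le_eqVlt; apply/orP; left; apply/eqP.
move: (m%:R ^+ k) (expf_neq0 k (lt0r_neq0 mR)) => u u0.
by field; rewrite u0/= gt_eqF.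
Qed.

Lemma weighted_prior_sum_le t k M a : 0 <= t -> (0 < a)%N -> (0 < M)%N ->
  \sum_(a <= m < M) sobolev_weight k m * prior_var t k M m <=
  t * (1 + k%:R / a%:R) * (2 * pi) ^+ (2 * k) *
    (M%:R ^+ (2 * k) * (M%:R * k%:R / (k.+1%:R * (2 * k).+1%:R) + 1)).
Proof.
move=> t0 a0 M0; have MR : 0 < M%:R :> R by rewrite ltr0n.
have aR : 0 < a%:R :> R by rewrite ltr0n.
have C0 : 0 <= t * (1 + k%:R / a%:R) * (2 * pi) ^+ (2 * k).
  by rewrite mulr_ge0 ?exprn_ge0 ?mulr_ge0 ?pi_ge0// addr_ge0// divr_ge0.
apply: (@le_trans _ _ (\sum_(a <= m < M) t * (1 + k%:R / a%:R) * (2 * pi) ^+ (2 * k) *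
    (M%:R ^+ k * m%:R ^+ k - m%:R ^+ (2 * k)))).
  by rewrite !big_nat; apply: ler_sum => m /andP[am mM]; exact: weighted_prior_var_le.
rewrite -mulr_sumr ler_wpM2l//.
have [Ma|aM] := leqP M a.
  by rewrite big_geq// mulr_ge0 ?exprn_ge0// addr_ge0// divr_ge0// mulr_ge0.
apply: (@le_trans _ _ (\sum_(0 <= m < M) (M%:R ^+ k * m%:R ^+ k - m%:R ^+ (2 * k)))).
  rewrite [leRHS](@big_cat_nat _ _ _ a)//= ?(ltnW aM)// lerDr !big_nat.
  apply: sumr_ge0 => m /andP[_ ma]; rewrite subr_ge0 mul2n -addnn exprD ler_wpM2r ?exprn_ge0//.
  by rewrite lerXn2r ?nnegrE// ler_nat ltnW// (ltn_trans ma).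
rewrite sumrB -mulr_sumr.
have h1 := @power_sum_le R k M; have h2 := @power_sum_ge R (2 * k) M.
have h3 : M%:R ^+ k * (\sum_(0 <= m < M) m%:R ^+ k) <= M%:R ^+ (2 * k) * (M%:R / k.+1%:R) :> R.
  apply: (le_trans (ler_wpM2l (exprn_ge0 k (ltW MR)) h1)).
  by rewrite le_eqVlt; apply/orP; left; apply/eqP; rewrite mul2n -addnn exprD exprS; ring.
have n1 : k.+1%:R != 0 :> R by []. have n2 : (2 * k).+1%:R != 0 :> R by [].
have E : M%:R ^+ (2 * k) * (M%:R * k%:R / (k.+1%:R * (2 * k).+1%:R) + 1) =
   M%:R ^+ (2 * k) * (M%:R / k.+1%:R) - (M%:R ^+ (2 * k).+1 / (2 * k).+1%:R - M%:R ^+ (2 * k)) :> R.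
  have e2 : (2 * k).+1%:R = 2 * k%:R + 1 :> R by rewrite -natr1 natrM.
  have e1 : k.+1%:R = k%:R + 1 :> R by rewrite -natr1.
  by rewrite exprS; move: n1 n2; rewrite e1 e2 => n1 n2; field; rewrite n1 n2.
by rewrite E; exact: lerB.
Qed.

Lemma weighted_prior_term_le t k M m : 0 <= t -> (0 < m)%N -> (m < M)%N ->
  0 <= sobolev_weight k m * prior_var t k M m <= t * k.+1%:R * (2 * pi) ^+ (2 * k) * M%:R ^+ (2 * k).
Proof.
move=> t0 m0 mM; have mR : 0 < m%:R :> R by rewrite ltr0n.
have y0 : 0 <= (M%:R / m%:R) ^+ k - 1 :> R.
  by rewrite subr_ge0 exprn_ege1// ler_pdivlMr// mul1r ler_nat ltnW.
rewrite !mulr_ge0 ?(le_trans ler01 (sobolev_weight_ge1 k m))//=.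
apply: le_trans (weighted_prior_var_le k t0 m0 (leqnn m) mM) _.
have p2 : 0 <= (2 * pi) ^+ (2 * k) :> R by rewrite exprn_ge0// mulr_ge0 ?pi_ge0.
have k1 : 0 <= 1 + k%:R / m%:R :> R by rewrite addr_ge0// divr_ge0.
have mk : m%:R ^+ k <= M%:R ^+ k :> R by rewrite lerXn2r ?nnegrE// ler_nat ltnW.
have mk0 : 0 <= m%:R ^+ k :> R by rewrite exprn_ge0.
apply: ler_pM; rewrite ?mulr_ge0//.
- by rewrite subr_ge0 mul2n -addnn exprD ler_wpM2r.
- by rewrite ler_wpM2r// ler_wpM2l// -natr1 addrC lerD2r ler_pdivrMr// ler_peMr// ler1n.
- rewrite mul2n -addnn !exprD; apply: (@le_trans _ _ (M%:R ^+ k * m%:R ^+ k)).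
    by rewrite gerBl mulr_ge0.
  by rewrite ler_wpM2l ?exprn_ge0.
Qed.

(** For eta = 0 this is an equality: the Bayes risk of the variance
    t (y - 1), with y = (M/m)^k and noise variance t, is t (1 - 1/y). *)
Lemma prior_risk_ge (c t eta : R) k M m : 0 < c -> 0 < t -> 0 < eta -> eta < 1 ->
  (0 < k)%N -> (0 < m)%N -> (m < M)%N ->
  (1 - eta) * t * (1 - (m%:R / M%:R) ^+ k) <=
  prior_var ((1 - eta) * t) k M m / (1 + (c / t) * prior_var ((1 - eta) * t) k M m / c).
Proof.
move=> c0 t0 eta0 eta1 k0 m0 mM; have mR : 0 < m%:R :> R by rewrite ltr0n.
have MR : 0 < M%:R :> R by rewrite ltr0n (leq_ltn_trans _ mM).
have e1 : 0 < 1 - eta by rewrite subr_gt0.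
have y1 : 1 < (M%:R / m%:R) ^+ k :> R.
  by rewrite exprn_egt1 ?gtn_eqF// ltr_pdivlMr// mul1r ltr_nat.
have -> : (m%:R / M%:R) ^+ k = ((M%:R / m%:R) ^+ k)^-1 :> R by rewrite -exprVn invf_div.
rewrite /prior_var; move: ((M%:R / m%:R) ^+ k) y1 => y y1.
have y0 : 0 < y by apply: lt_trans y1.
have -> : c / t * ((1 - eta) * t * (y - 1)) / c = (1 - eta) * (y - 1) by field; rewrite !gt_eqF.
have d0 : 0 < 1 + (1 - eta) * (y - 1) by rewrite addr_gt0// mulr_gt0// subr_gt0.
rewrite ler_pdivlMr// -!mulrA ler_pM2l// ler_pM2l//.
have -> : 1 - y^-1 = (y - 1) / y by field; rewrite gt_eqF.
rewrite mulrAC ler_pdivrMr// ler_pM2l ?subr_gt0//.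
nra.
Qed.

(** The orders of magnitude in the term of the functions outside the ball: A is
    the weight of the lowest frequency of the prior, d the distance of its mean
    energy to r, Z the sum of the squared mean energies of its coordinates. *)
Lemma off_ball_term_le (q r eta t u v w z Mr A d Z : R) : 0 < q -> 0 < r -> 0 < eta -> 0 < u -> 0 < v ->
  0 < w -> 0 <= Z -> u * v / w <= A -> eta / 2 * r <= d ->
  Z <= 2 * Mr * (t * z * u * v) ^+ 2 ->
  q * r / (A * d ^+ 2) * Z <= 8 * q * w * z ^+ 2 * u / (eta ^+ 2 * r) * t ^+ 2 * v * Mr.
Proof.
move=> q0 r0 eta0 u0 v0 w0 Z0 hA hd hZ.
have B0 : 0 < u * v / w by rewrite divr_gt0// mulr_gt0.
have e0 : 0 < eta / 2 * r by rewrite mulr_gt0// divr_gt0.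
have A0 : 0 < A by apply: lt_le_trans hA.
have d0 : 0 < d by apply: lt_le_trans hd.
apply: (@le_trans _ _ (q * r / ((u * v / w) * (eta / 2 * r) ^+ 2) * (2 * Mr * (t * z * u * v) ^+ 2))).
  have qr : 0 < q * r by rewrite mulr_gt0.
  apply: ler_pM => //.
    by apply: divr_ge0; [exact: ltW|rewrite mulr_ge0 ?sqr_ge0// ltW].
  rewrite ler_pM2l// lef_pV2 ?posrE ?mulr_gt0 ?invr_gt0 ?exprn_gt0//.
  apply: ler_pM; [exact: ltW|exact: sqr_ge0|exact: hA|].
  by rewrite lerXn2r ?nnegrE// ltW.
rewrite le_eqVlt; apply/orP; left; apply/eqP; field.
by rewrite !gt_eqF.
Qed.

End prior_variances.

Section minimax_lower_bound.
Context {R : realType} {n : nat}.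
Local Notation D := (skorokhod R n).

Variables (QQ : set (probability D R)) (Q : probability D R) (c : R).
Hypotheses (c0 : 0 < c) (QQQ : QQ Q) (wQ : wiener c Q).

Definition off_ball_constant (k p : nat) (r eta : R) : R :=
  8 * 640 * p%:R ^+ (2 * k) * k.+1%:R ^+ 2 * (2 * pi) ^+ (2 * k) * c ^+ 2 / (eta ^+ 2 * r).

(** The prior lives on the frequencies a <= m < M with a about M / p. A lower
    end proportional to M makes the lowest Sobolev weight of the same order
    as the highest, as the control of the functions outside the ball requires;
    it costs the proportion 1/p of the sum of the Bayes risks. The
    first assumption on M says that the leading term of the energy of the
    prior with eta = 0 is at most r, and the second that the corrections to it
    are absorbed in the factor 1 - eta. *)
Lemma minimax_lower_bound k r M p eta : (0 < n)%N -> (0 < k)%N -> (0 < M)%N -> (0 < p)%N ->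
  0 < r -> 0 < eta -> eta < 1 ->
  2 * c * k%:R * freq M ^+ (2 * k) * M%:R <= r * (k.+1%:R * (2 * k).+1%:R) * n%:R ->
  (1 + (k * p)%:R / M%:R) * (1 + (k.+1 * (2 * k).+1)%:R / M%:R) <= 1 + eta / 2 ->
  ((2 * (1 - eta) * (c / n%:R) * (M%:R * k%:R / k.+1%:R - (M%:R / p%:R + 1)))%:E <=
   minimax_risk QQ (sobolev k r) +
   (off_ball_constant k p r eta * M%:R ^+ (2 * k).+1 / n%:R ^+ 2)%:E)%E.
Proof.
move=> n0 k0 M0 p0 r0 eta0 eta1 hM hMp.
have nR : 0 < n%:R :> R by rewrite ltr0n.
have MR : 0 < M%:R :> R by rewrite ltr0n.
have pR : 0 < p%:R :> R by rewrite ltr0n.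
have kR : 0 < k%:R :> R by rewrite ltr0n.
pose a := (M %/ p).+1.
have a0 : (0 < a)%N by [].
have aR : 0 < a%:R :> R by rewrite ltr0n.
have Ma : M%:R <= p%:R * a%:R :> R.
  by rewrite -natrM ler_nat /a mulnC ltnW// ltn_ceil.
have aM : a%:R <= M%:R / p%:R + 1 :> R.
  by rewrite /a -natr1 lerD2r ler_pdivlMr// -natrM ler_nat leq_trunc_div.
pose t := c / n%:R; have t0 : 0 < t by rewrite divr_gt0.
have e1 : 0 < 1 - eta by rewrite subr_gt0.
pose t' := (1 - eta) * t; have t'0 : 0 < t' by rewrite mulr_gt0.
pose sigma j := Num.sqrt (prior_var t' k M j./2).
have jm j : (a.*2 <= j < M.*2)%N -> (0 < j./2)%N /\ (j./2 < M)%N.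
  by move=> /half_range[mM am]; split => //; exact: leq_trans am.
have sigma_gt0 j : (a.*2 <= j < M.*2)%N -> 0 < sigma j.
  by move=> /jm[m0 mM]; rewrite sqrtr_gt0 prior_var_gt0.
have sigmaE j : (a.*2 <= j < M.*2)%N -> sigma j ^+ 2 = prior_var t' k M j./2.
  by move=> /jm[m0 mM]; rewrite sqr_sqrtr// ltW// prior_var_gt0.
set W := \sum_(a.*2 <= j < M.*2) sobolev_weight k j./2 * sigma j ^+ 2.
have WE : W = 2 * \sum_(a <= m < M) sobolev_weight k m * prior_var t' k M m.
  rewrite /W (@eq_big_nat _ _ _ _ _ _ (fun j => sobolev_weight k j./2 * prior_var t' k M j./2)).
    by rewrite sum_pairs mulr_sumr; apply: eq_bigr => m _; rewrite doubleK /= uphalf_double; ring.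
  by move=> j hj; rewrite sigmaE.
have k1R : 0 < k.+1%:R * (2 * k).+1%:R :> R by rewrite mulr_gt0.
have hW : W <= (1 - eta / 2) * r.
  rewrite WE; apply: (@le_trans _ _ (2 * (t' * (1 + k%:R / a%:R) * (2 * pi) ^+ (2 * k) *
    (M%:R ^+ (2 * k) * (M%:R * k%:R / (k.+1%:R * (2 * k).+1%:R) + 1))))).
    by rewrite ler_pM2l// weighted_prior_sum_le// ltW.
  have ka : 1 + k%:R / a%:R <= 1 + (k * p)%:R / M%:R :> R.
    rewrite lerD2l ler_pdivrMr// mulrAC ler_pdivlMr// natrM -mulrA ler_wpM2l// .
  have E : 2 * (t' * (1 + k%:R / a%:R) * (2 * pi) ^+ (2 * k) *
      (M%:R ^+ (2 * k) * (M%:R * k%:R / (k.+1%:R * (2 * k).+1%:R) + 1))) =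
     (1 - eta) * ((2 * c * k%:R * freq M ^+ (2 * k) * M%:R) / (k.+1%:R * (2 * k).+1%:R * n%:R)) *
     ((1 + k%:R / a%:R) * (1 + (k.+1 * (2 * k).+1)%:R / M%:R / k%:R)).
    have n1 : k.+1%:R != 0 :> R by []. have n2 : (2 * k).+1%:R != 0 :> R by [].
    rewrite freqX /t' /t natrM; move: k.+1%:R (2 * k).+1%:R n1 n2 => u w u0 w0.
    by field; rewrite u0 w0 !gt_eqF.
  rewrite E {E}.
  have h1 : (2 * c * k%:R * freq M ^+ (2 * k) * M%:R) / (k.+1%:R * (2 * k).+1%:R * n%:R) <= r.
    by rewrite ler_pdivrMr ?mulr_gt0// mulrA.
  have h1' : 0 <= (2 * c * k%:R * freq M ^+ (2 * k) * M%:R) / (k.+1%:R * (2 * k).+1%:R * n%:R).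
    by rewrite divr_ge0 ?mulr_ge0 ?exprn_ge0 ?freq_ge0 ?(ltW c0).
  have h2 : (1 + k%:R / a%:R) * (1 + (k.+1 * (2 * k).+1)%:R / M%:R / k%:R) <= 1 + eta / 2.
    apply: le_trans hMp; apply: ler_pM => //.
    by rewrite lerD2l ler_pdivrMr// ler_peMr ?divr_ge0// ler1n.
  have h2' : 0 <= (1 + k%:R / a%:R) * (1 + (k.+1 * (2 * k).+1)%:R / M%:R / k%:R) :> R.
    by rewrite mulr_ge0// addr_ge0// !divr_ge0.
  move: h1 h1' h2 h2'; move: (_ / (_ * n%:R)) (_ * (1 + _ / k%:R)) => u w u1 u0 w1 w0.
  apply: (@le_trans _ _ ((1 - eta) * r * (1 + eta / 2))).
    by apply: ler_pM => //; rewrite ?mulr_ge0 ?(ltW e1)// ler_pM2l.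
  by rewrite mulrAC ler_pM2r//; nra.
have rW : eta / 2 * r <= r - W by lra.
have er0 : 0 < eta / 2 * r by rewrite mulr_gt0// divr_gt0.
have Wr : W < r by rewrite -subr_gt0; exact: lt_le_trans rW.
have hA := @sobolev_weight_ge R k p a M p0 Ma.
have LB Sh : estimators Sh ->
    ((\sum_(a.*2 <= j < M.*2) sigma j ^+ 2 / (1 + n%:R * sigma j ^+ 2 / c))%:E <=
      ereal_sup [set robust_risk QQ Sh S | S in sobolev k r] +
   (640 * r / (sobolev_weight k a * (r - W) ^+ 2) *
    \sum_(a.*2 <= j < M.*2) (sobolev_weight k j./2 * sigma j ^+ 2) ^+ 2)%:E)%E.
  move=> mSh; apply: (ball_lower_bound c0 wQ mSh a0 r0 sigma_gt0 Wr) => S bS.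
  apply: (@le_trans _ _ (robust_risk QQ Sh S)).
    by apply: ereal_sup_ubound; exists Q.
  by apply: ereal_sup_ubound; exists S.
set L := \sum_(a.*2 <= j < M.*2) _ / _ in LB.
set K := _ * \sum_(a.*2 <= j < M.*2) _ in LB.
have hL : 2 * (1 - eta) * t * (M%:R * k%:R / k.+1%:R - (M%:R / p%:R + 1)) <= L.
  apply: (@le_trans _ _ (2 * (1 - eta) * t * \sum_(a <= m < M) (1 - (m%:R / M%:R) ^+ k))).
    apply: ler_wpM2l; first exact: mulr_ge0 (mulr_ge0 (ler0n _ _) (ltW e1)) (ltW t0).
    by apply: le_trans (lower_filter_sum k a M0); rewrite lerD2l lerN2.
  have E2 : 2 * (1 - eta) * t * (\sum_(a <= m < M) (1 - (m%:R / M%:R) ^+ k)) =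
      \sum_(a.*2 <= j < M.*2) (1 - eta) * t * (1 - (j./2%:R / M%:R) ^+ k).
    by rewrite sum_pairs mulr_sumr; apply: eq_bigr => m _; rewrite doubleK /= uphalf_double; ring.
  rewrite E2 /L !big_nat; apply: ler_sum => j hj; have [m0 mM] := jm j hj.
  rewrite (sigmaE j hj); have := prior_risk_ge c0 t0 eta0 eta1 k0 m0 mM.
  by have -> : c / t = n%:R by rewrite /t invf_div mulrCA divff ?mulr1// gt_eqF.
have hK : K <= off_ball_constant k p r eta * M%:R ^+ (2 * k).+1 / n%:R ^+ 2.
  have p2 : 0 < (2 * pi) ^+ (2 * k) :> R by rewrite exprn_gt0// mulr_gt0// pi_gt0.
  have hT : \sum_(a.*2 <= j < M.*2) (sobolev_weight k j./2 * sigma j ^+ 2) ^+ 2 <=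
      2 * M%:R * (t * k.+1%:R * (2 * pi) ^+ (2 * k) * M%:R ^+ (2 * k)) ^+ 2.
    set T := t * _ * _ * _.
    apply: (@le_trans _ _ (\sum_(a.*2 <= j < M.*2) T ^+ 2)).
      rewrite !big_nat; apply: ler_sum => j hj; have [m0 mM] := jm j hj.
      rewrite (sigmaE j hj).
      have /andP[h1 h2] := @weighted_prior_term_le R t' k M j./2 (ltW t'0) m0 mM.
      have h3 : t' * k.+1%:R * (2 * pi) ^+ (2 * k) * M%:R ^+ (2 * k) <= T.
        rewrite ler_wpM2r ?exprn_ge0// ler_wpM2r ?(ltW p2)// ler_wpM2r//.
        by rewrite ler_piMl ?(ltW t0)// gerBl (ltW eta0).
      by rewrite lerXn2r ?nnegrE ?(le_trans h2)// (le_trans h1)// (le_trans h2).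
    rewrite sumr_const_nat -[leLHS]mulr_natl ler_wpM2r ?sqr_ge0// -natrM ler_nat mul2n.
    exact: leq_subr.
  have Z0 : 0 <= \sum_(a.*2 <= j < M.*2) (sobolev_weight k j./2 * sigma j ^+ 2) ^+ 2.
    by apply: sumr_ge0 => j _; exact: sqr_ge0.
  apply: (le_trans (off_ball_term_le (ltr0n R 640) r0 eta0 p2 (exprn_gt0 (2 * k) MR) (exprn_gt0 (2 * k) pR)
    Z0 hA rW hT)).
  rewrite le_eqVlt; apply/orP; left; apply/eqP.
  rewrite /off_ball_constant /t [M%:R ^+ (2 * k).+1]exprS; move: (640 : R) k.+1%:R => q z.
  by field; rewrite !gt_eqF.
move: L K LB hL hK => L K LB hL hK.
rewrite -leeBlDr//.
apply: le_ereal_inf_tmp => _ [Sh mSh <-].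
rewrite leeBlDr//; apply: (@le_trans _ _ L%:E); first by rewrite lee_fin.
apply: (le_trans (LB Sh mSh)); by rewrite leeD2l// lee_fin.
Qed.

End minimax_lower_bound.

Lemma off_ball_constant_ge0 {R : realType} (c : R) k p r eta : 0 <= r ->
  0 <= off_ball_constant c k p r eta.
Proof.
move=> r0; rewrite /off_ball_constant; have := ler0n R 640; move: (640 : R) => q q0.
have p0 : 0 <= 2 * pi :> R by rewrite mulr_ge0// pi_ge0.
apply: divr_ge0; last by rewrite mulr_ge0 ?sqr_ge0.
apply: mulr_ge0; last exact: sqr_ge0.
apply: mulr_ge0; last exact: exprn_ge0.
apply: mulr_ge0; last exact: sqr_ge0.
by apply: mulr_ge0; [exact: mulr_ge0|exact: exprn_ge0].
Qed.

(** * Rates *)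

Section rates.
Context {R : realType}.

Lemma ereal_squeeze (u : nat -> \bar R) (l : R) :
  (forall e, 0 < e -> \forall n \near \oo, ((l - e)%:E <= u n <= (l + e)%:E)%E) ->
  u n @[n --> \oo] --> l%:E.
Proof.
move=> h; apply/fine_cvgP; split.
  apply: filterS (h 1 ltr01) => n /andP[h1 h2].
  by rewrite fin_numE; apply/andP; split; apply/eqP => E; move: h1 h2; rewrite E.
apply/cvgrPdist_le => e e0; apply: filterS (h e e0) => n /andP[] /=.
case: (u n) => [x| |]//; rewrite !lee_fin /= => h1 h2.
by rewrite ler_distl; lra.
Qed.

(** All rates are powers of x = n^(1/(2k+1)): the normalization is x^(2k), the
    horizon is x^(2k+1) and the cutoff is of order x. *)
Definition root (k n : nat) : R := n%:R `^ ((2 * k + 1)%:R^-1).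

Lemma root_gt0 k n : (0 < n)%N -> 0 < root k n.
Proof. by move=> n0; rewrite powR_gt0// ltr0n. Qed.

Lemma rootX k n : root k n ^+ (2 * k).+1 = n%:R.
Proof.
rewrite /root -powR_mulrn ?powR_ge0// -powRrM addn1 mulVf ?powRr1//.
Qed.

Lemma root_rate k n : n%:R `^ ((2 * k)%:R / (2 * k + 1)%:R) = root k n ^+ (2 * k).
Proof. by rewrite mulrC powRrM powR_mulrn// powR_ge0. Qed.

Lemma root_inv_small k e : 0 < e -> \forall n \near \oo, (0 < n)%N /\ (root k n)^-1 <= e.
Proof.
move=> e0; near=> n.
have n0 : (0 < n)%N by near: n; exact: nbhs_infty_gt.
split=> //; rewrite -[leRHS]invrK lef_pV2 ?posrE ?invr_gt0 ?root_gt0//.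
rewrite leNgt; apply/negP => h.
have : root k n ^+ (2 * k).+1 < e^-1 ^+ (2 * k).+1.
  by rewrite ltrXn2r ?nnegrE// ?invr_ge0 ltW// root_gt0.
rewrite rootX => {}h; suff : e^-1 ^+ (2 * k).+1 < n%:R by rewrite ltNge (ltW h).
by near: n; exact: nbhs_infty_gtr.
Unshelve. all: by end_near. Qed.

Variables (k : nat) (r c : R).
Hypotheses (k0 : (0 < k)%N) (r0 : 0 < r) (c0 : 0 < c).
Let P := pinsker_constant k r c.
Let kR : 0 < k%:R :> R. Proof. by rewrite ltr0n. Qed.
Let k1 : 0 < k.+1%:R :> R. Proof. by rewrite ltr0n. Qed.
Let k2 : 0 < (2 * k).+1%:R :> R. Proof. by rewrite ltr0n. Qed.
Let pi0 : 0 < pi :> R. Proof. exact: pi_gt0. Qed.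

Lemma pinsker_constant_gt0 : 0 < P.
Proof.
by rewrite /P /pinsker_constant mulr_gt0// powR_gt0// ?divr_gt0// ?mulr_gt0// addn1.
Qed.

Lemma pinsker_constantX :
  P ^+ (2 * k).+1 = (2 * k).+1%:R * r * (c * k%:R / (k.+1%:R * pi)) ^+ (2 * k).
Proof.
rewrite /P /pinsker_constant !addn1 exprMn; congr (_ * _).
  by rewrite -powR_mulrn ?powR_ge0// -powRrM mulVf ?pnatr_eq0// powRr1// mulr_ge0// ltW.
rewrite -[LHS]powR_mulrn ?powR_ge0// -powRrM divfK ?pnatr_eq0// powR_mulrn//.
by rewrite divr_ge0// mulr_ge0// ltW.
Qed.

(** The limit kappa of M / n^(1/(2k+1)). *)
Definition cutoff_ratio : R := P * k.+1%:R / (2 * c * k%:R).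
Local Notation kappa := cutoff_ratio.

Lemma cutoff_ratio_gt0 : 0 < kappa.
Proof.
apply: divr_gt0; apply: mulr_gt0 => //; [exact: pinsker_constant_gt0|exact: mulr_gt0].
Qed.

(** The defining property of kappa: asymptotically the least favourable prior
    has Sobolev energy exactly r. *)
Lemma cutoff_ratioX :
  2 * c * k%:R * (2 * pi) ^+ (2 * k) * kappa ^+ (2 * k).+1 = r * (k.+1%:R * (2 * k).+1%:R).
Proof.
have ck : 0 < c * k%:R by rewrite mulr_gt0.
rewrite /cutoff_ratio expr_div_n [(P * k.+1%:R) ^+ _]exprMn pinsker_constantX expr_div_n.
rewrite -[2 * c * k%:R]mulrA [(2 * (c * k%:R)) ^+ _]exprMn ![_ ^+ (2 * k).+1]exprS !exprMn.
have a0 := expf_neq0 (2 * k) (lt0r_neq0 ck); have b0 := expf_neq0 (2 * k) (lt0r_neq0 k1).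
have q0 := expf_neq0 (2 * k) (lt0r_neq0 pi0); have w0 := expf_neq0 (2 * k) (lt0r_neq0 (ltr0Sn R 1)).
rewrite !exprMn in a0 *.
move: (2 ^+ (2 * k)) (c ^+ (2 * k)) (k%:R ^+ (2 * k)) (k.+1%:R ^+ (2 * k)) (pi ^+ (2 * k)) a0 b0 q0 w0.
move: k.+1%:R (2 * k).+1%:R (lt0r_neq0 k1) (lt0r_neq0 k2) => z1 z2 z10 z20 w a a' b q.
rewrite mulf_eq0 negb_or => /andP[a0 a'0] b0 q0 w0.
by field; rewrite a0 a'0 b0 q0 w0 !gt_eqF.
Qed.

(** The limit of the lower bound: the Bayes risks sum up to
    2 (c/n) M k / (k+1). *)
Lemma pinsker_constant_cutoff : P = 2 * c * k%:R / k.+1%:R * kappa.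
Proof.
rewrite /cutoff_ratio; move: k.+1%:R k1 => z z0; field.
by rewrite !gt_eqF.
Qed.

(** The normalized upper bound, without l_n, as a function of
    y = n^(-1/(2k+1)). The cutoff being an integer part, M / n^(1/(2k+1)) is at
    least kappa - y. *)
Definition upper_rate (y : R) : R :=
  r / (2 * pi) ^+ (2 * k) * ((kappa - y) ^+ (2 * k))^-1 +
  c * (4 * k%:R ^+ 2 / (k.+1%:R * (2 * k).+1%:R)) * kappa + 3 * c * y.

(** At y = 0 the squared bias and the variance add up to the constant:
    they are in the proportion 1 to 2 k. *)
Lemma upper_rate0 : upper_rate 0 = P.
Proof.
rewrite /upper_rate subr0 mulr0 addr0 pinsker_constant_cutoff.
have K0 := cutoff_ratio_gt0.
have -> : r = 2 * c * k%:R * (2 * pi) ^+ (2 * k) * kappa ^+ (2 * k).+1 / (k.+1%:R * (2 * k).+1%:R).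
  by rewrite cutoff_ratioX mulfK// mulf_neq0// gt_eqF.
have e2 : (2 * k).+1%:R = 2 * k%:R + 1 :> R by rewrite -natr1 natrM.
have e1 : k.+1%:R = k%:R + 1 :> R by rewrite -natr1.
have p2 : (2 * pi) ^+ (2 * k) != 0 :> R by rewrite expf_neq0// gt_eqF// mulr_gt0.
have kp : kappa ^+ (2 * k) != 0 by rewrite expf_neq0// gt_eqF.
move: k1 k2; rewrite exprS e1 e2; move: ((2 * pi) ^+ _) (kappa ^+ (2 * k)) p2 kp => u v u0 v0 z1 z2.
by field; rewrite u0 v0 !gt_eqF.
Qed.

Lemma upper_rate_cvg (y : nat -> R) : y n @[n --> \oo] --> (0 : R) ->
  upper_rate (y n) @[n --> \oo] --> P.
Proof.
move=> hy; rewrite -upper_rate0.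
apply: cvgD; last by apply: cvgM => //; exact: cvg_cst.
apply: cvgD; last exact: cvg_cst.
apply: cvgM; first exact: cvg_cst.
apply: cvgV.
  by rewrite subr0 expf_neq0// gt_eqF// cutoff_ratio_gt0.
apply: (@cvg_comp _ _ _ (fun n => kappa - y n) (fun z : R => z ^+ (2 * k))); last exact: exprn_continuous.
by apply: cvgB => //; exact: cvg_cst.
Qed.

Definition cutoff n : nat := Num.truncn (kappa * root k n).

Lemma cutoff_le n : (cutoff n)%:R <= kappa * root k n.
Proof. by rewrite truncn_le mulr_ge0 ?powR_ge0// ltW// cutoff_ratio_gt0. Qed.

Lemma cutoff_gt n : kappa * root k n < (cutoff n)%:R + 1.
Proof. by rewrite natr1; exact: truncnS_gt. Qed.

Lemma cutoff_large (b : R) : \forall n \near \oo, b <= (cutoff n)%:R.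
Proof.
have K0 := cutoff_ratio_gt0.
have B0 : 0 < `|b| + 1 by rewrite ltr_wpDl.
apply: filterS (root_inv_small k (divr_gt0 K0 B0)) => n [n0 h].
have x0 := root_gt0 k n0; have := cutoff_gt n.
move: h; rewrite ler_pdivlMr// mulrC ler_pdivrMr// => h1 h2.
by have := ler_norm b; lra.
Qed.

Lemma cutoff_dimension : \forall n \near \oo, ((cutoff n).*2.-1 <= n)%N.
Proof.
have K0 := cutoff_ratio_gt0.
have e0 : 0 < (2 * kappa + 1)^-1 by rewrite invr_gt0 addr_gt0// mulr_gt0.
apply: filterS (root_inv_small k e0) => n [n0 h].
have x0 := root_gt0 k n0; move: h; rewrite lef_pV2 ?posrE// => [h|]; last by rewrite addr_gt0// mulr_gt0.
apply: (leq_trans (leq_pred _)); rewrite -(ler_nat R) -(rootX k n) exprS.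
rewrite -muln2 natrM; apply: (@le_trans _ _ (root k n * (2 * kappa))).
  by have := cutoff_le n; lra.
rewrite ler_pM2l//; have x1 : 1 <= root k n by lra.
apply: (@le_trans _ _ (root k n ^+ 1)); first by rewrite expr1; lra.
by apply: ler_weXn2l => //; rewrite muln_gt0.
Qed.

Lemma cutoff_energy n :
  2 * c * k%:R * freq (cutoff n) ^+ (2 * k) * (cutoff n)%:R <= r * (k.+1%:R * (2 * k).+1%:R) * n%:R.
Proof.
have K0 := cutoff_ratio_gt0; have hM := cutoff_le n.
rewrite -cutoff_ratioX freqX -(rootX k n).
have -> : 2 * c * k%:R * ((2 * pi) ^+ (2 * k) * (cutoff n)%:R ^+ (2 * k)) * (cutoff n)%:R =
    2 * c * k%:R * (2 * pi) ^+ (2 * k) * (cutoff n)%:R ^+ (2 * k).+1.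
  by rewrite exprSr; ring.
have C0 : 0 <= 2 * c * k%:R * (2 * pi) ^+ (2 * k).
  by apply: ltW; apply: mulr_gt0; [apply: mulr_gt0 => //; exact: mulr_gt0|rewrite exprn_gt0// mulr_gt0].
rewrite -[leRHS]mulrA ler_wpM2l// -exprMn lerXn2r ?nnegrE//.
by rewrite (le_trans _ hM).
Qed.

Lemma cutoff_correction (a b eta : R) : 0 <= a -> 0 <= b -> 0 < eta ->
  \forall n \near \oo, (1 + a / (cutoff n)%:R) * (1 + b / (cutoff n)%:R) <= 1 + eta / 2.
Proof.
move=> a0 b0 eta0.
apply: filterS2 (cutoff_large 1) (cutoff_large (2 * (a + b + a * b) / eta)) => n.
move: (cutoff n)%:R => z z1; rewrite ler_pdivrMr// => h.
have z0 : 0 < z by apply: lt_le_trans z1.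
have w0 : 0 < z^-1 by rewrite invr_gt0.
have w1 : z^-1 <= 1 by rewrite invf_le1.
have hw : (a + b + a * b) * z^-1 <= eta / 2 by rewrite ler_pdivrMr//; lra.
have ab : a * b * (z^-1 * z^-1) <= a * b * z^-1.
  by rewrite ler_wpM2l ?mulr_ge0// ler_piMl// ltW.
lra.
Qed.

Lemma upper_rate_bound n l : (0 < n)%N -> (0 < cutoff n)%N -> (root k n)^-1 < kappa ->
  root k n ^+ (2 * k) * (r / freq (cutoff n) ^+ (2 * k) +
     (c * (\sum_(1 <= j < (cutoff n).*2) pinsker_filter k (cutoff n) j ^+ 2) + l) / n%:R) <=
  upper_rate (root k n)^-1 + l / root k n.
Proof.
move=> n0 M0 hk; have x0 := root_gt0 k n0; set x := root k n in x0 hk *.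
set M := cutoff n in M0 *; have K0 := cutoff_ratio_gt0.
have MR : 0 < M%:R :> R by rewrite ltr0n.
have hM := cutoff_le n; have hM' := cutoff_gt n; rewrite -/x -/M in hM hM'.
have xk0 : 0 < x ^+ (2 * k) by rewrite exprn_gt0.
have p0 : 0 < (2 * pi) ^+ (2 * k) :> R by rewrite exprn_gt0// mulr_gt0.
have nE : n%:R = x * x ^+ (2 * k) by rewrite -exprS rootX.
have hs := @pinsker_filter_sum R k M k0 M0.
set K2 := 4 * k%:R ^+ 2 / (k.+1%:R * (2 * k).+1%:R) in hs *.
have K20 : 0 <= K2 by rewrite divr_ge0// mulr_ge0// ?sqr_ge0// ltW.
set s := \sum_(_ <= _ < _) _ in hs *.
have h1 : x ^+ (2 * k) * (r / freq M ^+ (2 * k)) <=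
    r / (2 * pi) ^+ (2 * k) * ((kappa - x^-1) ^+ (2 * k))^-1.
  have d0 : 0 < kappa - x^-1 by rewrite subr_gt0.
  have -> : x ^+ (2 * k) * (r / freq M ^+ (2 * k)) = r / (2 * pi) ^+ (2 * k) * ((M%:R / x) ^+ (2 * k))^-1.
    rewrite freqX expr_div_n; have v0 := expf_neq0 (2 * k) (lt0r_neq0 MR).
    move: (_ ^+ (2 * k)) (_ ^+ (2 * k)) (_ ^+ (2 * k)) xk0 p0 v0 => u v w u0 v0 w0.
    by field; rewrite w0 !gt_eqF.
  rewrite ler_pM2l ?divr_gt0// lef_pV2 ?posrE ?exprn_gt0 ?divr_gt0//.
  rewrite lerXn2r ?nnegrE ?divr_ge0 ?(ltW d0) ?(ltW x0)//.
  rewrite ler_pdivlMr// mulrBl mulVf ?gt_eqF//; lra.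
have h2 : x ^+ (2 * k) * ((c * s + l) / n%:R) <= c * K2 * kappa + 3 * c * x^-1 + l / x.
  have -> : x ^+ (2 * k) * ((c * s + l) / n%:R) = (c * s + l) / x.
    by rewrite nE; field; rewrite !gt_eqF.
  have -> : c * K2 * kappa + 3 * c * x^-1 + l / x = (c * (K2 * (kappa * x) + 3) + l) / x.
    by field; rewrite gt_eqF.
  rewrite ler_pM2r ?invr_gt0// lerD2r ler_pM2l//; apply: le_trans hs _.
  by rewrite lerD2r ler_wpM2l.
by rewrite /upper_rate -/K2 mulrDr; lra.
Qed.

(** The loss eta P comes from shrinking the prior, the loss in 1/p from dropping
    its low frequencies, and the rest from rounding the cutoff and from the
    functions outside the ball. *)
Lemma lower_rate_bound n p eta C : (0 < n)%N -> (1 < p)%N -> 0 < eta -> eta < 1 -> 0 <= C ->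
  P - eta * P - 2 * c * kappa / p%:R - (4 * c + C * kappa ^+ (2 * k).+1) * (root k n)^-1 <=
  root k n ^+ (2 * k) *
   (2 * (1 - eta) * (c / n%:R) *
      ((cutoff n)%:R * k%:R / k.+1%:R - ((cutoff n)%:R / p%:R + 1)) -
    C * (cutoff n)%:R ^+ (2 * k).+1 / n%:R ^+ 2).
Proof.
move=> n0 p1 eta0 eta1 C0; have x0 := root_gt0 k n0; set x := root k n in x0 *.
have hM := cutoff_le n; have hM' := cutoff_gt n; rewrite -/x in hM hM'.
set M := (cutoff n)%:R in hM hM' *; have M0 : 0 <= M by [].
have K0 := cutoff_ratio_gt0.
have xk0 : 0 < x ^+ (2 * k) by rewrite exprn_gt0.
have nE : n%:R = x * x ^+ (2 * k) by rewrite -exprS rootX.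
have pR : 0 < p%:R :> R by rewrite ltr0n ltnW.
pose q : R := k%:R / k.+1%:R - p%:R^-1.
have kp : 2^-1 <= k%:R / k.+1%:R :> R.
  by rewrite ler_pdivlMr// mulrC ler_pdivrMr// -natr1 mulr2n mulrDr mulr1 lerD2l ler1n.
have pp : p%:R^-1 <= 2^-1 :> R by rewrite lef_pV2 ?posrE// ler_nat.
have q0 : 0 <= q by rewrite subr_ge0 (le_trans pp).
have q1 : q <= 1.
  rewrite lerBlDr (@le_trans _ _ 1)// ?lerDl ?invr_ge0//.
  by rewrite ler_pdivrMr// mul1r ler_nat.
have e1 : 0 < 1 - eta by rewrite subr_gt0.
have -> : x ^+ (2 * k) * (2 * (1 - eta) * (c / n%:R) * (M * k%:R / k.+1%:R - (M / p%:R + 1)) -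
    C * M ^+ (2 * k).+1 / n%:R ^+ 2) =
    2 * (1 - eta) * c * ((M / x) * q - x^-1) - C * (M / x) ^+ (2 * k).+1 * x^-1.
  rewrite /q nE expr_div_n [x ^+ (2 * k).+1]exprS; move: (M ^+ (2 * k).+1) => u.
  move: k.+1%:R k1 => z z0.
  by field; rewrite !gt_eqF.
have hz : M / x <= kappa by rewrite ler_pdivrMr.
have hz' : kappa - x^-1 <= M / x by rewrite ler_pdivlMr// mulrBl mulVf ?gt_eqF//; lra.
have z0 : 0 <= M / x by rewrite divr_ge0// ltW.
have y0 : 0 < x^-1 by rewrite invr_gt0.
have hp : (M / x) ^+ (2 * k).+1 <= kappa ^+ (2 * k).+1 by rewrite lerXn2r ?nnegrE// ltW.
have PE : P = 2 * c * (kappa * (q + p%:R^-1)).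
  by rewrite /q addrNK pinsker_constant_cutoff; ring.
have h2 : C * (M / x) ^+ (2 * k).+1 * x^-1 <= C * kappa ^+ (2 * k).+1 * x^-1.
  by rewrite ler_wpM2r ?(ltW y0)// ler_wpM2l.
suff : P - eta * P - 2 * c * kappa / p%:R - 4 * c * x^-1 <= 2 * (1 - eta) * c * ((M / x) * q - x^-1).
  rewrite mulrDl; lra.
have h3 : (kappa - x^-1) * q - x^-1 <= (M / x) * q - x^-1 by rewrite lerD2r ler_wpM2r.
apply: (@le_trans _ _ (2 * (1 - eta) * c * ((kappa - x^-1) * q - x^-1))); last first.
  by rewrite ler_wpM2l// !mulr_ge0// ltW.
have -> : 2 * (1 - eta) * c * ((kappa - x^-1) * q - x^-1) =
    (1 - eta) * P - (1 - eta) * (2 * c * kappa / p%:R) - (1 - eta) * (2 * c * (x^-1 * (1 + q))).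
  by rewrite PE; ring.
have c20 : 0 <= 2 * c by rewrite mulr_ge0// ltW.
have shrink z : 0 <= z -> (1 - eta) * z <= z.
  by move=> zz; rewrite ler_piMl// gerBl ltW.
have g1 : (1 - eta) * (2 * c * kappa / p%:R) <= 2 * c * kappa / p%:R.
  exact: shrink (divr_ge0 (mulr_ge0 c20 (ltW K0)) (ltW pR)).
have g2 : (1 - eta) * (2 * c * (x^-1 * (1 + q))) <= 4 * c * x^-1.
  apply: (@le_trans _ _ (2 * c * (x^-1 * (1 + q)))).
    exact: shrink (mulr_ge0 c20 (mulr_ge0 (ltW y0) (addr_ge0 ler01 q0))).
  have : x^-1 * (1 + q) <= x^-1 * 2 by rewrite ler_pM2l//; lra.
  by move=> h; have := ler_wpM2l (ltW c0) h; lra.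
lra.
Qed.

End rates.

(** * Pinsker's theorem for robust risks *)

Theorem corollary6p3 (R : realType) (k : nat) (r : R)
    (l : nat -> R) (varsigma_low varsigma_up sigma_up : R)
    (QQ : forall n, set (probability (skorokhod R n) R))
    (varsigma sigma : forall n, probability (skorokhod R n) R -> R)
    (I : forall n, probability (skorokhod R n) R ->
           (R -> R) -> skorokhod R n -> R)
    (k_ge1 : (1 <= k)%N) (r_gt0 : 0 < r)
    (l_gt0 : forall n, (0 < n)%N -> 0 < l n)
    (l_incr : forall m n, (0 < m)%N -> (m <= n)%N -> l m <= l n)
    (l_pinfty : l n @[n --> \oo] --> +oo)
    (l_slow : forall delta : R, 0 < delta ->
       l n / n%:R `^ delta @[n --> \oo] --> (0 : R))
    (noise_semimartingale : forall n Q, (0 < n)%N -> QQ n Q ->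
       semimartingale Q)
    (noise_integral : forall n Q, (0 < n)%N -> QQ n Q ->
       stochastic_integral Q (I n Q))
    (noise_moments : forall n Q f, (0 < n)%N -> QQ n Q -> L2fun n%:R f ->
       ('E_Q[I n Q f] = 0 /\
        'E_Q[fun w => ((I n Q f w) ^+ 2)%R]
          <= (sigma n Q)%:E *
             \int[lebesgue_measure]_(s in `[0%R, n%:R]) ((f s) ^+ 2)%:E)%E)
    (sigma_gt0 : forall n Q, (0 < n)%N -> QQ n Q -> 0 < sigma n Q)
    (varsigma_gt0 : forall n Q, (0 < n)%N -> QQ n Q -> 0 < varsigma n Q)
    (noise_L12 : forall n Q, (0 < n)%N -> QQ n Q ->
       (L1n Q (I n Q) (varsigma n Q) + L2n Q (I n Q) <= (l n)%:E)%E)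
    (varsigma_low_gt0 : 0 < varsigma_low)
    (varsigma_inf : forall n, (0 < n)%N ->
       ereal_inf [set (varsigma n Q)%:E | Q in QQ n] = varsigma_low%:E)
    (varsigma_sup : forall n, (0 < n)%N ->
       ereal_sup [set (varsigma n Q)%:E | Q in QQ n] = varsigma_up%:E)
    (sigma_sup : forall n, (0 < n)%N ->
       ereal_sup [set (sigma n Q)%:E | Q in QQ n] = sigma_up%:E)
    (noise_wiener : forall n, (0 < n)%N ->
       exists2 Q0, QQ n Q0 & wiener varsigma_up Q0) :
  ((n%:R `^ ((2 * k)%:R / (2 * k + 1)%:R))%:E *
     minimax_risk (QQ n) (sobolev k r))%E @[n --> \oo]
    --> (pinsker_constant k r varsigma_up)%:E.
Proof.
have QQ1 : exists2 Q, QQ 1%N Q & wiener varsigma_up Q by exact: noise_wiener.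
have vs_le n Q : (0 < n)%N -> QQ n Q -> varsigma n Q <= varsigma_up.
  move=> n0 QQQ; rewrite -lee_fin -(varsigma_sup n n0).
  by apply: ereal_sup_ubound; exists Q.
have sig_le n Q : (0 < n)%N -> QQ n Q -> sigma n Q <= sigma_up.
  move=> n0 QQQ; rewrite -lee_fin -(sigma_sup n n0).
  by apply: ereal_sup_ubound; exists Q.
have c0 : 0 < varsigma_up.
  have [Q QQQ _] := QQ1; apply: lt_le_trans (vs_le 1%N Q isT QQQ).
  exact: varsigma_gt0.
have s0 : 0 <= sigma_up.
  have [Q QQQ _] := QQ1; apply: le_trans (sig_le 1%N Q isT QQQ).
  by apply: ltW; exact: sigma_gt0.
set P := pinsker_constant k r varsigma_up.
have P0 : 0 < P by exact: pinsker_constant_gt0.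
set kappa := cutoff_ratio k r varsigma_up.
have K0 : 0 < kappa by exact: cutoff_ratio_gt0.
pose M n := cutoff k r varsigma_up n.
pose x n : R := root k n.
have y_cvg : (x n)^-1 @[n --> \oo] --> (0 : R).
  apply/cvgrPdist_le => e e0; apply: filterS (root_inv_small k e0) => n [n0 h].
  by rewrite sub0r normrN ger0_norm// invr_ge0 ltW// root_gt0.
have l_cvg : l n / x n @[n --> \oo] --> (0 : R).
  by apply: l_slow; rewrite invr_gt0 ltr0n addn1.
have upper e : 0 < e -> \forall n \near \oo,
    ((n%:R `^ ((2 * k)%:R / (2 * k + 1)%:R))%:E * minimax_risk (QQ n) (sobolev k r) <= (P + e)%:E)%E.
  move=> e0; have e2 : 0 < e / 2 by rewrite divr_gt0.
  have /cvgrPdist_le/(_ _ e2) U := upper_rate_cvg k_ge1 r_gt0 c0 y_cvg.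
  have /cvgrPdist_le/(_ _ e2) L := l_cvg.
  near=> n.
  have [n0 yk] : (0 < n)%N /\ (x n)^-1 <= kappa / 2.
    by near: n; apply: root_inv_small; rewrite divr_gt0.
  have M0 : (0 < M n)%N.
    by rewrite -(ler_nat R); near: n; exact: (cutoff_large k_ge1 r_gt0 c0 1).
  have Mn : ((M n).*2.-1 <= n)%N by near: n; exact: cutoff_dimension.
  have hU : `|P - upper_rate k r varsigma_up (x n)^-1| <= e / 2 by near: n; exact: U.
  have hL : `|0 - l n / x n| <= e / 2 by near: n; exact: L.
  have x0 : 0 < x n by exact: root_gt0.
  have sig_itv Q : QQ n Q -> 0 <= sigma n Q <= sigma_up.
    by move=> QQQ; rewrite (ltW (sigma_gt0 n Q n0 QQQ)) sig_le.
  have := minimax_upper_bound (fun Q => noise_integral n Q n0) (fun Q f => noise_moments n Q f n0)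
    sig_itv (fun Q => vs_le n Q n0) (fun Q => noise_L12 n Q n0) s0 n0 k_ge1 M0 Mn (ltW r_gt0).
  have rate0 : 0 <= x n ^+ (2 * k) by rewrite exprn_ge0// ltW.
  move=> /(@lee_wpmul2l _ (x n ^+ (2 * k))%:E); rewrite lee_fin => /(_ rate0).
  rewrite root_rate -/(x n) => /le_trans; apply; rewrite -EFinM lee_fin.
  have yk' : (x n)^-1 < kappa by apply: le_lt_trans yk _; rewrite ltr_pdivrMr// ltr_pMr// ltr1n.
  apply: (le_trans (upper_rate_bound k_ge1 r_gt0 c0 (l n) n0 M0 yk')).
  by move: hU hL; rewrite !ler_distl; lra.
(* eta and p are fixed first: shrinking the prior and dropping its low frequencies
   cost e/4 each, and for n large the remaining terms cost e/2 *)
have lower e : 0 < e -> \forall n \near \oo,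
    ((P - e)%:E <= (n%:R `^ ((2 * k)%:R / (2 * k + 1)%:R))%:E * minimax_risk (QQ n) (sobolev k r))%E.
  move=> e0; pose eta := e / (4 * (P + e)).
  have Pe : 0 < 4 * (P + e) by rewrite mulr_gt0// addr_gt0.
  have eta0 : 0 < eta by rewrite divr_gt0.
  have eta1 : eta < 1 by rewrite ltr_pdivrMr//; lra.
  have etaP : eta * P <= e / 4.
    rewrite /eta mulrAC ler_pdivrMr//; have := mulr_gt0 e0 e0; nra.
  pose p := (Num.truncn (8 * varsigma_up * kappa / e)).+2.
  have p1 : (1 < p)%N by [].
  have pR : 0 < p%:R :> R by rewrite ltr0n.
  have hp : 2 * varsigma_up * kappa / p%:R <= e / 4.
    rewrite ler_pdivrMr//; have : 8 * varsigma_up * kappa / e <= p%:R.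
      by apply: ltW; apply: lt_trans (truncnS_gt _) _; rewrite ltr_nat.
    by rewrite ler_pdivrMr//; lra.
  pose C := off_ball_constant varsigma_up k p r eta.
  have C0 : 0 <= C by apply: off_ball_constant_ge0; exact: ltW.
  pose B := 4 * varsigma_up + C * kappa ^+ (2 * k).+1.
  have B0 : 0 < B.
    by apply: ltr_pwDl; [exact: mulr_gt0|apply: mulr_ge0 => //; rewrite exprn_ge0// ltW].
  near=> n.
  have [n0 yB] : (0 < n)%N /\ (x n)^-1 <= e / 2 / B.
    by near: n; apply: root_inv_small; rewrite !divr_gt0.
  have M0 : (0 < M n)%N.
    by rewrite -(ler_nat R); near: n; exact: (cutoff_large k_ge1 r_gt0 c0 1).
  have hMp : (1 + (k * p)%:R / (M n)%:R) * (1 + (k.+1 * (2 * k).+1)%:R / (M n)%:R) <= 1 + eta / 2.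
    by near: n; exact: cutoff_correction.
  have x0 : 0 < x n by exact: root_gt0.
  have rate0 : 0 <= x n ^+ (2 * k) by rewrite exprn_ge0// ltW.
  have [Q0 QQ0 wQ0] := noise_wiener n n0.
  have := minimax_lower_bound c0 QQ0 wQ0 n0 k_ge1 M0 (ltnW p1) r_gt0 eta0 eta1
    (cutoff_energy k_ge1 r_gt0 c0 n) hMp.
  rewrite -/C -leeBlDr// -EFinB => /(@lee_wpmul2l _ (x n ^+ (2 * k))%:E).
  rewrite lee_fin => /(_ rate0).
  rewrite root_rate -/(x n); apply: le_trans; rewrite -EFinM lee_fin.
  apply: le_trans (lower_rate_bound k_ge1 r_gt0 c0 n0 p1 eta0 eta1 C0).
  rewrite -/P -/kappa -/(x n) -/B.
  have : B * (x n)^-1 <= e / 2 by rewrite mulrC -ler_pdivlMr.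
  lra.
by apply: ereal_squeeze => e e0; apply: filterS2 (lower e e0) (upper e e0) => n -> ->.
Unshelve. all: by end_near. Qed.
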